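(* Let $K\subset\mathbb C$ be a subfield and let $\mathbf G=\mathbf G_1\times\mathbf G_2\times\cdots\times\mathbf G_r$ be a direct product of Zariski connected non-abelian linear algebraic groups defined over $K$ that are $K$-indecomposable and have torsion-free centers $Z(\mathbf G_i)(\mathbb C)$. Then $\mathbf G$ satisfies the Central Mixing Property on $K$-automorphisms, that is: every $K$-automorphism $\Phi$ of $\mathbf G$ factorizes as $\Phi=\Theta\cdot\Psi$ (pointwise product, $x\mapsto\Theta(x)\Psi(x)$), where (A) $\Theta$ is a $K$-automorphism of $\mathbf G$ and there is a unique permutation $\sigma\in\mathcal S_r$ such that $\Theta$ maps each factor $\mathbf G_i$ onto an isomorphic factor $\mathbf G_{\sigma(i)}$; and (B) $\Psi$ is a $K$-endomorphism of $\mathbf G$ with $\Psi(\mathbf G)\subset Z(\mathbf G)$ and $\pi_{\sigma(i)}(\Psi(\mathbf G_i))=\{e\}$ for every $i$. Conversely, for any pair $(\Theta,\Psi)$ satisfying (A) and (B), the map $\Phi:=\Theta\cdot\Psi$ is a $K$-automorphism of $\mathbf G$.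
   Context: A linear algebraic group defined over $K$ (a $K$-group) is a subgroup $\mathbf G\subset\operatorname{GL}_n(\mathbb C)$ that is the zero set of finitely many polynomials over $K$, with the Zariski topology. A $K$-morphism (resp. $K$-endomorphism) of $K$-groups is a morphism (resp. endomorphism) of algebraic groups defined over $K$; a $K$-automorphism is a bijective $K$-endomorphism (in characteristic $0$ its inverse is automatically defined over $K$). $\mathbf G$ is $K$-indecomposable if it cannot be written as a direct product of two non-trivial closed $K$-subgroups. $Z(\mathbf G)(\mathbb C)$ is the group of complex points of the center. $\pi_j\colon\mathbf G\to\mathbf G_j$ is the projection and $\mathcal S_r$ is the symmetric group on $r$ letters. *)

(* Defs.v *)
From HB Require Import structures.
From mathcomp Require Import all_boot all_order all_fingroup all_algebra.
From mathcomp Require Import complex mpoly.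
From mathcomp Require Import boolp classical_sets functions reals.
From mathcomp Require Import topology_structure connected.

Set Implicit Arguments.
Unset Strict Implicit.
Unset Printing Implicit Defensive.

Import GRing.Theory.
Local Open Scope classical_set_scope.
Local Open Scope ring_scope.

(* The complex numbers are R[i] for R : realType.  A subfield K of R[i] is a  *)
(* predicate closed under 1, subtraction and division ([divringClosed R[i]]). *)
(* An algebraic group is identified with its set of complex points, a subset  *)
(* of GL_n(R[i]) and hence of 'M[R[i]]_n.  The size n = 0 is allowed (GL_0 is *)
(* trivial), so the unit is written 1%:M and the product *m.                  *)

Definition mxeval (R : realType) (n : nat) (p : {mpoly R[i][n * n]})
    (x : 'M[R[i]]_n) : R[i] :=
  p.@[fun k => mxvec x ord0 k].

Definition zero_locus (R : realType) (n : nat)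
    (S : set {mpoly R[i][n * n]}) : set 'M[R[i]]_n :=
  [set x | forall p, S p -> mxeval p x = 0].

(* 'M[R[i]]_n with the Zariski topology.  The topology this induces on        *)
(* GL_n(R[i]) is the usual one, since p / det ^+ k and p vanish at the same   *)
(* invertible matrices.                                                       *)
Definition zariski (R : realType) (n : nat) : Type := 'M[R[i]]_n.

HB.instance Definition _ (R : realType) (n : nat) :=
  Choice.copy (zariski R n) 'M[R[i]]_n.

Definition zariski_open (R : realType) (n : nat)
    (U : set (zariski R n)) : Prop :=
  exists S : set {mpoly R[i][n * n]}, U = ~` zero_locus S.

Lemma zariski_openT (R : realType) (n : nat) :
  zariski_open [set: zariski R n].
Proof.
exists [set 1]; apply/seteqP; split=> // x _ /= /(_ 1 erefl).
by rewrite /mxeval meval1 => /eqP; rewrite oner_eq0.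
Qed.

Lemma zariski_openI (R : realType) (n : nat) :
  setI_closed (@zariski_open R n).
Proof.
move=> _ _ [S ->] [T ->].
exists [set p * q | p in S & q in T]; rewrite -setCU; congr (~` _).
apply/seteqP; split=> [x [Sx|Tx] _ [p Sp] [q Tq] <-|x STx].
- by rewrite /mxeval mevalM -/(mxeval p x) Sx// mul0r.
- by rewrite /mxeval mevalM -/(mxeval q x) Tx// mulr0.
apply: contrapT => /not_orP[/existsNP[p /not_implyP[Sp px]]].
move=> /existsNP[q /not_implyP[Tq qx]].
have : mxeval (p * q) x = 0 by apply: STx; exists p => //; exists q.
by rewrite /mxeval mevalM => /eqP; rewrite mulf_eq0 => /orP[] /eqP.
Qed.

Lemma zariski_open_bigU (R : realType) (n : nat) (I : Type)
    (f : I -> set (zariski R n)) :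
  (forall i, zariski_open (f i)) -> zariski_open (\bigcup_i f i).
Proof.
move=> /choice[S fS]; exists (\bigcup_i S i); apply/seteqP; split=> [x [i _]|x].
  by rewrite fS => nSx Ux; apply: nSx => p Sp; apply: Ux; exists i.
move=> /existsNP[p /not_implyP[[i _ Sp] px]]; exists i => //.
by rewrite fS => /(_ p Sp).
Qed.

HB.instance Definition _ (R : realType) (n : nat) :=
  isOpenTopological.Build (zariski R n)
    (@zariski_openT R n) (@zariski_openI R n) (@zariski_open_bigU R n).

Definition zariski_connected (R : realType) (n : nat)
    (G : set 'M[R[i]]_n) : Prop :=
  connected (G : set (zariski R n)).

Definition K_group (R : realType) (K : divringClosed R[i]) (n : nat)
    (G : set 'M[R[i]]_n) : Prop :=
  [/\ exists2 s : seq {mpoly R[i][n * n]},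
        {in s, forall p, p \is a mpolyOver (n * n) K}
        & G = [set x | x \in unitmx] `&` zero_locus [set p | p \in s],
      G 1%:M,
      forall x y, G x -> G y -> G (x *m y)
    & forall x, G x -> G (invmx x)].

(* The K-regular functions on G are the restrictions to G of the elements of  *)
(* K[x_11, ..., x_nn, 1 / det].                                               *)
Definition K_regular (R : realType) (K : divringClosed R[i]) (n : nat)
    (G : set 'M[R[i]]_n) (f : 'M[R[i]]_n -> R[i]) : Prop :=
  exists (p : {mpoly R[i][n * n]}) (k : nat),
    p \is a mpolyOver (n * n) K /\
    forall x, G x -> f x = mxeval p x / \det x ^+ k.

(* Morphisms are total functions on matrices of which only the values on G    *)
(* matter.                                                                    *)
Definition K_morphism (R : realType) (K : divringClosed R[i]) (m n : nat)
    (G : set 'M[R[i]]_m) (H : set 'M[R[i]]_n)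
    (f : 'M[R[i]]_m -> 'M[R[i]]_n) : Prop :=
  [/\ set_fun G H f,
      forall x y, G x -> G y -> f (x *m y) = f x *m f y
    & forall i j, K_regular K G (fun x => f x i j)].

(* No condition on the inverse: in characteristic 0 the inverse of a          *)
(* bijective K-morphism of K-groups is automatically a K-morphism.            *)
Definition K_isomorphism (R : realType) (K : divringClosed R[i]) (m n : nat)
    (G : set 'M[R[i]]_m) (H : set 'M[R[i]]_n)
    (f : 'M[R[i]]_m -> 'M[R[i]]_n) : Prop :=
  K_morphism K G H f /\ set_bij G H f.

Definition K_isomorphic (R : realType) (K : divringClosed R[i]) (m n : nat)
    (G : set 'M[R[i]]_m) (H : set 'M[R[i]]_n) : Prop :=
  exists f, K_isomorphism K G H f.

Definition K_endomorphism (R : realType) (K : divringClosed R[i]) (n : nat)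
    (G : set 'M[R[i]]_n) (f : 'M[R[i]]_n -> 'M[R[i]]_n) : Prop :=
  K_morphism K G G f.

Definition K_automorphism (R : realType) (K : divringClosed R[i]) (n : nat)
    (G : set 'M[R[i]]_n) (f : 'M[R[i]]_n -> 'M[R[i]]_n) : Prop :=
  K_isomorphism K G G f.

Definition abelian_set (R : realType) (n : nat) (G : set 'M[R[i]]_n) : Prop :=
  forall x y, G x -> G y -> x *m y = y *m x.

Definition alg_center (R : realType) (n : nat) (G : set 'M[R[i]]_n) :
    set 'M[R[i]]_n :=
  [set z | G z /\ forall x, G x -> z *m x = x *m z].

Definition torsion_free (R : realType) (n : nat) (G : set 'M[R[i]]_n) : Prop :=
  forall x (m : nat), G x -> (0 < m)%N -> x ^+ m = 1%:M -> x = 1%:M.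

Definition is_internal_product (R : realType) (n : nat)
    (G H1 H2 : set 'M[R[i]]_n) : Prop :=
  [/\ H1 `&` H2 = [set 1%:M],
      forall x y, H1 x -> H2 y -> x *m y = y *m x
    & G = [set x *m y | x in H1 & y in H2]].

Definition K_indecomposable (R : realType) (K : divringClosed R[i]) (n : nat)
    (G : set 'M[R[i]]_n) : Prop :=
  forall H1 H2 : set 'M[R[i]]_n,
    K_group K H1 -> K_group K H2 -> is_internal_product G H1 H2 ->
    H1 = [set 1%:M] \/ H2 = [set 1%:M].

(* G_1 x ... x G_r, realized as block-diagonal matrices of size               *)
(* n_1 + ... + n_r.                                                           *)
Definition alg_product (R : realType) (r : nat) (n : 'I_r -> nat)
    (G : forall i, set 'M[R[i]]_(n i)) : set 'M[R[i]]_(\sum_i n i) :=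
  [set x | exists2 B : forall i, 'M[R[i]]_(n i),
     forall i, G i (B i) & x = mxdiag B].

Definition alg_factor (R : realType) (r : nat) (n : 'I_r -> nat)
    (G : forall i, set 'M[R[i]]_(n i)) (i : 'I_r) :
    set 'M[R[i]]_(\sum_i n i) :=
  [set x | exists B : forall j, 'M[R[i]]_(n j),
     [/\ G i (B i), forall j, j != i -> B j = 1%:M & x = mxdiag B]].

Definition alg_proj (R : realType) (r : nat) (n : 'I_r -> nat) (j : 'I_r)
    (x : 'M[R[i]]_(\sum_i n i)) : 'M[R[i]]_(n j) :=
  submxblock x j j.

Definition permutes_factors (R : realType) (K : divringClosed R[i]) (r : nat)
    (n : 'I_r -> nat) (G : forall i, set 'M[R[i]]_(n i))
    (Theta : 'M[R[i]]_(\sum_i n i) -> 'M[R[i]]_(\sum_i n i))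
    (sigma : 'S_r) : Prop :=
  forall i, Theta @` alg_factor G i = alg_factor G (sigma i) /\
            K_isomorphic K (G i) (G (sigma i)).

Definition mixing_part (R : realType) (K : divringClosed R[i]) (r : nat)
    (n : 'I_r -> nat) (G : forall i, set 'M[R[i]]_(n i))
    (Theta : 'M[R[i]]_(\sum_i n i) -> 'M[R[i]]_(\sum_i n i))
    (sigma : 'S_r) : Prop :=
  K_automorphism K (alg_product G) Theta /\
  unique (permutes_factors K G Theta) sigma.

Definition central_part (R : realType) (K : divringClosed R[i]) (r : nat)
    (n : 'I_r -> nat) (G : forall i, set 'M[R[i]]_(n i))
    (Psi : 'M[R[i]]_(\sum_i n i) -> 'M[R[i]]_(\sum_i n i))
    (sigma : 'S_r) : Prop :=
  [/\ K_endomorphism K (alg_product G) Psi,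
      Psi @` alg_product G `<=` alg_center (alg_product G)
    & forall i,
        @alg_proj R r n (sigma i) @` (Psi @` alg_factor G i) = [set 1%:M]].

(* Main.v *)
From HB Require Import structures.
Require Import Defs.
From mathcomp Require Import all_boot all_order all_fingroup all_algebra.
From mathcomp Require Import complex mpoly ring.
From mathcomp Require Import boolp classical_sets functions reals.

(** Write P for the product, Z for its center and F_i for the copy of G_i in
    P. Two facts about an automorphism Phi carry the theorem: for given i and j,
    the component of Phi(F_i) in F_j is central or all its other components are
    ([factor_dichotomy]); and an endomorphism with central values is trivial on
    Z ([central_endomorphism_kills_center]). Both are proved by exhibiting F_i
    as a direct product of two K-subgroups, one of which must then be trivial.

    Constructing K-subgroups requires linear algebra on Z. A closed subgroup of
    GL_n without torsion is unipotent ([torsion_free_unipotent]), and the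
    logarithm identifies a commutative unipotent group with a vector group. So Z
    has K-regular coordinates in which it is C^m and every K-endomorphism that
    preserves Z acts linearly by a matrix over K ([exists_center_coordinates]);
    kernels, images and complements of such matrices define K-subgroups of Z.
    Everything about rationality over K comes from one principle: what all
    automorphisms of C over K fix is defined over K. This rests on the
    existence, for c outside K, of an automorphism of C over K that moves c
    ([exists_automorphism]).

    For the dichotomy, let p be the projection of P onto F_i and let q, q' be
    the projections of P onto the inverse images under Phi of F_j and of the
    product of the other factors. For x in F_i the element q' (p (q x)) is
    central, because p (q x) commutes with the image of q'. The map z |->
    p (q z) on Z has a matrix A over K and p o q' has matrix 1 - A on Z(F_i).
    Let S1 and S0 be the parts of Z(F_i) on which A is invertible and nilpotent.
    Then p o q is bijective on S1 and p o q' on S0, and correcting p (q x) and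
    p (q' x) by elements of S0 and S1 splits F_i as the product of { x | q' x
    central, p (q' x) in S1 } and { x | q x central, p (q x) in S0 }
    ([fitting_splitting]). If the first is trivial then q is central on F_i; if
    the second is trivial then q' is.

    If Psi has central values, choose in Z a complement over K of the image of
    Z(F_i) under Psi. Then F_i is the product of the subgroup that Psi sends
    into this complement and of a subgroup of Z(F_i) that Psi maps
    isomorphically onto the image. The first is not trivial, since F_i is not
    abelian, so the second is, and Psi kills Z(F_i).

    As F_i is not abelian, Phi(F_i) is not central, so for each i the second
    alternative of the dichotomy holds for some j = sigma(i); surjectivity of
    Phi makes sigma surjective ([factor_permutation]). Separating Phi(F_i) into
    its component in F_sigma(i) and the other ones gives Phi = Theta . Psi with
    Psi central. Multiplying an automorphism by a central endomorphism h gives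
    an automorphism ([central_twist]), since h is trivial on Z: this is the
    converse, and applied to h = Psi^-1 it shows that Theta = Phi . Psi^-1 is an
    automorphism. *)

Set Implicit Arguments.
Unset Strict Implicit.
Unset Printing Implicit Defensive.

Import GRing.Theory Num.Theory.
Local Open Scope classical_set_scope.
Local Open Scope ring_scope.

(** * Automorphisms of an algebraically closed field over a subfield *)

Lemma Zorn_above (T : Type) (P : set (set T)) (A0 : set T) :
  P A0 ->
  (forall F, F !=set0 -> F `<=` P -> total_on F subset ->
     P (\bigcup_(X in F) X)) ->
  exists A, [/\ A0 `<=` A, P A & forall B, A `<=` B -> P B -> B `<=` A].
Proof.
move=> PA0 Pchain; pose P' X := P (A0 `|` X).
have [F FP Ftot|A [P'A Amax]] := @Zorn_bigcup T P'.
  have [->|/set0P[X0 FX0]] := eqVneq F set0.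
    by rewrite /P' bigcup_set0 setU0.
  rewrite /P' (_ : _ `|` _ = \bigcup_(Y in [set A0 `|` X | X in F]) Y).
    apply: Pchain; first by exists (A0 `|` X0); exists X0.
      by move=> _ [X FX <-]; exact: FP.
    move=> _ _ [X FX <-] [Y FY <-].
    by have [XY|YX] := Ftot _ _ FX FY; [left|right]; apply: setUS.
  apply/seteqP; split=> [x [A0x|[X FX Xx]]|x [_ [X FX <-] [A0x|Xx]]].
  - by exists (A0 `|` X0); [exists X0|left].
  - by exists (A0 `|` X); [exists X|right].
  - by left.
  - by right; exists X.
exists (A0 `|` A); split=> // B; rewrite subUset => -[A0B AB] PB.
apply: contrapT => nBA; apply: (Amax B); last by rewrite /P' setUidr.
by split=> // BA; apply: nBA => x /BA; right.
Qed.

Section Subfields.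
Variable A : unitRingType.

(** The ring need not be a field: it is also used for a product C * C,
    whose inverse is the identity on non-units. *)
Definition subfield_set (F : set A) : Prop :=
  [/\ F 1, forall x y, F x -> F y -> F (x - y)
    & forall x y, F x -> F y -> F (x / y)].

Lemma subfield_set_pred (F : set A) : subfield_set F ->
  exists S : divringClosed A, forall x, (x \in S) = `[< F x >].
Proof.
move=> [F1 FB FV].
have FD : divring_closed [pred x | `[< F x >]].
  split=> [|x y /asboolP Fx /asboolP Fy|x y /asboolP Fx /asboolP Fy].
  - exact/asboolP.
  - by apply/asboolP; exact: FB.
  - by apply/asboolP; exact: FV.
pose D : {pred A} := [pred x | `[< F x >]].
pose S : divringClosed A := HB.pack D (GRing.isDivringClosed.Build A D FD).
by exists S.
Qed.

Lemma subfield_set_of (S : divringClosed A) : subfield_set [set x | x \in S].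
Proof.
split=> [|x y|x y] /=; [exact: rpred1|exact: rpredB|exact: rpred_div].
Qed.

Lemma subfield_bigcup (F : set (set A)) : F !=set0 ->
  F `<=` subfield_set -> total_on F subset ->
  subfield_set (\bigcup_(X in F) X).
Proof.
move=> [X0 FX0] Fs Ftot; split.
- by exists X0 => //; have [] := Fs _ FX0.
- move=> x y [X FX Xx] [Y FY Yy]; have [XY|YX] := Ftot _ _ FX FY.
    by exists Y => //; have [_ + _] := Fs _ FY; apply => //; exact: XY.
  by exists X => //; have [_ + _] := Fs _ FX; apply => //; exact: YX.
- move=> x y [X FX Xx] [Y FY Yy]; have [XY|YX] := Ftot _ _ FX FY.
    by exists Y => //; have [_ _] := Fs _ FY; apply => //; exact: XY.
  by exists X => //; have [_ _] := Fs _ FX; apply => //; exact: YX.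
Qed.

End Subfields.

Section PartialIsomorphisms.
Variable C : numClosedFieldType.
Local Notation CC := (C * C)%type.

(** The graph of an isomorphism between two subfields of C is a subring of
    C * C in which the two coordinates of an element vanish together. Extending
    isomorphisms becomes enlarging such subsets, to which Zorn's lemma applies
    without gluing functions. *)
Definition partial_iso (F : set CC) : Prop :=
  subfield_set F /\ forall z, F z -> (z.1 = 0 <-> z.2 = 0).

Lemma pair_unit (z : CC) : z.1 != 0 -> z.2 != 0 -> z \is a GRing.unit.
Proof.
case: z => a b /= a0 b0; apply/unitrPr; exists (a^-1, b^-1).
by apply/eqP; rewrite xpair_eqE /= !divff ?eqxx.
Qed.

Lemma partial_iso_unit F z : partial_iso F -> F z -> z != 0 ->
  z \is a GRing.unit.
Proof.
move=> [_ F0] /F0[z12 z21] zn0; apply: pair_unit; apply: contra_neq zn0.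
  by move=> a0; case: z a0 z12 {z21} => a b /= -> /(_ erefl) ->.
by move=> b0; case: z b0 z21 {z12} => a b /= -> /(_ erefl) ->.
Qed.

Section Division.
Variables (S : divringClosed CC) (pi : {rmorphism CC -> C}) (a : C).
Hypothesis S_unit : {in S, forall z, z != 0 -> z \is a GRing.unit}.

Local Notation vanishes P := ((map_poly pi P).[a] = 0).

(** The coefficients lie in a field S inside C * C, but C * C is not an
    integral domain, so the division by N is carried out directly; it only
    needs the leading coefficients in S to be invertible. *)
Lemma minimal_poly (P0 : {poly CC}) :
  P0 \is a polyOver S -> P0 != 0 -> vanishes P0 ->
  exists N : {poly CC}, [/\ N \is a polyOver S, N \is monic /\ (1 < size N)%N,
    vanishes N,
    forall P, P \is a polyOver S -> P != 0 -> vanishes P ->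
      (size N <= size P)%N
    & forall P, P \is a polyOver S -> vanishes P ->
      exists2 A, A \is a polyOver S & P = A * N].
Proof.
move=> SP0 P0n0 P0a.
pose good P := [/\ P \is a polyOver S, P != 0 & vanishes P].
have [|n /asboolP[P1 [[SP1 P1n0 P1a] sP1]] nmin] :=
    @ex_minnP (fun n => `[< exists P, good P /\ size P = n >]).
  by exists (size P0); apply/asboolP; exists P0.
have S_lead P : P \is a polyOver S -> lead_coef P \in S.
  by move=> /polyOverP/(_ (size P).-1).
have lP1 : lead_coef P1 \is a GRing.unit.
  by apply: S_unit; rewrite ?S_lead// lead_coef_eq0.
pose N := (lead_coef P1)^-1 *: P1.
have SN : N \is a polyOver S by rewrite polyOverZ ?rpredV ?S_lead.
have sN : size N = n by rewrite -sP1 lreg_size//; apply: mulrI; rewrite unitrV.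
have lN : lead_coef N = 1.
  by rewrite lead_coefE sN -sP1 coefZ -lead_coefE mulVr.
have Na : vanishes N by rewrite map_polyZ hornerZ P1a mulr0.
have Nmin P : P \is a polyOver S -> P != 0 -> vanishes P ->
    (size N <= size P)%N.
  by move=> SP Pn0 Pa; rewrite sN; apply: nmin; apply/asboolP; exists P.
have mN : N \is monic by apply/eqP.
exists N; split=> //.
  split=> //; rewrite ltnNge; apply/negP => /size1_polyC NC.
  have N1 : N = 1 by rewrite NC -[N`_0]lead_coefC -NC lN.
  by move: Na; rewrite N1 rmorph1 hornerC => /eqP; rewrite oner_eq0.
move=> P; have [k] := ubnP (size P); elim: k P => // k IH P sP SP Pa.
have [->|Pn0] := eqVneq P 0; first by exists 0; rewrite ?rpred0// mul0r.
have sNP := Nmin _ SP Pn0 Pa.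
pose A0 := lead_coef P *: 'X^(size P - size N).
have SA0 : A0 \is a polyOver S by rewrite polyOverZ ?S_lead ?polyOverXn.
have [|||A SA defP] := IH (P - A0 * N).
- apply: (@leq_ltn_trans (size P).-1); last first.
    by rewrite prednK ?lt0n ?size_poly_eq0.
  apply/leq_sizeP => j jP; rewrite coefB -scalerAl coefZ coefXnM.
  have sN0 : (0 < size N)%N.
    by rewrite lt0n size_poly_eq0 -lead_coef_eq0 lN oner_eq0.
  rewrite ltnNge (leq_trans _ jP) /=; last first.
    by rewrite -ltnS prednK ?lt0n ?size_poly_eq0//
      ltn_subrL sN0/= lt0n size_poly_eq0.
  move: jP; rewrite leq_eqVlt => /orP[/eqP <-|].
    rewrite -subn1 subnAC subKn// !subn1 -!lead_coefE lN mulr1.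
    by rewrite subrr.
  rewrite prednK ?lt0n ?size_poly_eq0// => Pj.
  rewrite !nth_default ?mulr0 ?subrr//.
  by rewrite leq_subRL ?subnK// (leq_trans (leq_subr _ _)).
- by rewrite rpredB ?rpredM.
- by rewrite rmorphB/= hornerD hornerN rmorphM/= hornerM Na Pa mulr0 subrr.
- by exists (A + A0); rewrite ?rpredD// mulrDl -defP subrK.
Qed.

End Division.

Lemma horner_fst (P : {poly CC}) x y : (P.[(x, y)]).1 = (map_poly fst P).[x].
Proof. exact: (esym (horner_map (fst : {rmorphism CC -> C}) P (x, y))). Qed.

Lemma horner_snd (P : {poly CC}) x y : (P.[(x, y)]).2 = (map_poly snd P).[y].
Proof. exact: (esym (horner_map (snd : {rmorphism CC -> C}) P (x, y))). Qed.

Lemma pair_div (z w : CC) : w.1 != 0 -> w.2 != 0 ->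
  z / w = (z.1 / w.1, z.2 / w.2).
Proof.
move=> w1 w2; have wU := pair_unit w1 w2; apply: (mulIr wU).
rewrite divrK//; case: z w w1 w2 {wU} => [a b] [c d] /= c0 d0.
by apply/eqP; rewrite xpair_eqE /= !divfK ?eqxx.
Qed.

(** If x and y are roots of corresponding polynomials, then Q(x) / R(x) |->
    Q(y) / R(y) is a well-defined isomorphism; its graph is the set of values
    at (x, y) of the fractions over S. *)
Lemma partial_iso_adjoin (S : divringClosed CC) (x y : C) :
  (forall Q, Q \is a polyOver S ->
     (map_poly fst Q).[x] = 0 <-> (map_poly snd Q).[y] = 0) ->
  exists F, [/\ partial_iso F, [set z | z \in S] `<=` F & F (x, y)].
Proof.
move=> xy.
pose F := [set z : CC | exists Q R, [/\ Q \is a polyOver S,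
  R \is a polyOver S, R.[(x, y)].1 != 0 /\ R.[(x, y)].2 != 0
  & z = Q.[(x, y)] / R.[(x, y)]]].
have FS : forall Q, Q \is a polyOver S -> F Q.[(x, y)].
  move=> Q SQ; exists Q, 1; rewrite SQ rpred1 hornerC divr1 /=.
  by split=> //; rewrite oner_eq0.
have Feq0 Q : Q \is a polyOver S -> Q.[(x, y)].1 = 0 <-> Q.[(x, y)].2 = 0.
  by move=> SQ; rewrite horner_fst horner_snd; exact: xy.
have F0 z : F z -> (z.1 = 0 <-> z.2 = 0).
  move=> [Q [R [SQ SR [R1 R2] ->]]]; rewrite pair_div//=.
  have [f g] := Feq0 _ SQ; split=> /eqP; rewrite mulf_eq0 invr_eq0.
    by rewrite (negPf R1) orbF => /eqP/f ->; rewrite mul0r.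
  by rewrite (negPf R2) orbF => /eqP/g ->; rewrite mul0r.
exists F; split.
- split=> //; split.
  + by rewrite -[X in F X](hornerC 1 (x, y)); apply: FS; rewrite rpred1.
  + move=> _ _ [Q [R [SQ SR [R1 R2] ->]]] [Q' [R' [SQ' SR' [R1' R2'] ->]]].
    exists (Q * R' - Q' * R), (R * R'); rewrite rpredB ?rpredM//.
    rewrite hornerD hornerN !hornerM /= !mulf_eq0 !negb_or R1 R2 R1' R2'.
    split=> //; rewrite invrM ?pair_unit// mulrBl !mulrA.
    by rewrite mulrK ?pair_unit// [_ * R.[_]]mulrC -!mulrA [R.[_] * _]mulrC
      -!mulrA mulVr ?pair_unit// mulr1.
  + move=> _ _ [Q [R [SQ SR [R1 R2] ->]]] [Q' [R' [SQ' SR' [R1' R2'] ->]]].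
    have [Q1'|Q1'] := eqVneq Q'.[(x, y)].1 0.
      have /eqP Q0' : Q'.[(x, y)] == 0.
        by rewrite -pair_eqE /= Q1' (Feq0 _ SQ').1 ?eqxx.
      rewrite Q0' mul0r invr0 mulr0 -[X in F X](horner0 (x, y)).
      by apply: FS; rewrite rpred0.
    have Q2' : Q'.[(x, y)].2 != 0.
      by apply: contra_neq Q1' => Q2'; apply/(Feq0 _ SQ').
    exists (Q * R'), (R * Q'); rewrite !rpredM// !hornerM /= !mulf_eq0.
    rewrite !negb_or R1 R2 Q1' Q2'; split=> //.
    rewrite invrM ?unitrV ?pair_unit// invrK invrM ?pair_unit//.
    by rewrite -!mulrA; congr (_ * _); rewrite mulrCA; congr (_ * _);
      exact: mulrC.
- move=> z Sz /=; rewrite -[z](hornerC z (x, y)); apply: FS.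
  by rewrite polyOverC.
- by rewrite -[X in F X](hornerX (x, y)); apply: FS; rewrite polyOverX.
Qed.

Lemma partial_iso_pred F : partial_iso F ->
  exists2 S : divringClosed CC, [set z | z \in S] = F
    & {in S, forall z, z != 0 -> z \is a GRing.unit}.
Proof.
move=> Fiso; have [S SF] := subfield_set_pred Fiso.1; exists S.
  by apply/seteqP; split=> z /=; rewrite SF => /asboolP.
by move=> z; rewrite SF => /asboolP Fz; exact: partial_iso_unit Fz.
Qed.

(** Any root y of the polynomial that corresponds to the minimal polynomial
    N of x can serve as the image of x: a polynomial over S of smaller degree
    with root y would produce a proper factor of N with root x. *)
Lemma partial_iso_extend (S : divringClosed CC) (P0 : {poly CC}) x :
  {in S, forall z, z != 0 -> z \is a GRing.unit} ->
  P0 \is a polyOver S -> P0 != 0 -> (map_poly fst P0).[x] = 0 ->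
  exists N : {poly CC}, [/\ N \is a polyOver S, N \is monic /\ (1 < size N)%N,
    (map_poly fst N).[x] = 0,
    forall P, P \is a polyOver S -> P != 0 -> (map_poly fst P).[x] = 0 ->
      (size N <= size P)%N
    & forall y, (map_poly snd N).[y] = 0 ->
      exists F, [/\ partial_iso F, [set z | z \in S] `<=` F & F (x, y)]].
Proof.
move=> S_unit SP0 P0n0 P0x.
have [N [SN [mN sN] Nx Nmin Ndiv]] :=
  @minimal_poly S (fst : {rmorphism CC -> C}) x S_unit _ SP0 P0n0 P0x.
exists N; split=> // y Ny; apply: (@partial_iso_adjoin S).
have Nn0 : N != 0 by rewrite monic_neq0.
have [M [SM [mM sM] My _ Mdiv]] :=
  @minimal_poly S (snd : {rmorphism CC -> C}) y S_unit _ SN Nn0 Ny.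
(* Write N = A M. The polynomial A cannot vanish at x, since its degree is
   smaller than that of N; so M vanishes at x. *)
have Mx : (map_poly fst M).[x] = 0.
  have [A SA defN] := Mdiv _ SN Ny.
  have An0 : A != 0 by apply: contra_neq Nn0; rewrite defN => ->; rewrite mul0r.
  move: Nx; rewrite defN rmorphM hornerM => /eqP; rewrite mulf_eq0.
  case/orP => /eqP //  /(Nmin _ SA An0).
  rewrite defN size_Mmonic// -subn1 leq_subLR addnC leq_add2r.
  by rewrite leqNgt sM.
move=> Q SQ; split=> [/(Ndiv _ SQ)|/(Mdiv _ SQ)] [A _ ->].
  by rewrite rmorphM hornerM Ny mulr0.
by rewrite rmorphM hornerM Mx mulr0.
Qed.

Definition swap_set (F : set CC) : set CC := [set z | F (z.2, z.1)].

Lemma partial_iso_swap F : partial_iso F -> partial_iso (swap_set F).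
Proof.
move=> Fiso; have [[F1 FB FV] F0] := Fiso; split; last first.
  by move=> [a b] /= /F0 /= ab; split=> /ab.
split=> [//|[a b] [c d] /= ab cd|[a b] [c d] /= ab cd].
  by have := FB (b, a) (d, c) ab cd.
have [c0|c0] := eqVneq c 0.
  have d0 : d = 0 by apply/(F0 (d, c) cd).
  have -> : (c, d) = 0 by rewrite c0 d0.
  rewrite invr0 mulr0 /swap_set /=.
  by move: (FB _ _ F1 F1); rewrite subrr.
have d0 : d != 0 by apply: contra_neq c0 => d0; apply/(F0 (d, c) cd).
rewrite pair_div//= /swap_set /=.
by have := FV (b, a) (d, c) ab cd; rewrite pair_div.
Qed.

Definition adjoin (E : divringClosed C) (x : C) : set C :=
  [set z | exists Q R, [/\ Q \is a polyOver E, R \is a polyOver E,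
                           R.[x] != 0 & z = Q.[x] / R.[x]]].

Lemma adjoin_subfield E x : subfield_set (adjoin E x).
Proof.
split.
- by exists 1, 1; rewrite rpred1 hornerC divr1 oner_eq0.
- move=> _ _ [Q [R [SQ SR R0 ->]]] [Q' [R' [SQ' SR' R0' ->]]].
  exists (Q * R' - Q' * R), (R * R'); rewrite rpredB ?rpredM//.
  rewrite hornerD hornerN !hornerM mulf_eq0 negb_or R0 R0'; split=> //.
  by field; rewrite ?R0 ?R0'.
- move=> _ _ [Q [R [SQ SR R0 ->]]] [Q' [R' [SQ' SR' R0' ->]]].
  have [Q0'|Q0'] := eqVneq Q'.[x] 0.
    by exists 0, 1; rewrite rpred0 rpred1 horner0 hornerC oner_eq0 Q0' !mul0r
      invr0 mulr0.
  exists (Q * R'), (R * Q'); rewrite !rpredM// !hornerM mulf_eq0 negb_or R0 Q0'.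
  by split=> //; field; rewrite ?R0 ?Q0' ?R0'.
Qed.

Lemma adjoin_sub (E : divringClosed C) x : [set z | z \in E] `<=` adjoin E x.
Proof.
move=> z Ez; exists z%:P, 1.
by rewrite rpred1 polyOverC !hornerC divr1 oner_eq0.
Qed.

Lemma adjoin_gen (E : divringClosed C) x : adjoin E x x.
Proof.
by exists 'X, 1; rewrite rpred1 polyOverX hornerX hornerC divr1 oner_eq0.
Qed.

(** Over such an E the field C is algebraic ([avoiding_algebraic]), so that
    partial isomorphisms over E can be extended to all of C by adjoining
    algebraic elements only. *)
Lemma maximal_subfield_avoiding (K : divringClosed C) c : c \notin K ->
  exists E : divringClosed C, [/\ {subset K <= E}, c \notin E
    & forall x, x \notin E -> adjoin E x c].
Proof.
move=> Kc; pose P F := subfield_set F /\ ~ F c.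
have [||E0 [KE0 [E0f E0c] E0max]] := @Zorn_above C P [set z | z \in K].
- by split; [exact: subfield_set_of|move=> /=; exact/negP].
- move=> F F0 FP Ftot; split; last by move=> [X /FP[_ nXc] Xc].
  by apply: subfield_bigcup => // X /FP[].
have [E defE] := subfield_set_pred E0f.
have EE z : z \in E <-> E0 z by rewrite defE; split=> /asboolP.
exists E; split.
- by move=> z Kz; apply/EE; exact: KE0.
- by apply/negP => /EE.
move=> x; apply: contraNP => xc; apply/EE; apply: E0max (adjoin_gen E x).
  by move=> z /EE; exact: adjoin_sub.
by split=> //; exact: adjoin_subfield.
Qed.

Lemma poly_nat_eq0 (p : {poly C}) : (forall k : nat, p.[k%:R] = 0) -> p = 0.
Proof.
move=> p0; apply/eqP; apply: contraT => pn0.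
have := @max_poly_roots _ p [seq k%:R | k <- iota 0 (size p)] pn0.
rewrite size_map size_iota ltnn; apply.
  by apply/allP => _ /mapP[k _ ->]; rewrite /root p0.
by rewrite map_inj_uniq ?iota_uniq//; exact: (@mulrIn C 1 (oner_neq0 _)).
Qed.

Section Avoiding.
Variables (E : divringClosed C) (c : C).
Hypotheses (Ec : c \notin E) (Emax : forall x, x \notin E -> adjoin E x c).

(** If c^2 is not in E, then c is in E(c^2), say c = Q(c^2) / R(c^2), and
    X R(X^2) - Q(X^2) is not zero because its odd part is X R(X^2). *)
Lemma avoiding_algebraic_c :
  exists m, [/\ m \is a polyOver E, m != 0 & m.[c] = 0].
Proof.
have [Ec2|/Emax[Q [R [SQ SR R0 defc]]]] := boolP (c ^+ 2 \in E).
  exists ('X^2 - (c ^+ 2)%:P); split.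
  - by apply: rpredB; rewrite ?polyOverXn ?polyOverC.
  - by rewrite monic_neq0 ?monicXnsubC.
  - by rewrite !hornerE subrr.
exists ('X * (R \Po 'X^2) - (Q \Po 'X^2)); split.
- by rewrite rpredB ?rpredM ?polyOver_comp ?polyOverXn ?polyOverX.
- apply: contra_neq R0 => /eqP; rewrite subr_eq0 => /eqP RQ.
  suff -> : R = 0 by rewrite horner0.
  apply/polyP => k; rewrite coef0.
  have := congr1 (fun p : {poly C} => p`_(k.*2.+1)) RQ.
  rewrite coefXM /= !coef_comp_poly_Xn// !dvdn2 /= odd_double /=.
  by rewrite -muln2 mulnK.
- rewrite hornerD hornerN hornerM hornerX !horner_comp hornerXn.
  by rewrite {1}defc divfK// subrr.
Qed.

(** Outside E, the element x satisfies c = Q(x) / R(x), and the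
    homogenization in Q and R of an equation m of c is an equation of x. *)
Lemma avoiding_algebraic x :
  exists m, [/\ m \is a polyOver E, m != 0 & m.[x] = 0].
Proof.
have [Ex|/Emax[Q [R [SQ SR R0 defc]]]] := boolP (x \in E).
  exists ('X - x%:P); split; first by rewrite rpredB ?polyOverX ?polyOverC.
    by rewrite polyXsubC_eq0.
  by rewrite hornerXsubC subrr.
have [m [Sm m0 mc]] := avoiding_algebraic_c.
pose d := (size m).-1.
pose M := \sum_(k < size m) m`_k *: (Q ^+ k * R ^+ (d - k)).
have ME y : R.[y] != 0 -> M.[y] = R.[y] ^+ d * m.[Q.[y] / R.[y]].
  move=> Ry; rewrite horner_sum [m.[_]]horner_coef mulr_sumr.
  apply: eq_bigr => k _; rewrite hornerZ hornerM !horner_exp [RHS]mulrCA.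
  congr (_ * _); rewrite expr_div_n [RHS]mulrCA; congr (_ * _).
  have kd : (k <= d)%N by rewrite -ltnS prednK ?ltn_ord// lt0n size_poly_eq0.
  by rewrite -[in RHS](subnK kd) exprD mulfK ?expf_neq0.
exists M; split.
- by apply: rpred_sum => k _; rewrite polyOverZ ?rpredM ?rpredX//
    (polyOverP Sm).
(* If the homogenized polynomial were zero, R . prod_r (Q - r R) over the
   roots r of m would vanish at all natural numbers; but Q = r R would make
   c = r a quotient of two coefficients in E. *)
- have [rs defm] := closed_field_poly_normal m.
  have QR r : Q - r *: R != 0.
    apply: contraNneq Ec => /eqP; rewrite subr_eq0 => /eqP QrR.
    have cr : c = r by rewrite defc QrR hornerZ mulfK.
    have lR : lead_coef R != 0.
      by rewrite lead_coef_eq0; apply: contra_neq R0 => ->; rewrite horner0.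
    suff -> : c = Q`_(size R).-1 / lead_coef R.
      by rewrite rpred_div ?(polyOverP SQ) ?(polyOverP SR).
    by rewrite QrR coefZ -cr mulfK.
  have Rn0 : R != 0 by apply: contra_neq R0 => ->; rewrite horner0.
  pose q := R * \prod_(r <- rs) (Q - r *: R).
  have : q != 0.
    by rewrite mulf_neq0// prodf_seq_neq0; apply/allP => r _; rewrite QR.
  apply: contra_neq => M0; apply: poly_nat_eq0 => k; apply/eqP.
  rewrite hornerM mulf_eq0; apply/orP; have [|Rk] := eqVneq R.[k%:R] 0;
    first by left.
  right; have := ME _ Rk; rewrite M0 horner0 => /esym/eqP.
  rewrite mulf_eq0 expf_eq0 (negPf Rk) andbF /= defm hornerZ mulf_eq0.
  rewrite lead_coef_eq0 (negPf m0) /= !horner_prod.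
  rewrite !prodf_seq_eq0 => /hasP[r rrs]; rewrite hornerXsubC /= => rk.
  apply/hasP; exists r => //=; rewrite !hornerE.
  by rewrite -(divfK Rk Q.[_]) -mulrBl mulf_eq0 rk.
- by rewrite ME// -defc mc mulr0.
Qed.
End Avoiding.

Lemma diagonal_partial_iso (E : divringClosed C) :
  partial_iso [set z : CC | z.1 \in E /\ z.1 = z.2].
Proof.
split=> [|z [_ ->] //]; split=> [|x y [Ex x12] [Ey y12]|x y [Ex x12] [Ey y12]].
- by split; rewrite //= rpred1.
- by split; rewrite /= ?rpredB// x12 y12.
- have [y0|y0] := eqVneq y.1 0.
    have -> : y = 0 by case: y y12 y0 {Ey} => a b /= <- ->.
    by rewrite invr0 mulr0; split; rewrite //= rpred0.
  rewrite pair_div ?x12 ?y12 -?y12//.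
  by split; rewrite //= -x12 rpred_div.
Qed.

Lemma size_map_monic (R S : nzRingType) (f : {rmorphism R -> S}) p :
  p \is monic -> size (map_poly f p) = size p.
Proof.
by move=> /monicP mp; rewrite size_map_poly_id0// mp rmorph1 oner_neq0.
Qed.

Lemma rmorphism_of (R S : pzRingType) (f : R -> S) :
  zmod_morphism f -> monoid_morphism f ->
  exists g : {rmorphism R -> S}, g =1 f.
Proof.
move=> fB fM; pose f' : R -> S := f.
pose g : {rmorphism R -> S} := HB.pack f'
  (GRing.isZmodMorphism.Build R S f' fB)
  (GRing.isMonoidMorphism.Build R S f' fM).
by exists g.
Qed.

(** Let E be a maximal subfield that contains K but not c. The minimal
    polynomial N of c over E has a root c' different from c; mapping c to c'
    gives a partial isomorphism over E, and a maximal one among those that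
    extend it is total in both directions. *)
Lemma exists_automorphism (K : divringClosed C) c : c \notin K ->
  exists s t : {rmorphism C -> C}, [/\ cancel s t, cancel t s,
    {in K, forall a, s a = a} & s c != c].
Proof.
move=> /maximal_subfield_avoiding[E [KE Ec Emax]].
have [m [Em m0 mc]] := avoiding_algebraic_c Emax.
have [D DE D_unit] := partial_iso_pred (diagonal_partial_iso E).
have DP z : (z \in D) <-> (z.1 \in E /\ z.1 = z.2).
  by have /= := congr1 (fun F : set CC => F z) DE => ->.
have diagE (p : {poly C}) : p \is a polyOver E ->
    exists2 P : {poly CC}, P \is a polyOver D
      & map_poly fst P = p /\ map_poly snd P = p.
  move=> Ep; exists (\poly_(i < size p) (p`_i, p`_i)).
    by apply: polyOver_poly => i _; apply/DP; rewrite /= (polyOverP Ep).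
  by split; apply/polyP => i; rewrite coef_map coef_poly /=;
    case: ltnP => // ?; rewrite nth_default.
have diagD P : P \is a polyOver D -> map_poly fst P = map_poly snd P.
  move=> DPP; apply/polyP => i; rewrite !coef_map /=.
  by have /DP[] := polyOverP DPP i.
have diag0 (P : {poly CC}) : map_poly fst P != 0 -> P != 0.
  by apply: contra_neq => ->; rewrite rmorph0.
have [P DP_ [P1 P2]] := diagE _ Em.
have [||N [DN [mN sN] Nc Nmin Next]] := @partial_iso_extend D P c D_unit DP_.
  by apply: diag0; rewrite P1.
  by rewrite P1.
(* If c were the only root, N would be (X - c)^d, whose coefficient - d c
   of degree d - 1 lies in E only if c does, in characteristic 0. *)
have [c' Nc' c'c] : exists2 c', (map_poly snd N).[c'] = 0 & c' != c.
  set n := map_poly snd N.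
  have mn : n \is monic by exact: monic_map.
  have sn : (1 < size n)%N by rewrite /n size_map_monic.
  have [rs] := closed_field_poly_normal n; rewrite (monicP mn) scale1r => defn.
  have [/allP rsc|/allPn[c' c'rs c'c]] := boolP (all (pred1 c) rs); last first.
    exists c' => //; apply/eqP; rewrite -/n defn horner_prod prodf_seq_eq0.
    by apply/hasP; exists c' => //=; rewrite hornerXsubC subrr.
  have srs : size rs != 0%N.
    by move: sn; rewrite defn size_prod_XsubC ltnS lt0n.
  have := coefPn_prod_XsubC srs; rewrite -defn.
  have -> : \sum_(p <- rs) p = c *+ size rs.
    rewrite big_seq (eq_bigr (fun=> c)) => [|i /rsc/eqP //].
    by rewrite -big_seq big_const_seq count_predT iter_addr_0.
  move=> ncoef; case/negP: Ec.
  rewrite -(mulfK (_ : (size rs)%:R != 0) c) ?pnatr_eq0// mulr_natr.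
  rewrite rpred_div ?rpred_nat// -[_ *+ _]opprK -ncoef rpredN.
  have /DP[] := polyOverP DN (size rs).-1.
  by rewrite /n -diagD// coef_map.
have [F0 [F0iso DF0 F0c]] := Next _ Nc'.
have [||F [F0F Fiso Fmax]] := @Zorn_above CC partial_iso F0 => //.
  move=> X Xn0 Xiso Xtot; split; first by apply: subfield_bigcup => //
    ? /Xiso[].
  by move=> z [Y /Xiso[_ Y0] Yz]; exact: Y0.
have DF z : z \in D -> F z by move=> Dz; apply: F0F; exact: DF0.
(* The argument depends on H only through maximality over E, so that it
   also applies to the inverse isomorphism. *)
have total H : [set z | z \in D] `<=` H -> partial_iso H ->
    (forall B, H `<=` B -> partial_iso B -> B `<=` H) ->
    forall x, exists y, H (x, y).
  move=> DH Hiso Hmax x.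
  have [S SH S_unit] := partial_iso_pred Hiso.
  have SP z : z \in S <-> H z by rewrite -SH.
  have [p [Ep p0 px]] := avoiding_algebraic Ec Emax x.
  have [Q DQ [Q1 Q2]] := diagE _ Ep.
  have [|||M [SM [mM sM] Mx _ Mext]] := @partial_iso_extend S Q x S_unit.
  - by apply: polyOverS DQ => z /DH/SP.
  - by apply: diag0; rewrite Q1.
  - by rewrite Q1.
  have /closed_rootP[y /eqP My] : size (map_poly snd M) != 1%N.
    by rewrite size_map_monic// neq_ltn sM orbT.
  have [B [Biso SB Bxy]] := Mext _ My.
  by exists y; apply: Hmax Bxy => // z /SP; exact: SB.
have [s sF] := choice (total F DF Fiso Fmax).
have /choice[t tF] : forall y, exists x, swap_set F (y, x).
  apply: total.
  - by move=> [a b] /DP[/= Ea ab]; apply: DF; apply/DP; rewrite /= -ab.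
  - exact: partial_iso_swap.
  - move=> B FB Biso [a b] Bab.
    apply: (Fmax (swap_set B)) => //; last exact: partial_iso_swap.
    by move=> [u v] Fuv; exact: FB.
have {}tF y : F (t y, y) by exact: tF.
have [[F1 FB FV] Feq0] := Fiso.
have Ffun x y y' : F (x, y) -> F (x, y') -> y = y'.
  move=> xy xy'; have := FB _ _ xy xy'; move/Feq0 => /=; rewrite subrr.
  by move=> [/(_ erefl) /eqP]; rewrite subr_eq0 => /eqP.
have Finj x x' y : F (x, y) -> F (x', y) -> x = x'.
  move=> xy xy'; have := FB _ _ xy xy'; move/Feq0 => /=; rewrite subrr.
  by move=> [_ /(_ erefl) /eqP]; rewrite subr_eq0 => /eqP.
have FM x y : F x -> F y -> F (x * y).
  have [S SF _] := partial_iso_pred Fiso.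
  by rewrite -SF; exact: rpredM.
have [||s' ss'] := @rmorphism_of C C s.
- by move=> x y; apply: (Ffun (x - y)) (sF _) _; exact: (FB _ _ (sF x) (sF y)).
- split=> [|x y]; first by apply: (Ffun 1) (sF _) F1.
  by apply: (Ffun (x * y)) (sF _) _; exact: (FM _ _ (sF x) (sF y)).
have [||t' tt'] := @rmorphism_of C C t.
- move=> x y; apply: (Finj _ _ (x - y)) (tF _) _.
  exact: (FB _ _ (tF x) (tF y)).
- split=> [|x y]; first by apply: (Finj _ _ 1) (tF _) F1.
  by apply: (Finj _ _ (x * y)) (tF _) _; exact: (FM _ _ (tF x) (tF y)).
exists s', t'; split.
- by move=> x; rewrite ss' tt'; apply: Finj (tF _) (sF _).
- by move=> y; rewrite ss' tt'; apply: Ffun (sF _) (tF _).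
- move=> a Ka; rewrite ss'; apply: Ffun (sF a) _; apply: DF; apply/DP.
  by split=> //; exact: KE.
- by rewrite ss' (Ffun _ _ c' (sF c))//; exact: F0F.
Qed.
End PartialIsomorphisms.

(** * Exponential polynomials and binomials *)

Section ExponentialPolynomials.
Variable C : numClosedFieldType.

Lemma size_sub_lead (p q : {poly C}) : p != 0 -> size q = size p ->
  lead_coef q = lead_coef p -> (size (q - p)%R < size p)%N.
Proof.
move=> p0 qp lqp; apply: (@leq_ltn_trans (size p).-1); last first.
  by rewrite prednK ?lt0n ?size_poly_eq0.
apply/leq_sizeP => j; rewrite coefB leq_eqVlt => /orP[/eqP <-|].
  by move: lqp; rewrite !lead_coefE qp => ->; rewrite subrr.
rewrite prednK ?lt0n ?size_poly_eq0// => pj.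
by rewrite !nth_default ?subrr// qp.
Qed.

Local Notation shift p := (p \Po ('X + 1%:P)).

Lemma size_X1 : size ('X + 1%:P : {poly C}) = 2%N.
Proof. by rewrite size_XaddC. Qed.

Lemma size_shift (p : {poly C}) : size (shift p) = size p.
Proof. by rewrite size_comp_poly2// size_X1. Qed.

Lemma lead_shift (p : {poly C}) : lead_coef (shift p) = lead_coef p.
Proof.
by rewrite lead_coef_comp ?size_X1// lead_coefXaddC expr1n mulr1.
Qed.

Lemma horner_shift (p : {poly C}) (k : nat) :
  (shift p).[k%:R] = p.[k.+1%:R].
Proof. by rewrite horner_comp !hornerE -natr1. Qed.

(** Induction on the number of exponentials and on the degree of P v:
    replacing the relation at k by the one at k + 1 minus v times the one at k
    lowers the degree of P v and keeps the degrees of the other coefficients,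
    since u <> v. *)
Lemma exp_poly_free (s : seq C) (P : C -> {poly C}) :
  uniq s -> 0 \notin s ->
  (forall k, \sum_(u <- s) u ^+ k * (P u).[k%:R] = 0) ->
  {in s, forall u, P u = 0}.
Proof.
elim: s P => // v s IHs P /andP[vs us].
rewrite inE negb_or eq_sym => /andP[v0 s0].
have [d] := ubnP (size (P v)); elim: d P => // d IHd P sP P0.
suff Pv0 : P v = 0.
  move=> u; rewrite inE => /orP[/eqP ->//|]; apply: IHs => // k.
  by have := P0 k; rewrite big_cons Pv0 horner0 mulr0 add0r.
have [//|Pv0] := eqVneq (P v) 0.
pose P' u := u *: shift (P u) - v *: P u.
have P'0 : {in v :: s, forall u, P' u = 0}.
  apply: IHd => [|k].
    rewrite /P' -scalerBr size_scale// -ltnS; apply: leq_trans sP; rewrite ltnS.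
    by apply: size_sub_lead; rewrite ?size_shift ?lead_shift.
  transitivity (\sum_(u <- v :: s) u ^+ k.+1 * (P u).[k.+1%:R]
                - v * \sum_(u <- v :: s) u ^+ k * (P u).[k%:R]).
    rewrite mulr_sumr -sumrB; apply: eq_bigr => u _.
    rewrite /P' hornerD hornerN !hornerZ horner_shift exprS mulrBr.
    by rewrite !mulrA [u ^+ k * u]mulrC [u ^+ k * v]mulrC.
  by rewrite !P0 mulr0 subrr.
have Pu0 : {in s, forall u, P u = 0}.
  move=> u us'; have := P'0 u; rewrite inE us' orbT => /(_ isT)/eqP.
  rewrite subr_eq0 => /eqP/(congr1 lead_coef); rewrite !lead_coefZ lead_shift.
  move=> /eqP; rewrite -subr_eq0 -mulrBl mulf_eq0 subr_eq0 lead_coef_eq0.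
  by case/orP => /eqP// uv; rewrite -uv us' in vs.
have Pvk k : (P v).[k%:R] = 0.
  have := P0 k; rewrite big_cons big_seq big1 => [|u /Pu0 ->].
    by move/eqP; rewrite addr0 mulf_eq0 expf_eq0 (negPf v0) andbF => /eqP.
  by rewrite horner0 mulr0.
exact: poly_nat_eq0.
Qed.

(** Terms with the same exponential u m are grouped; by freeness each group
    of polynomials sums to 0, and so any function of u m may replace the powers
    of u m. *)
Lemma exp_poly_transfer (T : eqType) (r : seq T) (u : T -> C)
    (Q : T -> {poly C}) (phi : C -> C) :
  (forall m, u m != 0) ->
  (forall k, \sum_(m <- r) u m ^+ k * (Q m).[k%:R] = 0) ->
  \sum_(m <- r) phi (u m) *: Q m = 0.
Proof.
move=> u0 Q0; pose s := undup [seq u m | m <- r].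
pose P v := \sum_(m <- r | u m == v) Q m.
have group (V : zmodType) (F : T -> V) :
    \sum_(m <- r) F m = \sum_(v <- s) \sum_(m <- r | u m == v) F m.
  rewrite (eq_bigr (fun v => \sum_(m <- r) if u m == v then F m else 0)).
    rewrite exchange_big /= big_seq [RHS]big_seq; apply: eq_bigr => m mr.
    have ms : u m \in s by rewrite mem_undup map_f.
    rewrite (bigD1_seq (u m)) ?undup_uniq//= eqxx big1 ?addr0// => v.
    by rewrite eq_sym => /negPf ->.
  by move=> v _; rewrite big_mkcond.
have Pv0 : {in s, forall v, P v = 0}.
  apply: exp_poly_free; rewrite ?undup_uniq//.
    by rewrite mem_undup; apply/mapP => -[m _ /esym/eqP];
      rewrite (negPf (u0 m)).
  move=> k; rewrite -[RHS](Q0 k) group; apply: eq_bigr => v _.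
  rewrite /P horner_sum mulr_sumr; apply: eq_bigr => m /eqP ->//.
rewrite group big_seq big1// => v sv.
rewrite (eq_bigr (fun m => phi v *: Q m)) => [|m /eqP ->//].
by rewrite -scaler_sumr -/(P v) Pv0// scaler0.
Qed.
End ExponentialPolynomials.

Section Binomials.
Variable C : numClosedFieldType.

(** The polynomial in t whose value at a natural number k is the binomial
    coefficient of k over j. *)
Definition binp (j : nat) : {poly C} :=
  j`!%:R^-1 *: \prod_(l < j) ('X - l%:R%:P).

Lemma binp_nat j k : (binp j).[k%:R] = 'C(k, j)%:R.
Proof.
have prodE : (\prod_(l < j) ('X - l%:R%:P)).[k%:R] = (k ^_ j)%:R :> C.
  elim: j => [|j IH]; first by rewrite big_ord0 hornerC.
  rewrite big_ord_recr hornerM IH hornerXsubC ffactnSr natrM.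
  have [jk|kj] := leqP j k; first by rewrite natrB.
  by rewrite ffact_small// !mul0r.
rewrite /binp hornerZ prodE -bin_ffact natrM mulrC mulfK//.
by rewrite pnatr_eq0 -lt0n fact_gt0.
Qed.

Lemma binp_0 j : (binp j).[0] = (j == 0%N)%:R.
Proof. by rewrite -[0]/(0%:R) binp_nat bin0n. Qed.

(** The factor e only serves to make N nilpotent where it acts: it is a
    spectral idempotent below. *)
Lemma nilpotent_binomial (A : pzRingType) (N e : A) m k :
  N ^+ m * e = 0 ->
  (N + 1) ^+ k * e = \sum_(j < m) (N ^+ j * e) *+ 'C(k, j).
Proof.
move=> Ne; rewrite exprD1n mulr_suml.
pose F j := (N ^+ j * e) *+ 'C(k, j).
rewrite (eq_bigr (fun j : 'I_k.+1 => F j)) => [|j _]; last by rewrite mulrnAl.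
rewrite -(big_mkord predT F) -[RHS](big_mkord predT F).
have Fk j : (k < j)%N -> F j = 0 by move=> kj; rewrite /F bin_small.
have Fm j : (m <= j)%N -> F j = 0.
  by move=> mj; rewrite /F -(subnK mj) exprD -mulrA Ne mulr0 mul0rn.
transitivity (\sum_(0 <= j < k.+1 + m) F j).
  rewrite (@big_cat_nat _ _ _ k.+1 0 (k.+1 + m))//= ?leq_addr//.
  by rewrite [X in _ + X]big_nat_cond [X in _ + X]big1 ?addr0//
    => j /andP[/andP[/Fk]].
rewrite (@big_cat_nat _ _ _ m 0 (k.+1 + m))//= ?leq_addl//.
by rewrite [X in _ + X]big_nat_cond [X in _ + X]big1 ?addr0//
  => j /andP[/andP[/Fm]].
Qed.

End Binomials.

(** * Spectral idempotents *)

Section Spectral.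
Variables (C : numClosedFieldType) (n : nat) (x : 'M[C]_n.+1).
Local Notation ev := (horner_mx x).

Let evM (p q : {poly C}) : ev (p * q) = ev p * ev q.
Proof. exact: rmorphM. Qed.

Lemma coprime_XsubC_prod (v : C) (s : seq C) m : v \notin s ->
  coprimep (('X - v%:P) ^+ m) (\prod_(u <- s) ('X - u%:P) ^+ m).
Proof.
elim: s => [|u s IH]; first by rewrite big_nil coprimep1.
rewrite inE negb_or => /andP[vu vs]; rewrite big_cons coprimepMr IH// andbT.
by rewrite coprimep_expl// coprimep_expr// coprimep_XsubC2 // subr_eq0 eq_sym.
Qed.

(** Bezout relations between the coprime powers ('X - u) ^+ m, one
    eigenvalue at a time. *)
Lemma spectral_split (s : seq C) m (p : {poly C}) : uniq s ->
  ev (p * \prod_(u <- s) ('X - u%:P) ^+ m) = 0 ->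
  exists e : C -> {poly C}, \sum_(u <- s) ev (e u) = ev p /\
    {in s, forall u, ev (('X - u%:P) ^+ m * e u) = 0}.
Proof.
elim: s p => [|v s IH] p.
  by rewrite big_nil mulr1 => _ p0; exists (fun=> 0); rewrite big_nil p0.
move=> /andP[vs us]; rewrite big_cons => p0.
have /Bezout_eq1_coprimepP[[a b] /= ab] := coprime_XsubC_prod m vs.
set V := ('X - v%:P) ^+ m in p0 ab *; set Q := \prod_(u <- s) _ in p0 ab *.
have [||e [sume e0]] := IH (p * a * V) => //.
  have -> : p * a * V * Q = a * (p * (V * Q)) by ring.
  by rewrite evM p0 mulr0.
exists (fun u => if u == v then p * b * Q else e u); split.
  rewrite big_cons eqxx big_seq (eq_bigr (fun u => ev (e u))) => [|u us'].
    rewrite -big_seq sume -rmorphD; congr ev.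
    by rewrite -!mulrA -mulrDr addrC ab mulr1.
  by case: eqP => // uv; rewrite -uv us' in vs.
move=> u; rewrite inE; have [-> _|uv] := eqVneq u v; last exact: e0.
have -> : V * (p * b * Q) = b * (p * (V * Q)) by ring.
by rewrite evM p0 mulr0.
Qed.

Let evD (p q : {poly C}) : ev (p + q) = ev p + ev q.
Proof. exact: rmorphD. Qed.

(** The spectral projections are obtained as polynomials in x from the
    partial fraction decomposition of 1 over the characteristic polynomial;
    n.+1 bounds all multiplicities. *)
Lemma spectral_idempotents : exists (s : seq C) (E : C -> 'M[C]_n.+1),
  [/\ uniq s, forall u, (u \in s) = eigenvalue x u,
      \sum_(u <- s) E u = 1
    & {in s, forall u, (x - u%:M) ^+ n.+1 * E u = 0}] /\
  [/\ {in s &, forall u v, E u * E v = if u == v then E u else 0}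
    & {in s, forall u, E u != 0}].
Proof.
have [rs] := closed_field_poly_normal (char_poly x).
rewrite (monicP (char_poly_monic x)) scale1r => char_rs.
pose s := undup rs; have us : uniq s := undup_uniq rs.
have sP u : (u \in s) = eigenvalue x u.
  by rewrite eigenvalue_root_char char_rs root_prod_XsubC mem_undup.
have [|e [sume e0]] := @spectral_split s n.+1 1 us.
  rewrite mul1r.
  suff /dvdpP[q ->] : char_poly x %| \prod_(u <- s) ('X - u%:P) ^+ n.+1.
    by rewrite evM Cayley_Hamilton mulr0.
  have srs : size rs = n.+1.
    by have := size_char_poly x; rewrite char_rs size_prod_XsubC => -[].
  rewrite char_rs -prodr_undup_exp_count -/s.
  apply: (big_ind2 (fun p q : {poly C} => p %| q)) => // [p q p' q'|u _].
    exact: dvdp_mul.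
  by apply: dvdp_exp2l; rewrite -srs count_size.
pose E u := ev (e u).
have orth : {in s &, forall u v, u != v -> E u * E v = 0}.
  move=> u v us' vs uv.
  have /Bezout_eq1_coprimepP[[a b] /= ab] :
      coprimep (('X - u%:P) ^+ n.+1) (('X - v%:P) ^+ n.+1).
    by rewrite coprimep_expl// coprimep_expr// coprimep_XsubC2//
      subr_eq0 eq_sym.
  rewrite /E -evM -[e u * e v]mul1r -ab.
  set U := ('X - u%:P) ^+ _ in ab *; set V := ('X - v%:P) ^+ _ in ab *.
  have -> : (a * U + b * V) * (e u * e v) =
      (a * e v) * (U * e u) + (b * e u) * (V * e v) by ring.
  have Ue : ev (U * e u) = 0 := e0 u us'.
  have Ve : ev (V * e v) = 0 := e0 v vs.
  by rewrite evD (evM (a * e v)) (evM (b * e u)) Ue Ve !mulr0 addr0.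
have E1 : \sum_(u <- s) E u = 1 by rewrite sume rmorph1.
have e0' : {in s, forall u, (x - u%:M) ^+ n.+1 * E u = 0}.
  by move=> u /e0; rewrite evM rmorphXn rmorphB /= horner_mx_X horner_mx_C.
exists s, E; split; split=> //.
- move=> u v us' vs; case: eqP => [<-|/eqP uv]; last exact: orth.
  rewrite -[RHS]mulr1 -E1 (bigD1_seq u)//= mulrDr mulr_sumr.
  rewrite big_seq_cond big1 ?addr0// => w /andP[ws wu].
  by apply: orth; rewrite // eq_sym.
- move=> u; rewrite sP => /eigenvalueP[w wx w0].
  apply: contra_neq w0 => Eu0.
  rewrite -[w]mulmx1 -[1%:M]/(1 : 'M_n.+1) -E1 mulmx_sumr big_seq big1//
    => v vs.
  have [->|vu] := eqVneq v u; first by rewrite Eu0 mulmx0.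
  have wk k : w *m (x - v%:M) ^+ k = (u - v) ^+ k *: w.
    elim: k => [|k IH]; first by rewrite !expr0 mulmx1 scale1r.
    rewrite exprS -mulmxE mulmxA mulmxBr wx mul_mx_scalar -scalerBl -scalemxAl.
    by rewrite IH scalerA -exprS.
  have /eqP := congr1 (mulmx w) (e0' v vs).
  rewrite mulmx0 -mulmxE mulmxA wk -scalemxAl scaler_eq0 expf_eq0 subr_eq0.
  by rewrite eq_sym (negPf vu) => /eqP.
Qed.
End Spectral.

(** * Torsion-free closed subgroups are unipotent *)

Section CharacterSpecialization.
Variables (C : numClosedFieldType) (N t : nat) (f : {mpoly C[N]}).
Variables (lam : 'I_t -> C) (Q : 'I_t -> 'I_N -> {poly C}).
Hypothesis lam0 : forall i, lam i != 0.
Hypothesis f0 : forall k : nat,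
  f.@[fun l => \sum_i lam i ^+ k * (Q i l).[k%:R]] = 0.
Variables (chi : 'I_t -> C) (phi : C -> C).
Hypothesis chiE : forall m : 'I_t -> nat,
  \prod_i chi i ^+ m i = phi (\prod_i lam i ^+ m i).

(** A polynomial condition f that holds for all powers of a matrix holds
    for exponential polynomials with bases lam i. In the expansion of f the
    coefficient of a product of bases is a polynomial in k, and by linear
    independence of exponentials this product may be replaced by its image
    under any phi, and k by 0. So the lam i may be replaced by any chi i that
    satisfy the multiplicative relations between them. *)
Lemma character_specialization : f.@[fun l => \sum_i chi i * (Q i l).[0]] = 0.
Proof.
pose P := {poly C}.
pose up : {rmorphism C -> {mpoly P[t]}} := (@mpolyC t P) \o polyC.
(* The exponentials become indeterminates, and the polynomials in k
   coefficients. *)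
pose F : {mpoly P[t]} :=
  mmap up (fun l => \sum_i (Q i l)%:MP_[t] * 'X_i) f.
pose ev v tau : {rmorphism {mpoly P[t]} -> C} := mmap (horner_eval tau) v.
have evF v tau : ev v tau F = f.@[fun l => \sum_i v i * (Q i l).[tau]].
  rewrite /F {1}/mmap rmorph_sum mevalE; apply: eq_bigr => m _.
  rewrite rmorphM; congr (_ * _).
    by rewrite /ev /up /= mmapC /= /horner_eval hornerC.
  rewrite rmorph_prod; apply: eq_bigr => l _; rewrite rmorphXn; congr (_ ^+ _).
  rewrite rmorph_sum; apply: eq_bigr => i _.
  by rewrite rmorphM /ev /= mmapC mmapX mmap1U mulrC.
pose u (m : 'X_{1..t}) := \prod_i lam i ^+ m i.
have u0 m : u m != 0.
  by apply/prodf_neq0 => i _; rewrite expf_neq0.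
have Fu0 : \sum_(m <- msupp F) phi (u m) *: F@_m = 0.
  apply: exp_poly_transfer => // k.
  transitivity (ev (fun i => lam i ^+ k) k%:R F); last by rewrite evF f0.
  apply: eq_bigr => m _; rewrite mulrC; congr (_ * _).
  rewrite /mmap1 /u -prodrXl; apply: eq_bigr => i _.
  by rewrite -!exprM mulnC.
rewrite -evF; transitivity (\sum_(m <- msupp F) phi (u m) *: F@_m).[0].
  by rewrite horner_sum; apply: eq_bigr => m _; rewrite hornerZ mulrC -chiE.
by rewrite Fu0 horner0.
Qed.
End CharacterSpecialization.

Lemma maximal_free_rows (F : fieldType) n (S : 'rV[F]_n -> Prop) :
  exists m (X : 'M[F]_(m, n)), [/\ row_free X, forall i, S (row i X)
    & forall v, S v -> (v <= X)%MS].
Proof.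
pose good m := exists X : 'M[F]_(m, n), row_free X /\ forall i, S (row i X).
have [||m /asboolP[X [freeX SX]] mmax] := @ex_maxnP (fun m => `[< good m >]) n.
- by exists 0%N; apply/asboolP; exists 0; split=> [|[]//];
    rewrite /row_free mxrank0.
- by move=> m /asboolP[X [/eqP rX _]]; rewrite -rX; exact: rank_leq_col.
exists m, X; split=> // v Sv; apply: contraT => nvX.
have : good (m + 1)%N.
  exists (col_mx X v); split.
    have : (X < X + v)%MS by rewrite ltmxE addsmxSl addsmx_sub submx_refl.
    by move/rank_ltmx; rewrite (eqP freeX) addsmxE -row_leq_rank => lt_m;
      rewrite {1}addn1.
  move=> i; case: (split_ordP i) => j ->; first by rewrite rowKu.
  by rewrite rowKd [j]ord1 row_id.
by move=> /asboolP/mmax; rewrite addn1 ltnn.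
Qed.

Section TorsionOrSign.
Variables (C : numClosedFieldType) (t : nat) (lam : 'I_t -> C).
Hypothesis lam0 : forall i, lam i != 0.

Let mono (m : 'I_t -> nat) := \prod_i lam i ^+ m i.

(** The isomorphism of Z/2 with the group of signs. *)
Definition sgF2 (a : 'F_2) : C := (-1) ^+ (a != 0).

Lemma sgF2D : {morph sgF2 : a b / a + b >-> a * b}.
Proof.
have F2 (a : 'F_2) : a = 0 \/ a = 1.
  by case: a => -[|[|//]] i; [left|right]; apply/val_inj.
move=> a b; have [->|->] := F2 a; have [->|->] := F2 b;
  by rewrite /sgF2 ?(addr0, add0r, eqxx, oner_eq0, expr0, expr1, mul1r, mulr1,
    mulrNN).
Qed.

Lemma sgF2_prod (c : 'I_t -> 'F_2) (m : 'I_t -> nat) :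
  \prod_i sgF2 (c i) ^+ m i = sgF2 (\sum_i (m i)%:R * c i).
Proof.
have sg0 : sgF2 0 = 1 by rewrite /sgF2 eqxx.
rewrite (big_morph sgF2 sgF2D sg0); apply: eq_bigr => i _.
rewrite mulr_natl; elim: (m i) => [|k IH]; first by rewrite expr0 mulr0n.
by rewrite exprS IH mulrS sgF2D.
Qed.

Lemma exprz_row (w : 'I_t -> int) (z : int) :
  (\prod_l lam l ^ w l) ^ z = \prod_l lam l ^ (w l * z).
Proof.
rewrite (big_morph (fun y : C => y ^ z) (id1 := 1) (op1 := *%R)).
- by apply: eq_bigr => l _; rewrite exprz_exp.
- by move=> x y; rewrite expfzMl.
- by rewrite exp1rz.
Qed.

(** Consider the exponent vectors of the relations between the lam i,
    modulo 2. If they span, then the determinant of t relations with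
    independent reductions is odd, hence not zero, and some power of every
    lam i is 1. Otherwise a nonzero linear form over F_2 that vanishes on them
    gives signs which satisfy all these relations. *)
Lemma torsion_or_sign :
  (exists2 N, (0 < N)%N & forall i, lam i ^+ N = 1) \/
  exists (chi : 'I_t -> C) (phi : C -> C),
    [/\ forall m, \prod_i chi i ^+ m i = phi (mono m),
        forall i, chi i ^+ 2 = 1 & exists i, chi i != 1].
Proof.
pose S (v : 'rV['F_2]_t) := exists a b, mono a = mono b /\
  v = \row_i ((a i)%:R - (b i)%:R).
have [m [X [freeX SX Xmax]]] := maximal_free_rows S.
have [fullX|nfullX] := boolP (row_full X); [left|right].
  have mt : m = t by rewrite -(eqP freeX) (eqP fullX).
  subst m.
  have /choice[a /choice[b ab]] : forall i, exists a b, mono a = mono b /\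
    row i X = \row_i ((a i)%:R - (b i)%:R) by [].
  pose M := \matrix_(i, j) ((a i j)%:Z - (b i j)%:Z).
  have MX : map_mx intr M = X.
    apply/matrixP => i j; have [_ /rowP/(_ j)] := ab i.
    by rewrite !mxE => ->; rewrite rmorphB.
  have detM : \det M != 0.
    apply: contraTneq fullX => M0; rewrite row_full_unit unitmxE -MX det_map_mx.
    by rewrite M0 rmorph0 unitr0.
  have rel k : \prod_l lam l ^ M k l = 1.
    have [abk _] := ab k; have mk0 : mono (b k) != 0.
      by apply/prodf_neq0 => i _; rewrite expf_neq0.
    apply: (mulIf mk0); rewrite mul1r -[RHS]abk -big_split.
    apply: eq_bigr => l _; rewrite mxE /=.
    by rewrite [lam l ^+ b k l]exprnP -expfzDr// subrK.
  (* Multiplying the relations M by the adjugate of M. *)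
  have lamz i : lam i ^ \det M = 1.
    transitivity (\prod_l lam l ^ ((\det M)%:M i l)).
      rewrite (bigD1 i)//= mxE eqxx mulr1n big1 ?mulr1// => l li.
      by rewrite mxE eq_sym (negPf li) expr0z.
    rewrite -mul_adj_mx.
    transitivity (\prod_k (\prod_l lam l ^ M k l) ^ (\adj M i k)); last first.
      by rewrite big1// => k _; rewrite rel exp1rz.
    rewrite (eq_bigr _ (fun k _ => exprz_row _ _)) exchange_big /=.
    apply: eq_bigr => l _; rewrite mxE.
    rewrite (big_morph (fun z => lam l ^ z) (id1 := 1) (op1 := *%R)) ?expr0z//.
      by apply: eq_bigr => k _; rewrite mulrC.
    by move=> x y; rewrite expfzDr.
  exists `|\det M|%N; first by rewrite absz_gt0.
  move=> i; have := lamz i; case: (\det M) => d /=; first by [].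
  by move=> /(canRL (@invrK _)); rewrite invr1.
have [i [j cij]] : exists i j, cokermx X i j != 0.
  apply: contrapT => c0; move: nfullX; rewrite -sub1mx submxE mul1mx.
  case/negP; apply/eqP/matrixP => i j; rewrite [RHS]mxE; apply/eqP;
    apply: contraT.
  by move=> cij; case: c0; exists i, j.
pose c i := cokermx X i j; pose chi i := sgF2 (c i).
have chi_eq a b : mono a = mono b ->
    \prod_i chi i ^+ a i = \prod_i chi i ^+ b i.
  move=> ab; rewrite !sgF2_prod; congr sgF2.
  have : S (\row_i ((a i)%:R - (b i)%:R)) by exists a, b.
  move/Xmax; rewrite submxE => /eqP/matrixP/(_ 0 j); rewrite mxE [RHS]mxE.
  under eq_bigr do rewrite mxE mulrBl.
  by rewrite sumrB => /eqP; rewrite subr_eq0 => /eqP.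
have /choice[phi phiE] : forall z, exists y, forall a, mono a = z ->
    \prod_i chi i ^+ a i = y.
  move=> z; have [[b bz]|nz] := pselect (exists a, mono a = z).
    by exists (\prod_i chi i ^+ b i) => a az; apply: chi_eq; rewrite az.
  by exists 0 => a az; case: nz; exists a.
exists chi, phi; split; first by move=> a; exact: phiE.
- by move=> k; rewrite /chi /sgF2 -exprM mulnC exprM sqrrN !expr1n.
- by exists i; rewrite /chi /sgF2 cij expr1 eq_sym -addr_eq0 (_ : 1 + 1 = 2)
    ?pnatr_eq0.
Qed.
End TorsionOrSign.

Section TorsionFreeClosed.
Variables (C : numClosedFieldType).

(** [mxeval] for coefficients in any C; the two are convertible for
    R[i]. *)
Definition mxev n (p : {mpoly C[n * n]}) (x : 'M[C]_n) : C :=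
  p.@[fun k => mxvec x ord0 k].

Section Specialize.
Variables (n : nat) (x : 'M[C]_n.+1) (t : nat) (lam : 'I_t -> C).
Variable E : 'I_t -> 'M[C]_n.+1.
Hypotheses (lam0 : forall i, lam i != 0) (E1 : \sum_i E i = 1).
Hypothesis xE : forall i, (x - (lam i)%:M) ^+ n.+1 * E i = 0.

(* Rescaled so that x = lam i (1 + N i) on the image of E i. *)
Let N i := (lam i)^-1 *: (x - (lam i)%:M).

Lemma power_spectral k : x ^+ k =
  \sum_i lam i ^+ k *: \sum_(j < n.+1) (N i ^+ j * E i) *+ 'C(k, j).
Proof.
rewrite -[LHS]mulr1 -E1 mulr_sumr; apply: eq_bigr => i _.
rewrite -(@nilpotent_binomial _ (N i)); last first.
  by rewrite exprZn -scalerAl xE scaler0.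
rewrite scalerAl; congr (_ * _); rewrite -exprZn scalerDr scalerA divff//.
by rewrite scale1r scale_scalar_mx mulr1 subrK.
Qed.

(** The entries of the powers of x are exponential polynomials in the
    eigenvalues of x, with constant terms given by the spectral idempotents. *)
Lemma specialize_powers (f : {mpoly C[n.+1 * n.+1]}) (chi : 'I_t -> C) phi :
  (forall k, mxev f (x ^+ k) = 0) ->
  (forall m, \prod_i chi i ^+ m i = phi (\prod_i lam i ^+ m i)) ->
  mxev f (\sum_i chi i *: E i) = 0.
Proof.
move=> f0 chiE.
pose Q i l := \sum_(j < n.+1) mxvec (N i ^+ j * E i) ord0 l *: binp C j.
have := @character_specialization C _ t f lam Q lam0 _ chi phi chiE.
rewrite /mxev => fQ; rewrite -{}fQ; last first.
  move=> k; rewrite -[RHS](f0 k); apply: meval_eq => l.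
  rewrite power_spectral linear_sum summxE; apply: eq_bigr => i _.
  rewrite linearZ mxE; congr (_ * _).
  rewrite horner_sum linear_sum summxE; apply: eq_bigr => j _.
  by rewrite hornerZ binp_nat mulr_natr linearMn mulmxnE.
apply: meval_eq => l; rewrite linear_sum summxE; apply: eq_bigr => i _.
rewrite linearZ mxE; congr (_ * _).
rewrite horner_sum big_ord_recl hornerZ binp_0 mulr1 expr0 mul1r.
by rewrite big1 ?addr0// => j _; rewrite hornerZ binp_0 mulr0.
Qed.

End Specialize.

(** A closed subgroup contains with x every sum of chi i E i where the chi
    i satisfy the multiplicative relations between the eigenvalues lam i and
    the E i are the spectral idempotents of x. With chi = lam if the
    eigenvalues are torsion, and with a sign vector otherwise, this is a
    torsion element; so all chi i are 1, which excludes the second case and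
    makes x unipotent in the first. *)
Lemma torsion_free_unipotent n (A : set 'M[C]_n) (S : set {mpoly C[n * n]}) :
  A = [set x | x \in unitmx] `&` [set x | forall p, S p -> mxev p x = 0] ->
  A 1%:M -> (forall x y, A x -> A y -> A (x *m y)) ->
  (forall x m, A x -> (0 < m)%N -> x ^+ m = 1%:M -> x = 1%:M) ->
  forall x, A x -> (x - 1%:M) ^+ n = 0.
Proof.
case: n A S => [|n] A S defA A1 AM Atf x Ax; first by apply/matrixP => -[].
have Axk k : A (x ^+ k).
  by elim: k => [|k IH]; [rewrite expr0|rewrite exprS; exact: AM].
have xU : x \in unitmx by move: Ax; rewrite defA => -[].
have [s [E0 [[us sE E01 xE0] [orth0 E0n0]]]] := spectral_idempotents x.
pose t := size s; pose lam (i : 'I_t) := nth 0 s i.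
have slam i : lam i \in s by rewrite mem_nth.
pose E i := E0 (lam i).
have lam0 i : lam i != 0.
  apply: contraTneq (slam i) => ->; rewrite sE; apply/negP => /eigenvalueP[v].
  rewrite scale0r => vx; case/eqP.
  by rewrite -[v](mulmxK xU) vx mul0mx.
have E1 : \sum_i E i = 1 by rewrite -E01 (big_nth 0) big_mkord.
have xE i : (x - (lam i)%:M) ^+ n.+1 * E i = 0 by exact: xE0.
have orth i j : E i * E j = if i == j then E i else 0.
  by rewrite orth0// nth_uniq ?ltn_ord.
(* The element y of A attached to chi has finite order and is therefore
   trivial. *)
have key (chi : 'I_t -> C) (phi : C -> C) (M : nat) :
    (0 < M)%N -> (forall i, chi i ^+ M = 1) ->
    (forall m, \prod_i chi i ^+ m i = phi (\prod_i lam i ^+ m i)) ->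
    forall i, chi i = 1.
  move=> M0 chiM chiE.
  pose y := \sum_i chi i *: E i.
  have yE i : y * E i = chi i *: E i.
    rewrite mulr_suml (bigD1 i)//= -scalerAl orth eqxx big1 ?addr0// => j ji.
    by rewrite -scalerAl orth (negPf ji) scaler0.
  have yk k : y ^+ k = \sum_i chi i ^+ k *: E i.
    elim: k => [|k IH].
      by rewrite expr0 -E1; apply: eq_bigr => i _; rewrite expr0 scale1r.
    rewrite exprS IH mulr_sumr; apply: eq_bigr => i _.
    by rewrite -scalerAr yE scalerA exprSr.
  have yM : y ^+ M = 1.
    by rewrite yk -E1; apply: eq_bigr => i _; rewrite chiM scale1r.
  have y1 : y = 1.
    apply: (Atf y M) => //; rewrite defA; split=> [/=|p Sp].
      have : y *m y ^+ M.-1 = 1%:M by rewrite mulmxE -exprS prednK.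
      by case/mulmx1_unit.
    apply: (specialize_powers lam0 E1 xE _ chiE) => k.
    by have := Axk k; rewrite defA => -[_]; exact.
  move=> i; apply/eqP; rewrite -subr_eq0.
  apply: contraNT (E0n0 _ (slam i)) => ci.
  have := yE i; rewrite y1 mul1r => /eqP; rewrite -subr_eq0 -{1}[E i]scale1r.
  by rewrite -scalerBl scaler_eq0 -opprB oppr_eq0 (negPf ci).
have [[M M0 lamM]|[chi [phi [chiE chi2 [i /eqP[]]]]]] := torsion_or_sign lam0.
  have lam1 := key lam id M M0 lamM (fun=> erefl).
  rewrite -[LHS]mulr1 -E1 mulr_sumr big1// => i _.
  by rewrite -[in 1%:M](lam1 i) xE.
exact: (key chi phi 2).
Qed.
End TorsionFreeClosed.

(** * Powers and logarithms of unipotent matrices *)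

Lemma map_mx_exp (S T : comNzRingType) (h : {rmorphism S -> T}) n
    (B : 'M[S]_n) l :
  map_mx h (B ^+ l) = map_mx h B ^+ l.
Proof.
elim: l => [|l IH]; first by rewrite !expr0 map_mx1.
by rewrite !exprS -!mulmxE map_mxM IH.
Qed.

Section UnipotentPowers.
Variables (C : numClosedFieldType) (n : nat).
Implicit Types u v : 'M[C]_n.

Local Notation at_ t := (map_mx (horner_eval t)).

Definition unipotent u : Prop := (u - 1) ^+ n = 0.

(** The powers of u as a polynomial in the exponent, by the binomial
    formula. *)
Definition upoly u : 'M[{poly C}]_n :=
  \sum_(j < n) binp C j *: map_mx polyC ((u - 1) ^+ j).

Definition upow u (t : C) : 'M[C]_n := at_ t (upoly u).

(** The logarithm of u is the derivative at t = 0 of u^t; see [ulogE]. *)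
Definition ulog u : 'M[C]_n := \sum_(j < n) (binp C j)`_1 *: (u - 1) ^+ j.

Lemma upowE u t : upow u t = \sum_(j < n) (binp C j).[t] *: (u - 1) ^+ j.
Proof.
rewrite /upow /upoly raddf_sum; apply: eq_bigr => j _.
by apply/matrixP => a b; rewrite !mxE /= /horner_eval hornerM hornerC.
Qed.

Lemma upow_nat u k : unipotent u -> upow u k%:R = u ^+ k.
Proof.
move=> uu; have := @nilpotent_binomial 'M[C]_n (u - 1) 1 n k.
rewrite !mulr1 subrK => /(_ uu) ->; rewrite upowE; apply: eq_bigr => j _.
by rewrite binp_nat scaler_nat mulr1.
Qed.

Lemma poly_mx_nat_eq m p (A B : 'M[{poly C}]_(m, p)) :
  (forall k : nat, at_ k%:R A = at_ k%:R B) -> A = B.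
Proof.
move=> AB; apply/matrixP => i j; apply/eqP; rewrite -subr_eq0; apply/eqP.
apply: poly_nat_eq0 => k; have /matrixP/(_ i j) := AB k.
by rewrite !mxE /horner_eval hornerD hornerN => ->; rewrite subrr.
Qed.

Lemma mxev_poly (f : {mpoly C[n * n]}) (A : 'M[{poly C}]_n) t :
  mxev f (at_ t A) = (mmap polyC (fun k => mxvec A ord0 k) f).[t].
Proof.
rewrite /mmap horner_sum /mxev mevalE; apply: eq_bigr => m _.
rewrite hornerM hornerC; congr (_ * _).
rewrite /mmap1 horner_prod; apply: eq_bigr => l _.
by rewrite horner_exp -map_mxvec mxE.
Qed.

(** A polynomial in t that vanishes at all natural numbers vanishes. *)
Lemma upow_closed (f : {mpoly C[n * n]}) u t : unipotent u ->
  (forall k, mxev f (u ^+ k) = 0) -> mxev f (upow u t) = 0.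
Proof.
move=> uu f0; rewrite mxev_poly.
rewrite (_ : mmap _ _ _ = 0) ?horner0//; apply: poly_nat_eq0 => k.
by rewrite -mxev_poly -/(upow u _) upow_nat.
Qed.

Lemma ulogE u : ulog u = map_mx (fun p : {poly C} => p^`().[0]) (upoly u).
Proof.
rewrite /ulog /upoly; apply/matrixP => a b; rewrite mxE !summxE.
rewrite raddf_sum horner_sum; apply: eq_bigr => j _; rewrite !mxE /=.
rewrite derivM derivC mulr0 addr0 hornerM hornerC; congr (_ * _).
by rewrite horner_coef0 coef_deriv mulr1n.
Qed.

Lemma upow0 u : unipotent u -> upow u 0 = 1.
Proof. by move=> uu; rewrite -[0]/(0%:R) upow_nat. Qed.

Lemma upolyM u v : unipotent u -> unipotent v -> unipotent (u *m v) ->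
  u *m v = v *m u -> upoly (u *m v) = upoly u *m upoly v.
Proof.
move=> uu uv uuv cuv; apply: poly_mx_nat_eq => k.
rewrite map_mxM -!/(upow _ _) !upow_nat//.
exact: exprMn_comm.
Qed.

(** Derivative at 0 of (u v)^t = u^t v^t. *)
Lemma ulogM u v : unipotent u -> unipotent v -> unipotent (u *m v) ->
  u *m v = v *m u -> ulog (u *m v) = ulog u + ulog v.
Proof.
move=> uu uv uuv cuv; rewrite !ulogE upolyM//; apply/matrixP => a b.
rewrite !mxE raddf_sum horner_sum.
have u0 (w : 'M[C]_n) i j : unipotent w -> (upoly w i j).[0] = (i == j)%:R.
  by move=> uw; have /matrixP/(_ i j) := upow0 uw; rewrite !mxE.
transitivity (\sum_j ((upoly u a j)^`().[0] * (j == b)%:R +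
                      (a == j)%:R * (upoly v j b)^`().[0])).
  by apply: eq_bigr => j _; rewrite /= derivM hornerD !hornerM !u0.
rewrite big_split /= (bigD1 b)//= eqxx mulr1 big1 ?addr0; last first.
  by move=> j /negPf ->; rewrite mulr0.
rewrite (bigD1 a)//= eqxx mul1r big1 ?addr0// => j.
by rewrite eq_sym => /negPf ->; rewrite mul0r.
Qed.

Lemma upow_natM u t k : unipotent u -> upow u t ^+ k = upow u (t * k%:R).
Proof.
move=> uu; pose A : 'M[{poly C}]_n := map_mx (comp_poly (k%:R *: 'X)) (upoly u).
have AE s : at_ s A = upow u (s * k%:R).
  apply/matrixP => a b; rewrite !mxE /horner_eval horner_comp hornerZ hornerX.
  by rewrite mulrC.
rewrite -AE -map_mx_exp; congr (at_ t); apply: poly_mx_nat_eq => l.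
by rewrite map_mx_exp AE -/(upow u _) -natrM !upow_nat// exprM.
Qed.

(** Derivative at 0 of (u^t)^s = u^(t s) in s. *)
Lemma ulog_upow u t : unipotent u -> unipotent (upow u t) ->
  ulog (upow u t) = t *: ulog u.
Proof.
move=> uu uut; rewrite !ulogE.
have -> : upoly (upow u t) = map_mx (comp_poly (t *: 'X)) (upoly u).
  apply: poly_mx_nat_eq => k; rewrite -/(upow _ _) upow_nat// upow_natM//.
  by apply/matrixP => a b; rewrite !mxE /horner_eval horner_comp hornerZ
    hornerX.
apply/matrixP => a b; rewrite !mxE deriv_comp hornerM horner_comp derivZ derivX.
by rewrite !hornerZ hornerX mulr0 hornerC mulr1 mulrC.
Qed.

(** If u - 1 = N has nilpotency index m + 2, then multiplying the logarithm
    by N^m leaves only its first term N^(m + 1), which is not 0. *)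
Lemma ulog_eq0 u : unipotent u -> ulog u = 0 -> u = 1.
Proof.
rewrite /unipotent; set N := u - 1 => Nn ul0.
suff N0 : N = 0 by apply/eqP; rewrite -subr_eq0 -/N N0.
have [|m /eqP Nm mmin] := @ex_minnP (fun m => N ^+ m == 0).
  by exists n; apply/eqP.
case: m => [|[|m]] in Nm mmin *; first by rewrite -[N]mulr1 -(expr0 N) Nm mulr0.
  by [].
have mn : (m.+1 < n)%N by apply: mmin; apply/eqP.
have : N ^+ m * ulog u = 0 by rewrite ul0 mulr0.
rewrite /ulog -/N mulr_sumr.
have scaleE c (A B : 'M[C]_n) : A * (c *: B) = c *: (A * B).
  exact: (esym (scalemxAr c A B)).
have m1n : (1 < n)%N by apply: leq_ltn_trans mn.
have c1 : (binp C 1)`_1 = 1.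
  by rewrite /binp big_ord1 invr1 scale1r coefB coefX coefC subr0.
rewrite (bigD1 (Ordinal m1n))//= c1 scale1r expr1 -exprSr big1 ?addr0.
  by move/eqP => Nm1; have := mmin _ Nm1; rewrite ltnn.
move=> j j1; rewrite scaleE -exprD.
have [j0|j0] := posnP j.
  by rewrite j0 /binp big_ord0 coefZ coefC mulr0 scale0r.
rewrite (_ : N ^+ (m + j) = 0) ?scaler0//.
have j2 : (1 < j)%N by rewrite ltn_neqAle eq_sym j0 andbT.
by rewrite -(subnK j2) addnCA addn2 exprD Nm mulr0.
Qed.

End UnipotentPowers.

(** * Descent to a subfield *)

Section Rationality.
Variables (C : numClosedFieldType) (K : divringClosed C).

Definition field_aut (s : {rmorphism C -> C}) : Prop :=
  {in K, forall a, s a = a} /\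
  exists t : {rmorphism C -> C}, cancel s t /\ cancel t s.

(** Matrices defined over K, in the form in which this is verified:
    operations that commute with field automorphisms, such as inverses,
    pseudo-inverses and cokernels, obviously preserve it. See
    [rational_mxP]. *)
Definition rational_mx m n (A : 'M[C]_(m, n)) : Prop :=
  forall s, field_aut s -> map_mx s A = A.

Lemma rational_mxP m n (A : 'M[C]_(m, n)) :
  rational_mx A <-> forall i j, A i j \in K.
Proof.
split=> [ratA i j|KA s [sK _]]; last first.
  by apply/matrixP => i j; rewrite mxE sK.
apply: contraT => /exists_automorphism[s [t [st ts sK]]]; apply: contraNT => _.
have sA : field_aut s by split=> //; exists t.
by have /matrixP/(_ i j) := ratA s sA; rewrite mxE => ->.
Qed.

(** The reduced echelon form of a spanning family of vectors in S is
    determined by their span; hence it is fixed by the field automorphisms over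
    K. *)
Lemma rational_basis n (S : 'rV[C]_n -> Prop) :
  (forall s v, field_aut s -> S v -> S (map_mx s v)) ->
  exists m (E : 'M[C]_(m, n)), [/\ row_free E, rational_mx E,
    forall v, S v -> (v <= E)%MS
    & exists2 X : 'M[C]_(m, n), (forall i, S (row i X)) & (E <= X)%MS].
Proof.
move=> Sst; have [m [X [freeX SX Xmax]]] := maximal_free_rows S.
have fullXT : row_full X^T by rewrite /row_full mxrank_tr.
pose g := fullrankfun fullXT.
(* The columns g of E form the identity matrix: this normalizes the choice
   of the basis. *)
pose Y := colsub g X.
have Yunit : Y \in unitmx.
  rewrite -unitmx_tr; have -> : Y^T = rowsub g X^T.
    by apply/matrixP => i j; rewrite !mxE.
  exact: fullrowsub_unit.
pose E := invmx Y *m X.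
have EX : (E <= X)%MS by exact: submxMl.
have XE : (X <= E)%MS by rewrite -[X](mulKVmx Yunit); exact: submxMl.
have gE : colsub g E = 1%:M.
  rewrite -(mulVmx Yunit); apply/matrixP => i j; rewrite !mxE.
  by apply: eq_bigr => l _; rewrite !mxE.
exists m, E; split=> //.
- by apply/eqP; rewrite -[RHS](eqP freeX); apply/anti_leq; rewrite !mxrankS.
- move=> s sA.
  have : (map_mx s E <= E)%MS.
    apply: submx_trans XE; rewrite /E map_mxM;
      apply: submx_trans (submxMl _ _) _.
    apply/row_subP => i; rewrite -map_row; apply: Xmax; exact: Sst.
  case/submxP => D sE.
  have D1 : D = 1%:M.
    have : colsub g (map_mx s E) = colsub g (D *m E) by rewrite sE.
    have -> : colsub g (map_mx s E) = map_mx s (colsub g E).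
      by apply/matrixP => i j; rewrite !mxE.
    have -> : colsub g (D *m E) = D *m colsub g E.
      by apply/matrixP => i j; rewrite !mxE; apply: eq_bigr => l _;
        rewrite !mxE.
    by rewrite gE map_mx1 mulmx1.
  by rewrite sE D1 mul1mx.
- by move=> v /Xmax vX; exact: submx_trans XE.
- by exists X.
Qed.

End Rationality.

Lemma binp_map (C : numClosedFieldType) (s : {rmorphism C -> C}) j :
  map_poly s (binp C j) = binp C j.
Proof.
rewrite map_polyZ fmorphV rmorph_nat; congr (_ *: _).
rewrite rmorph_prod; apply: eq_bigr => l _.
by rewrite rmorphB /= map_polyX map_polyC /= rmorph_nat.
Qed.

Lemma ulog_map (C : numClosedFieldType) n (s : {rmorphism C -> C}) (x : 'M_n) :
  ulog (map_mx s x) = map_mx s (ulog x).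
Proof.
rewrite /ulog raddf_sum; apply: eq_bigr => j _ /=.
rewrite map_mxZ -{1}(binp_map s) coef_map; congr (_ *: _).
by rewrite map_mx_exp map_mxB map_mx1.
Qed.

Section Coordinates.
Variables (C : numClosedFieldType) (K : divringClosed C) (n : nat).
Variable A : set 'M[C]_n.
Hypotheses (A1 : A 1) (AM : forall x y, A x -> A y -> A (x *m y)).
Hypothesis A_comm : forall x y, A x -> A y -> x *m y = y *m x.
Hypothesis A_inv : forall x, A x -> exists2 y, A y & x *m y = 1%:M.
Hypothesis A_unip : forall x, A x -> unipotent x.
Hypothesis A_pow : forall x t, A x -> A (upow x t).
Hypothesis A_stable : forall s x, field_aut K s -> A x -> A (map_mx s x).

Lemma ulogMA x y : A x -> A y -> ulog (x *m y) = ulog x + ulog y.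
Proof. by move=> Ax Ay; apply: ulogM; auto. Qed.

Lemma ulog_inj x y : A x -> A y -> ulog x = ulog y -> x = y.
Proof.
move=> Ax Ay xy; have [z Az yz] := A_inv Ay.
suff xz : x *m z = 1 by rewrite -[x]mulmx1 -yz (A_comm Ay Az) mulmxA xz mul1mx.
apply: ulog_eq0; first by apply/A_unip/AM.
rewrite ulogMA// xy -ulogMA// yz.
have := ulogMA A1 A1; rewrite mulmx1 => /eqP.
by rewrite -subr_eq0 opprD addNKr oppr_eq0 => /eqP.
Qed.

(** The logarithms of the elements of A form a vector space, stable under
    field automorphisms over K; coordinates in a rational basis E of it are
    additive and bijective on A. *)
Lemma coordinates : exists m (E : 'M[C]_(m, n * n)),
  let kappa x := mxvec (ulog x) *m pinvmx E in
  [/\ rational_mx K E, forall x y, A x -> A y -> kappa x = kappa y -> x = y,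
      forall v, exists2 z, A z & kappa z = v,
      forall x y, A x -> A y -> kappa (x *m y) = kappa x + kappa y
    & forall x t, A x -> kappa (upow x t) = t *: kappa x].
Proof.
pose L v := exists2 z, A z & v = mxvec (ulog z).
have [|m [E [freeE ratE LE [X LX EX]]]] := @rational_basis C K _ L.
  move=> s _ sA [z Az ->]; exists (map_mx s z); first exact: A_stable.
  by rewrite ulog_map map_mxvec.
have Lspan v : (v <= E)%MS -> L v.
  move=> /submx_trans/(_ EX)/submxP[w ->]; rewrite mulmx_sum_row.
  apply: (big_ind L) => [|_ _ [y Ay ->] [z Az ->]|i _].
  - exists (upow 1 0); first exact: A_pow.
    by rewrite ulog_upow ?scale0r ?linear0//; apply/A_unip => //; exact: A_pow.
  - by exists (y *m z); [exact: AM|rewrite ulogMA ?linearD].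
  - have [z Az ->] := LX i; exists (upow z (w 0 i)); first exact: A_pow.
    by rewrite ulog_upow ?linearZ//; apply/A_unip => //; exact: A_pow.
have kappaE z : A z -> mxvec (ulog z) *m pinvmx E *m E = mxvec (ulog z).
  by move=> Az; rewrite mulmxKpV//; apply: LE; exists z.
exists m, E; split=> //.
- move=> x y Ax Ay xy; apply: ulog_inj => //; apply: (can_inj (@mxvecK _ _ _)).
  by rewrite -kappaE// xy kappaE.
- move=> v; have [z Az vz] := Lspan (v *m E) (submxMl _ _).
  by exists z => //; rewrite -vz mulmxKp.
- by move=> x y Ax Ay; rewrite ulogMA// linearD mulmxDl.
- move=> x t Ax; rewrite ulog_upow; [|exact: A_unip|exact/A_unip/A_pow].
  by rewrite linearZ -scalemxAl.
Qed.

End Coordinates.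

(** * Regular functions *)

Section RegularFunctions.
Variables (R : realType) (K : divringClosed R[i]).
Local Notation C := R[i].

Section Ring.
Variables (n : nat) (G : set 'M[C]_n).
Hypothesis G_unit : forall x, G x -> x \in unitmx.
Implicit Types f g : 'M[C]_n -> C.

Definition detp : {mpoly C[n * n]} :=
  \det (\matrix_(i, j) 'X_(mxvec_index i j)).

Lemma detpE x : mxeval detp x = \det x.
Proof.
rewrite /mxeval /detp -det_map_mx; congr (\det _); apply/matrixP => i j.
by rewrite !mxE /= mevalXU mxvecE.
Qed.

Lemma detp_over : detp \is a mpolyOver (n * n) K.
Proof.
rewrite /detp /determinant; apply: rpred_sum => s _.
rewrite rpredM ?rpred_sign// rpred_prod// => i _.
by rewrite mxE mpolyOverX.
Qed.

Lemma mxeval_comb (p q : {mpoly C[n * n]}) k x :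
  mxeval (p * detp ^+ k) x = mxeval p x * \det x ^+ k.
Proof. by rewrite -detpE /mxeval mevalM rmorphXn. Qed.

Lemma reg_ext f g : (forall x, G x -> f x = g x) ->
  K_regular K G f -> K_regular K G g.
Proof.
by move=> fg [p [k [Kp fE]]]; exists p, k; split=> // x Gx; rewrite -fg ?fE.
Qed.

Lemma reg_poly (p : {mpoly C[n * n]}) : p \is a mpolyOver (n * n) K ->
  K_regular K G (mxeval p).
Proof. by move=> Kp; exists p, 0%N; split=> // x _; rewrite expr0 divr1. Qed.

Lemma reg_const c : c \in K -> K_regular K G (fun=> c).
Proof.
move=> Kc; apply: (@reg_ext (mxeval c%:MP)).
  by move=> x _; rewrite /mxeval mevalC.
by apply: reg_poly; rewrite mpolyOverC.
Qed.

Lemma reg_entry i j : K_regular K G (fun x => x i j).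
Proof.
apply: (@reg_ext (mxeval 'X_(mxvec_index i j))).
  by move=> x _; rewrite /mxeval mevalXU mxvecE.
by apply: reg_poly; exact: mpolyOverX.
Qed.

Lemma det_neq0 x : G x -> \det x != 0.
Proof. by move=> /G_unit; rewrite unitmxE unitfE. Qed.

Lemma reg_add f g : K_regular K G f -> K_regular K G g ->
  K_regular K G (fun x => f x + g x).
Proof.
move=> [p [k [Kp fE]]] [q [l [Kq gE]]].
exists (p * detp ^+ l + q * detp ^+ k), (k + l)%N; split.
  by rewrite rpredD ?rpredM ?rpredX ?detp_over.
move=> x Gx; rewrite fE// gE// exprD /mxeval mevalD -!/(mxeval _ x).
rewrite !mxeval_comb// addf_div ?expf_neq0 ?det_neq0//.
Qed.

Lemma reg_mul f g : K_regular K G f -> K_regular K G g ->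
  K_regular K G (fun x => f x * g x).
Proof.
move=> [p [k [Kp fE]]] [q [l [Kq gE]]].
exists (p * q), (k + l)%N; split; first by rewrite rpredM.
move=> x Gx; rewrite fE// gE// exprD /mxeval mevalM -!/(mxeval _ x).
by rewrite mulf_div.
Qed.

Lemma reg_opp f : K_regular K G f -> K_regular K G (fun x => - f x).
Proof.
move=> fr; apply: (@reg_ext (fun x => -1 * f x)).
  by move=> x _; rewrite mulN1r.
by apply: reg_mul => //; apply: reg_const; rewrite rpredN1.
Qed.

Lemma reg_sum (I : Type) (r : seq I) (P : pred I) (F : I -> 'M[C]_n -> C) :
  (forall i, P i -> K_regular K G (F i)) ->
  K_regular K G (fun x => \sum_(i <- r | P i) F i x).
Proof.
move=> Fr; elim: r => [|i r IH].
  by apply: reg_ext (reg_const (rpred0 _)) => x _; rewrite big_nil.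
have [Pi|nPi] := boolP (P i).
  by apply: reg_ext (reg_add (Fr i Pi) IH) => x _; rewrite big_cons Pi.
by apply: reg_ext IH => x _; rewrite big_cons (negPf nPi).
Qed.

Lemma reg_prod (I : Type) (r : seq I) (P : pred I) (F : I -> 'M[C]_n -> C) :
  (forall i, P i -> K_regular K G (F i)) ->
  K_regular K G (fun x => \prod_(i <- r | P i) F i x).
Proof.
move=> Fr; elim: r => [|i r IH].
  by apply: reg_ext (reg_const (rpred1 _)) => x _; rewrite big_nil.
have [Pi|nPi] := boolP (P i).
  by apply: reg_ext (reg_mul (Fr i Pi) IH) => x _; rewrite big_cons Pi.
by apply: reg_ext IH => x _; rewrite big_cons (negPf nPi).
Qed.

Lemma reg_exp f k : K_regular K G f -> K_regular K G (fun x => f x ^+ k).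
Proof.
move=> fr; elim: k => [|k IH].
  by apply: reg_ext (reg_const (rpred1 _)) => x _; rewrite expr0.
by apply: reg_ext (reg_mul fr IH) => x _; rewrite exprS.
Qed.

Lemma reg_meval N (q : {mpoly C[N]}) (h : 'M[C]_n -> 'I_N -> C) :
  q \is a mpolyOver N K -> (forall l, K_regular K G (fun x => h x l)) ->
  K_regular K G (fun x => q.@[h x]).
Proof.
move=> Kq hr; apply: (@reg_ext
  (fun x => \sum_(m <- msupp q) q@_m * \prod_i h x i ^+ m i)).
  by move=> x _; rewrite mevalE.
apply: reg_sum => m _; apply: reg_mul.
  by apply: reg_const; have /mpolyOverP/(_ m) := Kq.
by apply: reg_prod => i _; apply: reg_exp.
Qed.

Lemma reg_detV : K_regular K G (fun x => (\det x)^-1).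
Proof.
exists 1, 1%N; split; first exact: rpred1.
by move=> x _; rewrite /mxeval meval1 div1r expr1.
Qed.

Definition reg_mx m p (f : 'M[C]_n -> 'M[C]_(m, p)) : Prop :=
  forall i j, K_regular K G (fun x => f x i j).

Lemma reg_mx_id : reg_mx id.
Proof. by move=> i j; exact: reg_entry. Qed.

Lemma reg_mx_const m p (A : 'M[C]_(m, p)) :
  (forall i j, A i j \in K) -> reg_mx (fun=> A).
Proof. by move=> KA i j; exact: reg_const. Qed.

Lemma reg_mx_ext m p (f g : 'M[C]_n -> 'M[C]_(m, p)) :
  (forall x, G x -> f x = g x) -> reg_mx f -> reg_mx g.
Proof. by move=> fg fr i j; apply: reg_ext (fr i j) => x Gx; rewrite fg. Qed.

Lemma reg_mxM m p q (f : 'M[C]_n -> 'M[C]_(m, p))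
    (g : 'M[C]_n -> 'M[C]_(p, q)) :
  reg_mx f -> reg_mx g -> reg_mx (fun x => f x *m g x).
Proof.
move=> fr gr i j; apply: (@reg_ext (fun x => \sum_k f x i k * g x k j)).
  by move=> x _; rewrite mxE.
by apply: reg_sum => k _; exact: reg_mul.
Qed.

Lemma reg_mxD m p (f g : 'M[C]_n -> 'M[C]_(m, p)) :
  reg_mx f -> reg_mx g -> reg_mx (fun x => f x + g x).
Proof.
move=> fr gr i j; apply: reg_ext (reg_add (fr i j) (gr i j)) => x _.
by rewrite mxE.
Qed.

Lemma reg_mxN m p (f : 'M[C]_n -> 'M[C]_(m, p)) :
  reg_mx f -> reg_mx (fun x => - f x).
Proof.
by move=> fr i j; apply: reg_ext (reg_opp (fr i j)) => x _; rewrite mxE.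
Qed.

Lemma reg_det m (f : 'M[C]_n -> 'M[C]_m) : reg_mx f ->
  K_regular K G (fun x => \det (f x)).
Proof.
move=> fr; apply: reg_sum => s _; apply: reg_mul.
  by apply: reg_const; rewrite rpred_sign.
by apply: reg_prod => i _.
Qed.

Lemma reg_invmx : reg_mx (@invmx _ n).
Proof.
move=> i j; apply: (@reg_ext (fun x => (\det x)^-1 * (\adj x) i j)).
  by move=> x Gx; rewrite /invmx G_unit// [in RHS]mxE.
apply: reg_mul; first exact: reg_detV.
apply: (@reg_ext (fun x => cofactor x j i)) => [x _|]; first by rewrite mxE.
apply: reg_mul; first by apply: reg_const; rewrite rpredX ?rpredN1.
apply: (@reg_det _ (fun x => row' j (col' i x))) => a b.
by apply: reg_ext (reg_entry (lift j a) (lift i b)) => x _; rewrite !mxE.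
Qed.

Lemma reg_ulog : reg_mx (@ulog C n).
Proof.
have reg_pow j : reg_mx (fun x : 'M[C]_n => (x - 1) ^+ j).
  elim: j => [|j IH].
    apply: (@reg_mx_ext _ _ (fun=> 1)) => [x _|]; first by rewrite expr0.
    by apply: reg_mx_const => a b; rewrite mxE; case: eqP;
      rewrite ?rpred1 ?rpred0.
  apply: (@reg_mx_ext _ _ (fun x => (x - 1) *m (x - 1) ^+ j)) => [x _|].
    by rewrite exprS.
  apply: reg_mxM IH; apply: reg_mxD; first exact: reg_mx_id.
  apply: reg_mxN; apply: reg_mx_const => a b.
  by rewrite mxE; case: eqP; rewrite ?rpred1 ?rpred0.
move=> a b; apply: (@reg_ext
  (fun x => \sum_(j < n) (binp C j)`_1 * ((x - 1) ^+ j) a b)).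
  by move=> x _; rewrite summxE; apply: eq_bigr => j _; rewrite mxE.
apply: reg_sum => j _; apply: reg_mul (reg_pow j a b).
apply: reg_const; apply: (polyOverP (_ : binp C j \is a polyOver K)).
rewrite polyOverZ ?rpredV ?rpred_nat//; apply: rpred_prod => l _.
by rewrite rpredB ?polyOverX ?polyOverC ?rpred_nat.
Qed.

End Ring.

End RegularFunctions.

(** * Abstract groups of matrices and their endomorphisms *)

Section MatrixGroups.
Variables (F : fieldType) (n : nat).
Implicit Types (P S : set 'M[F]_n) (f g p q : 'M[F]_n -> 'M[F]_n).

Definition mx_group P : Prop :=
  [/\ P 1%:M, forall x y, P x -> P y -> P (x *m y),
      forall x, P x -> P (invmx x) & forall x, P x -> x \in unitmx].

Definition mx_endo P f : Prop :=
  (forall x, P x -> P (f x)) /\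
  forall x y, P x -> P y -> f (x *m y) = f x *m f y.

Lemma mx_endo1 P f : mx_group P -> mx_endo P f -> f 1%:M = 1%:M.
Proof.
move=> [P1 _ _ PU] [fP fM]; have f1U := PU _ (fP _ P1).
by rewrite -(mulmxK f1U (f 1%:M)) -fM// mulmx1 mulmxV.
Qed.

Lemma mx_endoV P f x : mx_group P -> mx_endo P f -> P x ->
  f (invmx x) = invmx (f x).
Proof.
move=> PG fe Px; have [P1 PM PV PU] := PG; have [fP fM] := fe.
have fxU := PU _ (fP _ Px).
rewrite -(mulKmx fxU (f (invmx x))) -fM ?mulmxV ?(mx_endo1 PG fe) ?mulmx1//.
- exact: PU.
- exact: PV.
Qed.

Lemma mx_group_preim P S f : mx_group P -> mx_group S -> mx_endo P f ->
  mx_group [set x | P x /\ S (f x)].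
Proof.
move=> PG SG fe; have [P1 PM PV PU] := PG; have [fP fM] := fe.
have [S1 SM SV SU] := SG; split.
- by split=> //; rewrite (mx_endo1 PG fe).
- by move=> x y [Px Sx] [Py Sy]; split; [exact: PM|rewrite fM//; exact: SM].
- by move=> x [Px Sx]; split; [exact: PV|rewrite (mx_endoV PG fe)//; exact: SV].
- by move=> x [Px _]; exact: PU.
Qed.

Lemma mx_group_eq P f : mx_group P -> mx_endo P f ->
  mx_group [set x | P x /\ f x = x].
Proof.
move=> PG fe; have [P1 PM PV PU] := PG; have [fP fM] := fe; split.
- by split=> //; rewrite (mx_endo1 PG fe).
- by move=> x y [Px fx] [Py fy]; split; [exact: PM|rewrite fM// fx fy].
- by move=> x [Px fx]; split; [exact: PV|rewrite (mx_endoV PG fe)// fx].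
- by move=> x [Px _]; exact: PU.
Qed.

Lemma mx_groupI P S : mx_group P -> mx_group S -> mx_group (P `&` S).
Proof.
move=> [P1 PM PV PU] [S1 SM SV SU].
split=> [//|x y [Px Sx] [Py Sy]|x [Px Sx]|x [Px _]].
- by split; [exact: PM|exact: SM].
- by split; [exact: PV|exact: SV].
- exact: PU.
Qed.

Lemma mx_endo_comp P f g : mx_endo P f -> mx_endo P g ->
  mx_endo P (fun x => g (f x)).
Proof.
move=> [fP fM] [gP gM]; split=> [x Px|x y Px Py]; first exact/gP/fP.
by rewrite fM// gM//; exact: fP.
Qed.

Lemma mx_endo_inj (H : set 'M[F]_n) f :
  mx_group H -> mx_endo H f -> (forall x, H x -> f x = 1%:M -> x = 1%:M) ->
  forall x y, H x -> H y -> f x = f y -> x = y.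
Proof.
move=> HG fe f1 x y Hx Hy fxy; have [_ HM HV HU] := HG; have [fH fM] := fe.
have HyV := HV _ Hy; have yU := HU _ Hy; have fyU := HU _ (fH _ Hy).
have : x *m invmx y = 1%:M.
  apply: f1; first exact: HM.
  by rewrite (fM _ _ Hx HyV) (mx_endoV HG fe Hy) fxy mulmxV.
by move/(congr1 (mulmx^~ y)); rewrite mulmxKV// mul1mx.
Qed.

Lemma center_mx_group P : mx_group P ->
  mx_group [set z | P z /\ forall x, P x -> z *m x = x *m z].
Proof.
move=> [P1 PM PV PU]; split.
- by split=> // x _; rewrite mul1mx mulmx1.
- move=> x y [Px xC] [Py yC]; split; first exact: PM.
  by move=> z Pz; rewrite -mulmxA yC// !mulmxA xC.
- move=> x [Px xC]; split=> [|z Pz]; first exact: PV.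
  have xU := PU _ Px.
  by rewrite -[in LHS](mulmxK xU z) !mulmxA -(mulmxA _ z x) -xC//
    mulmxA mulVmx// mul1mx.
- by move=> x [Px _]; exact: PU.
Qed.

End MatrixGroups.

Section AutomorphismInverse.
Variables (F : fieldType) (n : nat) (P : set 'M[F]_n).
Variable Phi : 'M[F]_n -> 'M[F]_n.
Hypotheses (PG : mx_group P) (Pe : mx_endo P Phi) (Pbij : set_bij P P Phi).

(** The inverse serves as an abstract homomorphism: subgroups defined
    through it are described in terms of Phi alone when they are shown to be
    K-subgroups. *)
Lemma automorphism_inverse : exists Psi : 'M[F]_n -> 'M[F]_n,
  [/\ mx_endo P Psi, forall x, P x -> Psi (Phi x) = x
    & forall y, P y -> Phi (Psi y) = y].
Proof.
have [_ inj surj] := Pbij; have [PP PM] := Pe; have [P1 PMul _ _] := PG.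
have /choice[Psi PsiP] : forall y, exists x, P y -> P x /\ Phi x = y.
  move=> y; have [Py|nPy] := pselect (P y); last by exists y.
  by have [x Px xy] := surj y Py; exists x.
have PsiK x : P x -> Psi (Phi x) = x.
  move=> Px; have [PPsi PsiE] := PsiP _ (PP _ Px).
  by apply: inj; rewrite ?inE.
exists Psi; split=> //; last by move=> y /PsiP[].
split=> [x /PsiP[]//|x y Px Py].
have [Px' xE] := PsiP x Px; have [Py' yE] := PsiP y Py.
by rewrite -{1}xE -{1}yE -PM// PsiK//; exact: PMul.
Qed.

Lemma automorphism_center z :
  P z -> (forall x, P x -> z *m x = x *m z) ->
  forall x, P x -> Phi z *m x = x *m Phi z.
Proof.
have [_ inj surj] := Pbij; have [PP PM] := Pe.
by move=> Pz zC x /surj[y Py <-]; rewrite -!PM// zC.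
Qed.

End AutomorphismInverse.

(** * Subsets cut out by regular functions *)

Section KClosedSubsets.
Variables (R : realType) (K : divringClosed R[i]).
Local Notation C := R[i].

Lemma K_group_unit n (G : set 'M[C]_n) x : K_group K G -> G x -> x \in unitmx.
Proof. by move=> [[s _ ->] _ _ _] []. Qed.

Lemma K_group_mx_group m (H : set 'M[C]_m) : K_group K H -> mx_group H.
Proof.
by move=> KH; have [_ H1 HM HV] := KH; split=> // x Hx;
  exact: (K_group_unit KH Hx).
Qed.

Lemma K_morphism_endo m (H : set 'M[C]_m) f : K_morphism K H H f -> mx_endo H f.
Proof. by move=> [fH fM _]; split. Qed.

(** The functions have determinants as denominators, whereas a K-group is
    defined by polynomials; [K_cut_group] removes the denominators. *)
Definition K_cut n (G H : set 'M[C]_n) : Prop :=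
  exists (I : finType) (f : I -> 'M[C]_n -> C),
    (forall i, K_regular K G (f i)) /\
    H = [set x | G x /\ forall i, f i x = 0].

Lemma K_cut_group n (G H : set 'M[C]_n) : K_group K G -> K_cut G H ->
  H 1%:M -> (forall x y, H x -> H y -> H (x *m y)) ->
  (forall x, H x -> H (invmx x)) -> K_group K H.
Proof.
move=> KG [I [f [fr HE]]] H1 HM HV; split=> //.
have [p pE] := choice fr; have [k kE] := choice pE.
have [[s Ks GE] _ _ _] := KG.
exists (s ++ [seq p i | i <- enum I]).
  move=> q; rewrite mem_cat => /orP[/Ks//|/mapP[i _ ->]].
  by have [] := kE i.
rewrite HE; apply/seteqP; split=> x /=.
  move=> [Gx fx]; split; first exact: K_group_unit Gx.
  move=> q /=; rewrite mem_cat => /orP[|/mapP[i _ ->]].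
    by move: Gx; rewrite GE => -[_]; exact.
  have [_ /(_ x Gx)] := kE i; rewrite fx => /esym/eqP.
  rewrite mulf_eq0 invr_eq0 expf_eq0.
  rewrite (negPf (det_neq0 (@K_group_unit _ _ ^~ KG) Gx)).
  by rewrite andbF orbF => /eqP.
move=> [xU sx]; have Gx : G x.
  by rewrite GE; split=> // q qs; apply: sx => /=; rewrite mem_cat qs.
split=> // i; have [_ ->//] := kE i.
rewrite (_ : mxeval _ _ = 0) ?mul0r//; apply: sx => /=.
by rewrite mem_cat map_f ?orbT// mem_enum.
Qed.

Lemma K_cut_sub n (G H : set 'M[C]_n) : K_cut G H -> H `<=` G.
Proof. by move=> [I [f [_ ->]]] x []. Qed.

Lemma K_cut_forall n (G : set 'M[C]_n) (I : finType) (H : I -> set 'M[C]_n) :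
  (forall i, K_cut G (H i)) -> K_cut G [set x | G x /\ forall i, H i x].
Proof.
move=> HK; have [J Jf] := choice HK.
pose f i := projT1 (cid (Jf i)); have fP i :
  (forall j, K_regular K G (f i j)) /\
  H i = [set x | G x /\ forall j, f i j x = 0] := projT2 (cid (Jf i)).
exists {i : I & J i}, (fun ij => f (tag ij) (tagged ij)); split.
  by move=> [i j] /=; have [+ _] := fP i; exact.
apply/seteqP; split=> x [Gx Hx]; split=> //.
  by move=> [i j] /=; have := Hx i; have [_ ->] := fP i; case.
move=> i; have [_ ->] := fP i; split=> // j.
exact: (Hx (existT _ i j)).
Qed.

Lemma K_cut_setI n (G H1 H2 : set 'M[C]_n) :
  K_cut G H1 -> K_cut G H2 -> K_cut G (H1 `&` H2).
Proof.
move=> H1K H2K.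
rewrite (_ : _ `&` _ =
    [set x | G x /\ forall b : bool, (if b then H1 else H2) x]).
  by apply: K_cut_forall => -[].
apply/seteqP; split=> [x [H1x H2x]|x [Gx Hx]].
  by split; [exact: (K_cut_sub H1K)|case].
by split; [exact: (Hx true)|exact: (Hx false)].
Qed.

Lemma K_cut_zero n (G : set 'M[C]_n) m p (f : 'M[C]_n -> 'M[C]_(m, p)) :
  reg_mx K G f -> K_cut G [set x | G x /\ f x = 0].
Proof.
move=> fr; exists ('I_m * 'I_p)%type, (fun ij x => f x ij.1 ij.2); split=> //.
apply/seteqP; split=> x [Gx fx]; split=> //; first by move=> ij; rewrite fx mxE.
by apply/matrixP => i j; rewrite mxE; exact: (fx (i, j)).
Qed.

Lemma K_morphism1 m n (G : set 'M[C]_m) (H : set 'M[C]_n) f :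
  K_group K G -> K_group K H -> K_morphism K G H f -> f 1%:M = 1%:M.
Proof.
move=> [_ G1 _ _] KH [fGH fM _].
have f1U : f 1%:M \in unitmx by apply: (K_group_unit KH); exact: fGH.
by rewrite -(mulmxK f1U (f 1%:M)) -fM// mulmx1 mulmxV.
Qed.

(** The only issue is the denominator of g, and 1 / det (f x) = det
    (f (x^-1)) is regular because f is a morphism of groups. *)
Lemma reg_comp m n (G : set 'M[C]_m) (H : set 'M[C]_n) f g :
  K_group K G -> K_group K H -> K_morphism K G H f ->
  K_regular K H g -> K_regular K G (fun x => g (f x)).
Proof.
move=> KG KH fm [q [k [Kq gE]]]; have [fGH fM fr] := fm.
have G_unit x : G x -> x \in unitmx by exact: K_group_unit.
have [_ G1 GM GV] := KG.
apply: (@reg_ext _ _ _ _ (fun x => mxeval q (f x) * (\det (f (invmx x))) ^+ k)).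
  move=> x Gx; rewrite gE; last exact: fGH.
  congr (_ * _); rewrite -exprVn; congr (_ ^+ _).
  have fxU : f x \in unitmx by apply: (K_group_unit KH); exact: fGH.
  have f1 := K_morphism1 KG KH fm.
  have : \det (f x *m f (invmx x)) = 1.
    by rewrite -fM ?mulmxV ?f1 ?det1//; [exact: G_unit|exact: GV].
  rewrite det_mulmx => /(canRL (mulKf _)) ->; first by rewrite mulr1.
  by move: fxU; rewrite unitmxE unitfE.
apply: reg_mul.
  apply: reg_meval => // l; case/mxvec_indexP: l => i j.
  by apply: reg_ext (fr i j) => x _; rewrite mxvecE.
apply: reg_exp; apply: reg_det => // i j.
have [p [l [Kp fE]]] := fr i j.
apply: (@reg_ext _ _ _ _ (fun x => mxeval p (invmx x) * \det x ^+ l)).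
  move=> x Gx; rewrite fE; last exact: GV.
  by rewrite det_inv exprVn invrK.
apply: reg_mul; last first.
  apply: reg_exp; apply: (@reg_ext _ _ _ _ (mxeval (detp R m))).
    by move=> x _; exact: detpE.
  by apply: reg_poly; exact: detp_over.
apply: reg_meval => // ab; case/mxvec_indexP: ab => a b.
by apply: reg_ext (reg_invmx K G_unit a b) => x _; rewrite mxvecE.
Qed.

Lemma reg_mx_comp m n p q (G : set 'M[C]_m) (H : set 'M[C]_n) f
    (g : 'M[C]_n -> 'M[C]_(p, q)) :
  K_group K G -> K_group K H -> K_morphism K G H f ->
  reg_mx K H g -> reg_mx K G (fun x => g (f x)).
Proof. by move=> KG KH fm gr i j; exact: (reg_comp KG KH fm (gr i j)). Qed.

Lemma K_morphism_comp m n p (G : set 'M[C]_m) (H : set 'M[C]_n)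
    (L : set 'M[C]_p) f g :
  K_group K G -> K_group K H ->
  K_morphism K G H f -> K_morphism K H L g ->
  K_morphism K G L (fun x => g (f x)).
Proof.
move=> KG KH fm gm; have [fGH fM fr] := fm; have [gHL gM gr] := gm; split.
- by move=> x Gx; apply/gHL/fGH.
- by move=> x y Gx Gy; rewrite fM ?gM//; exact: fGH.
- exact: (reg_mx_comp KG KH fm gr).
Qed.

Lemma K_cut_preimage m n (G : set 'M[C]_m) (H H' : set 'M[C]_n) f :
  K_group K G -> K_group K H -> K_morphism K G H f -> K_cut H H' ->
  K_cut G [set x | G x /\ H' (f x)].
Proof.
move=> KG KH fm [I [h [hr ->]]]; have [fGH _ _] := fm.
exists I, (fun i x => h i (f x)); split.
  by move=> i; exact: (reg_comp KG KH fm (hr i)).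
apply/seteqP; split=> x [Gx]; first by move=> [_ hx].
by move=> hx; split=> //; split=> //; exact: fGH.
Qed.

Section Equivariance.
Variable s : {rmorphism C -> C}.
Hypothesis sA : field_aut K s.

Lemma mxeval_map n (p : {mpoly C[n * n]}) x : p \is a mpolyOver (n * n) K ->
  mxeval p (map_mx s x) = s (mxeval p x).
Proof.
move=> Kp; rewrite /mxeval !mevalE rmorph_sum; apply: eq_bigr => m _.
rewrite rmorphM; have [sK _] := sA; rewrite sK; last first.
  by have /mpolyOverP/(_ m) := Kp.
congr (_ * _); rewrite rmorph_prod; apply: eq_bigr => i _.
by rewrite rmorphXn -map_mxvec mxE.
Qed.

Lemma K_group_map n (G : set 'M[C]_n) x : K_group K G -> G x ->
  G (map_mx s x).
Proof.
move=> [[l Kl ->] _ _ _] [xU lx]; split; first by rewrite /= map_unitmx.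
by move=> p pl; rewrite mxeval_map ?lx ?rmorph0//; exact: Kl.
Qed.

Lemma reg_map n (G : set 'M[C]_n) f x : K_group K G -> K_regular K G f ->
  G x -> f (map_mx s x) = s (f x).
Proof.
move=> KG [p [k [Kp fE]]] Gx; rewrite !fE//; last exact: K_group_map.
by rewrite mxeval_map// det_map_mx fmorph_div rmorphXn.
Qed.

Lemma reg_mx_map n m p (G : set 'M[C]_n) (f : 'M[C]_n -> 'M[C]_(m, p)) x :
  K_group K G -> reg_mx K G f -> G x -> f (map_mx s x) = map_mx s (f x).
Proof.
by move=> KG fr Gx; apply/matrixP => i j; rewrite mxE;
  exact: (reg_map KG (fr i j)).
Qed.

End Equivariance.
End KClosedSubsets.

(** * The center as a vector group *)

Section CenterCoordinates.
Variables (R : realType) (K : divringClosed R[i]).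
Local Notation C := R[i].
Local Notation at_ t := (map_mx (horner_eval t)).

(** The polynomial identity (u^t - 1)^n = 0 in t holds at natural
    numbers. *)
Lemma unipotent_upow n (u : 'M[C]_n) t :
  (forall k, unipotent (u ^+ k)) -> unipotent (upow u t).
Proof.
move=> uu; have u1 : unipotent u by rewrite -[u]expr1.
have U0 : (upoly u - 1) ^+ n = 0.
  apply: poly_mx_nat_eq => k; rewrite map_mx_exp map_mxB map_mx1 map_mx0.
  by have := upow_nat k u1; rewrite /upow => ->; exact: uu.
have := congr1 (at_ t) U0.
by rewrite map_mx_exp map_mxB map_mx1 map_mx0.
Qed.

Lemma unipotent_unit n (u : 'M[C]_n) : unipotent u -> u \in unitmx.
Proof.
rewrite /unipotent => un.
have : u *m \sum_(i < n) (1 - u) ^+ i = 1%:M.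
  have := subrX1 (1 - u) n; rewrite -{1}[1 - u]opprB exprNn un mulr0.
  rewrite sub0r addrAC subrr sub0r mulNr => /oppr_inj uS.
  exact: (esym uS).
by case/mulmx1_unit.
Qed.

(** Both sides are rational functions of t, and they agree at natural
    numbers. *)
Lemma morphism_upow n (G : set 'M[C]_n) (f : 'M[C]_n -> 'M[C]_n) z t :
  K_group K G -> K_morphism K G G f -> G z -> unipotent z -> unipotent (f z) ->
  (forall t, G (upow z t)) -> f (upow z t) = upow (f z) t.
Proof.
move=> KG fm Gz zu fzu Gzt; have [fGG fM fr] := fm.
have [_ G1 GM _] := KG.
have GX k : G (z ^+ k).
  by elim: k => [|k IH]; [rewrite expr0|rewrite exprS; exact: GM].
have fX k : f (z ^+ k) = f z ^+ k.
  elim: k => [|k IH]; first by rewrite !expr0; exact: K_morphism1 fm.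
  by rewrite !exprS -IH; exact: fM.
apply/matrixP => i j; have [p [l [_ fE]]] := fr i j.
have det0 s : \det (upow z s) != 0.
  by have := K_group_unit KG (Gzt s); rewrite unitmxE unitfE.
rewrite fE//; apply: (canLR (mulfK _)); first by rewrite expf_neq0.
pose P := mmap polyC (fun k => mxvec (upoly z) ord0 k) p.
pose Q := upoly (f z) i j * \det (upoly z) ^+ l.
have detE s : (\det (upoly z)).[s] = \det (upow z s).
  by rewrite /upow det_map_mx.
have PE s : P.[s] = mxeval p (upow z s) by rewrite -[LHS]mxev_poly.
have QE s : Q.[s] = upow (f z) s i j * \det (upow z s) ^+ l.
  by rewrite hornerM horner_exp detE; congr (_ * _); rewrite mxE.
rewrite -PE -QE; congr (_.[t]); apply/eqP; rewrite -subr_eq0; apply/eqP.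
apply: poly_nat_eq0 => k; rewrite hornerD hornerN PE QE.
rewrite [upow (f z) _]upow_nat// -fX -[in f _](upow_nat k zu) fE//.
by rewrite divfK ?subrr// expf_neq0.
Qed.

(** The center is the intersection of G with the commutant of the linear
    span of G, and this span has a basis over K. *)
Lemma center_cut n (G : set 'M[C]_n) : K_group K G -> K_cut K G (alg_center G).
Proof.
move=> KG; pose S v := exists2 g, G g & v = mxvec g.
have [|m [E [_ ratE SE [X SX EX]]]] := @rational_basis C K _ S.
  by move=> s _ sA [g Gg ->]; exists (map_mx s g);
    [exact: (K_group_map sA KG)|rewrite map_mxvec].
have comm_span p (Y : 'M[C]_(p, n * n)) x v :
    (forall k, x *m vec_mx (row k Y) = vec_mx (row k Y) *m x) ->
    (v <= Y)%MS -> x *m vec_mx v = vec_mx v *m x.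
  move=> xY /submxP[w ->]; rewrite mulmx_sum_row linear_sum mulmx_sumr
    mulmx_suml.
  apply: eq_bigr => k _; rewrite linearZ /= -scalemxAr -scalemxAl;
    congr (_ *: _).
  exact: xY.
rewrite (_ : alg_center G = [set x | G x /\ forall k : 'I_m,
    [set x | G x /\ x *m vec_mx (row k E) - vec_mx (row k E) *m x = 0] x]).
  apply: K_cut_forall => k; apply: K_cut_zero.
  have KE : reg_mx K G (fun=> vec_mx (row k E)).
    by apply: reg_mx_const => i j; rewrite !mxE;
      exact: (iffLR (rational_mxP K E) ratE).
  have G_unit x : G x -> x \in unitmx by move=> Gx; exact: (K_group_unit KG Gx).
  by apply: reg_mxD => //; [|apply: reg_mxN]; apply: reg_mxM => //;
    exact: reg_mx_id.
apply/seteqP; split=> [x [Gx xG]|x [Gx xE]]; split=> //.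
  move=> k; split=> //; apply/eqP; rewrite subr_eq0; apply/eqP.
  apply: (comm_span _ X); last by apply: submx_trans EX; exact: row_sub.
  by move=> l; have [g Gg ->] := SX l; rewrite mxvecK; exact: xG.
move=> g Gg; rewrite -(mxvecK g); apply: (comm_span _ E).
  by move=> k; have [_ /eqP] := xE k; rewrite subr_eq0 => /eqP.
by apply: SE; exists g.
Qed.

End CenterCoordinates.

Section CenterCoordinateSystem.
Variables (R : realType) (K : divringClosed R[i]).
Local Notation C := R[i].

(** A K-isomorphism of the center with a vector group, in which
    endomorphisms defined over K are linear and given by matrices over K. *)
Definition center_coordinates n (G : set 'M[C]_n) m
    (kappa : 'M[C]_n -> 'rV[C]_m) : Prop :=
  [/\ reg_mx K G kappa,
      forall x y, alg_center G x -> alg_center G y ->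
        kappa x = kappa y -> x = y,
      forall v, exists2 z, alg_center G z & kappa z = v,
      forall x y, alg_center G x -> alg_center G y ->
        kappa (x *m y) = kappa x + kappa y
    & forall f, K_morphism K G G f ->
        (forall z, alg_center G z -> alg_center G (f z)) ->
        exists2 F : 'M[C]_m, rational_mx K F
          & forall z, alg_center G z -> kappa (f z) = kappa z *m F].

Lemma alg_center_group n (G : set 'M[C]_n) : K_group K G ->
  K_group K (alg_center G).
Proof.
move=> KG; have [Z1 ZM ZV _] := center_mx_group (K_group_mx_group KG).
exact: (K_cut_group KG (center_cut KG)).
Qed.

(** The center is unipotent, because it is closed and has no torsion, and
    [coordinates] applies. An endomorphism f commutes with the powers z^t,
    hence is linear in these coordinates; its matrix is over K because f and
    kappa commute with the field automorphisms over K. *)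
Lemma exists_center_coordinates n (G : set 'M[C]_n) :
  K_group K G -> torsion_free (alg_center G) ->
  exists m (kappa : 'M[C]_n -> 'rV[C]_m), center_coordinates G kappa.
Proof.
move=> KG Gtf; set Z := alg_center G in Gtf *.
have KZ : K_group K Z by exact: alg_center_group.
have [[l Kl ZE] Z1 ZM ZV] := KZ.
have ZG x : Z x -> G x by case.
have Zcomm x y : Z x -> Z y -> x *m y = y *m x.
  by move=> [_ xG] [Gy _]; exact: xG.
have Zinv x : Z x -> exists2 y, Z y & x *m y = 1%:M.
  by move=> Zx; exists (invmx x); [exact: ZV|exact/mulmxV/(K_group_unit KZ Zx)].
have Zunip x : Z x -> unipotent x.
  exact: (torsion_free_unipotent ZE Z1 ZM Gtf).
have ZX x k : Z x -> Z (x ^+ k).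
  by move=> Zx; elim: k => [|k IH]; [rewrite expr0|rewrite exprS; exact: ZM].
have Zpow x t : Z x -> Z (upow x t).
  move=> Zx; rewrite ZE; split=> [/=|p pl].
    by apply/unipotent_unit/unipotent_upow => k; exact/Zunip/ZX.
  apply: (upow_closed _ (Zunip _ Zx)) => k.
  by have := ZX x k Zx; rewrite ZE => -[_]; exact.
have Zst s x : field_aut K s -> Z x -> Z (map_mx s x).
  by move=> sA Zx; exact: (K_group_map sA KZ Zx).
have G_unit x : G x -> x \in unitmx by move=> Gx; exact: (K_group_unit KG Gx).
have [m [kappa [kreg kinj ksurj kadd kscale]]] :
    exists m (kappa : 'M[C]_n -> 'rV[C]_m), [/\ reg_mx K G kappa,
      forall x y, Z x -> Z y -> kappa x = kappa y -> x = y,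
      forall v, exists2 z, Z z & kappa z = v,
      forall x y, Z x -> Z y -> kappa (x *m y) = kappa x + kappa y
    & forall x t, Z x -> kappa (upow x t) = t *: kappa x].
  have [m [E [ratE kinj ksurj kadd kscale]]] :=
    coordinates Z1 ZM Zcomm Zinv Zunip Zpow Zst.
  exists m, (fun x => mxvec (ulog x) *m pinvmx E); split=> //.
  apply: reg_mxM => //.
    move=> i j; rewrite ord1; case/mxvec_indexP: j => a b.
    by apply: reg_ext (reg_ulog K G_unit a b) => x _; rewrite mxvecE.
  apply: reg_mx_const; apply/(rational_mxP K) => s sA.
  by rewrite map_pinvmx ratE.
exists m, kappa; split=> // f fm fZ.
have fpow z t : Z z -> f (upow z t) = upow (f z) t.
  move=> Zz; apply: (morphism_upow _ KG fm); [exact: ZG|exact: Zunip| |].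
    exact/Zunip/fZ.
  by move=> t'; exact/ZG/Zpow.
have /choice[h hP] : forall v, exists z, Z z /\ kappa z = v.
  by move=> v; have [z Zz zv] := ksurj v; exists z.
pose g v := kappa (f (h v)).
have kf z : Z z -> kappa (f z) = g (kappa z).
  move=> Zz; congr (kappa (f _)).
  by have [Zh kh] := hP (kappa z); exact: (kinj _ _ Zz Zh (esym kh)).
have glin : linear g.
  move=> a v w; have [Zv kv] := hP v; have [Zw kw] := hP w.
  have Zav : Z (upow (h v) a) by exact: Zpow.
  transitivity (g (kappa (upow (h v) a *m h w))).
    by rewrite kadd// kscale// kv kw.
  rewrite -kf; last exact: ZM.
  have [_ fM _] := fm; rewrite fM; [|exact: ZG|exact: ZG].
  have Zfv := fZ _ Zv; have Zfw := fZ _ Zw.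
  by rewrite (fpow _ _ Zv) (kadd _ _ (Zpow _ a Zfv) Zfw) (kscale _ _ Zfv).
pose glin' : {linear 'rV[C]_m -> 'rV[C]_m} :=
  HB.pack g (GRing.isLinear.Build C 'rV[C]_m 'rV[C]_m _ g glin).
have gE v : g v = v *m lin1_mx glin' by rewrite mul_rV_lin1.
exists (lin1_mx glin') => [s sA|z Zz]; last by rewrite kf// gE.
have [_ [t [st ts]]] := sA.
have gs v : map_mx s (g v) = g (map_mx s v).
  have [Zv kv] := hP v; rewrite -{2}kv.
  have Gv := ZG _ Zv.
  rewrite -(reg_mx_map sA KG kreg Gv) -kf; last exact: Zst.
  have [fGG _ fr] := fm.
  rewrite (reg_mx_map sA KG fr Gv) /g.
  by rewrite (reg_mx_map sA KG kreg (fGG _ Gv)).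
apply/row_matrixP => i; rewrite !rowE -gE.
have -> : delta_mx 0 i = map_mx s (delta_mx 0 i : 'rV[C]_m).
  by rewrite map_delta_mx.
by rewrite -map_mxM -gE gs.
Qed.

End CenterCoordinateSystem.

(** * Block-diagonal matrices and products of groups *)

Section BlockDiagonal.
Variables (r : nat) (n : 'I_r -> nat).

Section Semiring.
Variable A : pzRingType.
Implicit Types B : forall i : 'I_r, 'M[A]_(n i).

Lemma mxdiagM B B' : mxdiag B *m mxdiag B' = mxdiag (fun i => B i *m B' i).
Proof.
rewrite {2}/mxdiag mul_mxdiag_mxblock; apply/eq_mxblockP => i j.
have [<-|ij] := eqVneq i j; first by rewrite !conform_mx_id.
by rewrite mulmx0.
Qed.

Lemma mxdiag1 : mxdiag (fun i => 1%:M : 'M[A]_(n i)) = 1%:M.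
Proof. exact: mxdiagZ. Qed.

Lemma mxdiag_inj B B' : mxdiag B = mxdiag B' -> forall i, B i = B' i.
Proof. by move=> /eq_mxdiagP. Qed.

(** Which case holds depends on a and b only: this is what makes entries of
    block-diagonal matrices regular functions. *)
Lemma mxdiag_entry a b :
  (forall B, mxdiag B a b = 0) \/
  exists k i j, forall B, mxdiag B a b = B k i j.
Proof.
have [e|ne] := eqVneq (tagnat.sig1 a) (tagnat.sig1 b); [right|left]; last first.
  by move=> B; rewrite mxE (negPf ne) mxE.
have entry k (e' : tagnat.sig1 a = k) (l : 'I_(n k)) : exists j, forall B,
    (if tagnat.sig1 a == k then conform_mx 0 (B (tagnat.sig1 a)) else 0
      : 'M[A]_(n (tagnat.sig1 a), n k)) (tagnat.sig2 a) l =
    B (tagnat.sig1 a) (tagnat.sig2 a) j.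
  by case: k / e' l => l; exists l => B; rewrite eqxx conform_mx_id.
have [j jE] := entry _ e (tagnat.sig2 b).
by exists (tagnat.sig1 a), (tagnat.sig2 a), j => B; rewrite mxE jE.
Qed.

Lemma submxblock_mul B (x : 'M[A]_(\sum_i n i)) i :
  submxblock (mxdiag B *m x) i i = B i *m submxblock x i i.
Proof. by rewrite -{1}[x]submxblockK mul_mxdiag_mxblock mxblockK. Qed.

Lemma mxdiag_exp B k : mxdiag B ^+ k = mxdiag (fun i => B i ^+ k).
Proof.
elim: k => [|k IH]; first by rewrite expr0 -[LHS]mxdiag1.
by rewrite exprS IH -mulmxE mxdiagM; apply/eq_mxdiagP => i; rewrite exprS.
Qed.

(** The projection of a product of groups onto its factors with index in S,
    seen as an endomorphism of the product. *)
Definition blk (S : {set 'I_r}) (x : 'M[A]_(\sum_i n i)) : 'M[A]_(\sum_i n i) :=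
  mxdiag (fun i => if i \in S then submxblock x i i else 1%:M).

(** The blocks have dependent types: conform_mx is the identity on the
    block i, where the sizes agree. *)
Definition inj_block i (x : 'M[A]_(n i)) : 'M[A]_(\sum_i n i) :=
  mxdiag (fun k => if k == i then conform_mx 1%:M x else 1%:M).

Lemma blkE (S : {set 'I_r}) B :
  blk S (mxdiag B) = mxdiag (fun i => if i \in S then B i else 1%:M).
Proof. by apply/eq_mxdiagP => i; rewrite submxblock_diag. Qed.

Lemma blk_blk (S T : {set 'I_r}) x : blk S (blk T x) = blk (S :&: T)%SET x.
Proof.
rewrite /blk; apply/eq_mxdiagP => i; rewrite inE submxblock_diag.
by case: (i \in S).
Qed.

Lemma blk_mul_disjoint (S T : {set 'I_r}) x : {in S, forall i, i \notin T} ->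
  blk S x *m blk T x = blk (S :|: T)%SET x.
Proof.
move=> dST; rewrite mxdiagM; apply/eq_mxdiagP => i; rewrite inE.
have [iS|_] := boolP (i \in S); last by rewrite mul1mx.
by rewrite (negPf (dST i iS)) mulmx1.
Qed.

Lemma blk_comm_disjoint (S T : {set 'I_r}) x y : {in S, forall i, i \notin T} ->
  blk S x *m blk T y = blk T y *m blk S x.
Proof.
move=> dST; rewrite !mxdiagM; apply/eq_mxdiagP => i.
have [iS|_] := boolP (i \in S); last by rewrite mul1mx mulmx1.
by rewrite (negPf (dST i iS)) mulmx1 mul1mx.
Qed.

Lemma blk_setT B : blk [set: 'I_r]%SET (mxdiag B) = mxdiag B.
Proof. by rewrite blkE; apply/eq_mxdiagP => i; rewrite inE. Qed.

Lemma blk_set0 x : blk finset.set0 x = 1%:M.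
Proof. by rewrite -mxdiag1; apply/eq_mxdiagP => i; rewrite inE. Qed.

Lemma blk_1 (S : {set 'I_r}) : blk S 1%:M = 1%:M.
Proof.
by rewrite -mxdiag1 blkE; apply/eq_mxdiagP => i; case: ifP.
Qed.

Lemma blk_inj_block i (x : 'M[A]_(n i)) :
  blk (finset.set1 i) (inj_block x) = inj_block x.
Proof.
rewrite blkE; apply/eq_mxdiagP => k; rewrite inE.
by case: eqP.
Qed.

Lemma inj_blockK i (x : 'M[A]_(n i)) : submxblock (inj_block x) i i = x.
Proof. by rewrite submxblock_diag eqxx conform_mx_id. Qed.

Lemma inj_block_sub i x :
  inj_block (submxblock x i i) = blk (finset.set1 i) x.
Proof.
apply/eq_mxdiagP => k; rewrite inE.
by case: eqP => // ->; rewrite conform_mx_id.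
Qed.

Lemma inj_blockM i (x y : 'M[A]_(n i)) :
  inj_block (x *m y) = inj_block x *m inj_block y.
Proof.
rewrite mxdiagM; apply/eq_mxdiagP => k.
case: eqP => [->|_]; last by rewrite mulmx1.
by rewrite !conform_mx_id.
Qed.

End Semiring.

Lemma mxdiag_unit (F : fieldType) (B : forall i, 'M[F]_(n i)) :
  (mxdiag B \in unitmx) <-> (forall i, B i \in unitmx).
Proof.
split=> [BU i|BU].
  have := submxblock_mul B (invmx (mxdiag B)) i.
  rewrite mulmxV// -mxdiag1 submxblock_diag => /esym.
  by case/mulmx1_unit.
have : mxdiag B *m mxdiag (fun i => invmx (B i)) = 1%:M.
  by rewrite mxdiagM -mxdiag1; apply/eq_mxdiagP => i; rewrite mulmxV.
by case/mulmx1_unit.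
Qed.

Lemma invmx_mxdiag (F : fieldType) (B : forall i, 'M[F]_(n i)) :
  (forall i, B i \in unitmx) ->
  invmx (mxdiag B) = mxdiag (fun i => invmx (B i)).
Proof.
move=> BU; have dU : mxdiag B \in unitmx by apply/mxdiag_unit.
rewrite -[RHS](mulKmx dU) mxdiagM.
rewrite (_ : mxdiag (fun i => B i *m _) = 1%:M) ?mulmx1//.
by rewrite -mxdiag1; apply/eq_mxdiagP => i; rewrite mulmxV.
Qed.

End BlockDiagonal.

Section ProductGroup.
Variables (R : realType) (K : divringClosed R[i]) (r : nat) (n : 'I_r -> nat).
Local Notation C := R[i].
Unset Implicit Arguments.
Variable G : forall i, set 'M[C]_(n i).
Set Implicit Arguments.
Hypothesis G_group : forall i, K_group K (G i).

Local Notation P := (alg_product G).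
Local Notation bl i x := (@submxblock _ r r n n x i i).

Lemma prodP x :
  P x <-> (forall i, G i (bl i x)) /\ x = mxdiag (fun i => (bl i x)).
Proof.
split=> [[B GB ->]|[Gx xE]]; last by exists (fun i => (bl i x)).
split=> [i|]; first by rewrite submxblock_diag.
by apply/eq_mxdiagP => i; rewrite submxblock_diag.
Qed.

Lemma prod_block x i : P x -> G i (bl i x).
Proof. by case/prodP. Qed.

Lemma prod_diag B : (forall i, G i (B i)) -> P (mxdiag B).
Proof. by move=> GB; exists B. Qed.

Lemma prod_eq x y : P x -> P y -> (forall i, (bl i x) = (bl i y)) -> x = y.
Proof.
by move=> /prodP[_ xE] /prodP[_ yE] xy; rewrite xE yE; apply/eq_mxdiagP.
Qed.

Lemma block_mul x y i : P x -> bl i (x *m y) = (bl i x) *m (bl i y).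
Proof. by move=> /prodP[_ ->]; rewrite submxblock_mul submxblock_diag. Qed.

Lemma prod1 : P 1%:M.
Proof.
rewrite -mxdiag1; apply: prod_diag => i.
by have [_ G1 _ _] := G_group i.
Qed.

Lemma prodM x y : P x -> P y -> P (x *m y).
Proof.
move=> /prodP[Gx ->] /prodP[Gy ->]; rewrite mxdiagM; apply: prod_diag => i.
by have [_ _ GM _] := G_group i; exact: GM.
Qed.

(** Inside the group of all invertible matrices, the product is cut out by
    the vanishing of the off-diagonal blocks and by the equations of the
    factors in the diagonal blocks. *)
Lemma prod_group : K_group K P.
Proof.
pose U : set 'M[C]_(\sum_i n i) := [set x | x \in unitmx].
have KU : K_group K U.
  split.
  - exists [::] => //; apply/seteqP; split=> x; first by move=> xU; split.
    by case.
  - exact: unitmx1.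
  - by move=> x y xU yU; rewrite /U /= unitmx_mul xU.
  - by move=> x xU; rewrite /U /= unitmx_inv.
have reg_block k : reg_mx K U (fun x => (bl k x)).
  move=> a b.
  apply: reg_ext (reg_entry K U (tagnat.Rank k a) (tagnat.Rank k b)) => x _.
  by rewrite mxE.
have reg_diag : reg_mx K U (fun x => mxdiag (fun k => (bl k x))).
  move=> a b; have [d0|[k [i [j dE]]]] := @mxdiag_entry r n C a b.
    by apply: reg_ext (reg_const _ (rpred0 K)) => x _; rewrite d0.
  by apply: reg_ext (reg_block k i j) => x _; rewrite dE.
apply: (K_cut_group KU); last first.
- move=> x Px; have [Gx xE] := (prodP x).1 Px.
  rewrite xE invmx_mxdiag => [|i]; last exact: (K_group_unit (G_group i) (Gx
    i)).
  by apply: prod_diag => i; have [_ _ _ GV] := G_group i; exact: GV.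
- exact: prodM.
- exact: prod1.
pose poly_seq i := projT1 (cid2 (let: And4 H _ _ _ := G_group i in H)).
have poly_over i : {in poly_seq i, forall p, p \is a mpolyOver (n i * n i) K}.
  by rewrite /poly_seq; case: cid2.
have GE i :
    G i = [set x | x \in unitmx] `&` zero_locus [set p | p \in poly_seq i].
  by rewrite /poly_seq; case: cid2.
rewrite (_ : P = [set x | U x /\ mxdiag (fun k => (bl k x)) - x = 0] `&`
  [set x | U x /\ forall i, [set x | U x /\ forall k : 'I_(size (poly_seq i)),
     mxeval (nth 0 (poly_seq i) k) (bl i x) = 0] x]).
  apply: K_cut_setI.
    apply: K_cut_zero; apply: reg_mxD => //; apply: reg_mxN; exact: reg_mx_id.
  apply: K_cut_forall => i; exists 'I_(size (poly_seq i)),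
    (fun (k : 'I_(size (poly_seq i))) x =>
      mxeval (nth 0 (poly_seq i) k) (bl i x)).
  split=> // k.
  apply: reg_meval => //; first by apply: poly_over; rewrite mem_nth.
  move=> l; case/mxvec_indexP: l => a b.
  by apply: reg_ext (reg_block i a b) => x _; rewrite mxvecE.
apply/seteqP; split=> x.
  move=> Px; have [Gx xE] := (prodP x).1 Px.
  have Ux : U x.
    by rewrite xE /U /=; apply/mxdiag_unit => i;
      exact: (K_group_unit (G_group i)).
  split; split=> //; first by rewrite -xE subrr.
  move=> i; split=> // k; have := Gx i; rewrite GE => -[_]; apply.
  by rewrite /= mem_nth.
move=> [[Ux /eqP]]; rewrite subr_eq0 => /eqP xE [_ xP]; rewrite -xE.
apply: prod_diag => i; rewrite GE; split.
  by move: Ux; rewrite -[X in U X]xE => /mxdiag_unit/(_ i).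
move=> p /= /(nthP 0)[k ks <-]; have [_ /(_ (Ordinal ks))] := xP i.
by [].
Qed.

Lemma proj_morphism i : K_morphism K P (G i) (fun x => (bl i x)).
Proof.
split.
- by move=> x; exact: prod_block.
- by move=> x y Px _; exact: block_mul.
- move=> a b.
  apply: reg_ext (reg_entry K P (tagnat.Rank i a) (tagnat.Rank i b)) => x _.
  by rewrite mxE.
Qed.

Lemma diag_morphism m (H : set 'M[C]_m) (f : forall i, 'M[C]_m -> 'M[C]_(n i)) :
  (forall i, K_morphism K H (G i) (f i)) ->
  K_morphism K H P (fun x => mxdiag (fun i => f i x)).
Proof.
move=> fm; split.
- by move=> x Hx; apply: prod_diag => i; have [fH _ _] := fm i; exact: fH.
- move=> x y Hx Hy; rewrite mxdiagM; apply/eq_mxdiagP => i.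
  by have [_ fM _] := fm i; exact: fM.
- move=> a b; have [d0|[k [i [j dE]]]] := @mxdiag_entry r n C a b.
    by apply: reg_ext (reg_const _ (rpred0 K)) => x _; rewrite d0.
  by have [_ _ fr] := fm k; apply: reg_ext (fr i j) => x _; rewrite dE.
Qed.

Lemma trivial_morphism m (H : set 'M[C]_m) i :
  K_morphism K H (G i) (fun=> 1%:M).
Proof.
split.
- by move=> x _; have [_ G1 _ _] := G_group i.
- by move=> x y _ _; rewrite mulmx1.
- by move=> a b; apply: reg_const; rewrite mxE; case: eqP;
    rewrite ?rpred1 ?rpred0.
Qed.

Lemma blk_morphism (S : {set 'I_r}) : K_morphism K P P (blk S).
Proof.
apply: (@diag_morphism _ _ (fun i x => if i \in S then bl i x else 1%:M)) => i.
by case: (i \in S); [exact: proj_morphism|exact: trivial_morphism].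
Qed.

Lemma inj_morphism i : K_morphism K (G i) P (@inj_block r n C i).
Proof.
apply: (@diag_morphism _ _
  (fun k x => if k == i then conform_mx 1%:M x else 1%:M)).
move=> k; case: eqP => [->|_]; last exact: trivial_morphism.
split.
- by move=> x; rewrite conform_mx_id.
- by move=> x y _ _; rewrite !conform_mx_id.
- by move=> a b; apply: reg_ext (reg_entry K (G i) a b) => x _;
    rewrite conform_mx_id.
Qed.

Lemma prod_blk (S : {set 'I_r}) x : P x -> P (blk S x).
Proof. by have [+ _ _] := blk_morphism S; exact. Qed.

Lemma prod_blkM (S : {set 'I_r}) x y : P x -> P y ->
  blk S (x *m y) = blk S x *m blk S y.
Proof. by have [_ + _] := blk_morphism S; exact. Qed.

Lemma prod_split (S : {set 'I_r}) x : P x -> x = blk S x *m blk (~: S)%SET x.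
Proof.
move=> /prodP[_ xE]; rewrite blk_mul_disjoint; last by move=> i;
  rewrite inE negbK.
by rewrite finset.setUCr {2}xE blk_setT -xE.
Qed.

Lemma factorP i x : alg_factor G i x <-> P x /\ blk (finset.set1 i) x = x.
Proof.
have G1 k : G k 1%:M by have [] := G_group k.
split=> [[B [GB B1 ->]]|[/prodP[Gx xE] xi]].
  split; last first.
    rewrite blkE; apply/eq_mxdiagP => k; rewrite inE.
    by have [//|/B1] := eqVneq k i.
  apply: prod_diag => k; have [->//|/B1 ->//] := eqVneq k i.
exists (fun k => if k \in finset.set1 i then (bl k x) else 1%:M).
split; first by rewrite inE eqxx.
  by move=> j; rewrite inE => /negPf ->.
by rewrite -[LHS]xi.
Qed.

Lemma center_prodP x :
  alg_center P x <-> P x /\ forall i, alg_center (G i) (bl i x).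
Proof.
split=> [[Px xC]|[Px xC]].
  split=> // i; split=> [|y Gy]; first exact: prod_block.
  have Piy : P (inj_block y) by have [+ _ _] := inj_morphism i; exact.
  have := congr1 (fun z => (bl i z)) (xC _ Piy).
  by rewrite !block_mul// inj_blockK.
split=> // y Py; apply: (prod_eq (prodM Px Py) (prodM Py Px)) => i.
by rewrite !block_mul//; have [_ ->] := xC i; last exact: prod_block.
Qed.

(** The center of a product is the product of the centers. *)
Lemma center_prod_torsion_free :
  (forall i, torsion_free (alg_center (G i))) -> torsion_free (alg_center P).
Proof.
move=> tf x m /center_prodP[Px xC] m0 xm.
apply: (prod_eq Px prod1) => i; rewrite -[in RHS]mxdiag1 submxblock_diag.
apply: (tf i _ m (xC i) m0).
have /prodP[_ xE] := Px; rewrite xE mxdiag_exp in xm.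
by move: xm; rewrite -mxdiag1 => /mxdiag_inj/(_ i).
Qed.

End ProductGroup.

(** * Splitting a direct factor *)

Section DirectSplittings.
Variables (F : fieldType) (n : nat).
Implicit Types (P : set 'M[F]_n) (p : 'M[F]_n -> 'M[F]_n).

(** The projections of a direct decomposition of P, and all that is used of
    them; conjugating by an automorphism preserves these properties. *)
Definition direct_split P p p' : Prop :=
  [/\ mx_endo P p, mx_endo P p', forall x, P x -> x = p x *m p' x
    & forall x y, P x -> P y -> p x *m p' y = p' y *m p x].

Lemma direct_splitC P p p' : direct_split P p p' -> direct_split P p' p.
Proof.
move=> [pe pe' pp comm]; split=> // [x Px|x y Px Py]; last by rewrite comm.
by rewrite -comm// -pp.
Qed.

Lemma direct_split_comm P p p' a b : direct_split P p p' -> P a -> P b ->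
  a *m b = b *m a -> p a *m b = b *m p a.
Proof.
move=> [[pP pM] [pP' pM'] pp comm] Pa Pb ab.
rewrite {1}(pp b Pb) mulmxA -pM// ab pM// -mulmxA comm// mulmxA.
by rewrite -pp.
Qed.

Lemma direct_split_conj P Phi Psi q q' :
  mx_endo P Phi -> mx_endo P Psi -> (forall x, P x -> Psi (Phi x) = x) ->
  direct_split P q q' ->
  direct_split P (fun x => Psi (q (Phi x))) (fun x => Psi (q' (Phi x))).
Proof.
move=> Phie Psie PsiK [qe qe' qq qcomm].
have [PP PM] := Phie; have [QP QM] := Psie.
have [qP _] := qe; have [qP' _] := qe'.
split.
- exact: (mx_endo_comp (mx_endo_comp Phie qe) Psie).
- exact: (mx_endo_comp (mx_endo_comp Phie qe') Psie).
- move=> x Px; have PPx := PP _ Px.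
  by rewrite -QM -?qq ?PsiK//; [exact: qP|exact: qP'].
- move=> x y Px Py; have PPx := PP _ Px; have PPy := PP _ Py.
  have [qx qy] := (qP _ PPx, qP' _ PPy).
  by rewrite -!QM// qcomm.
Qed.

End DirectSplittings.

Section SplittingFactor.
Variables (F : fieldType) (n : nat) (P : set 'M[F]_n).
Variables (p p' q q' : 'M[F]_n -> 'M[F]_n).
Hypotheses (PG : mx_group P) (ps : direct_split P p p').
Hypotheses (qs : direct_split P q q').

Local Notation Z := [set z | P z /\ forall x, P x -> z *m x = x *m z].

Let P1 : P 1%:M. Proof. by case: PG. Qed.
Let PM x y : P x -> P y -> P (x *m y).
Proof. by have [_ + _ _] := PG; exact. Qed.
Let pP x : P x -> P (p x). Proof. by have [[+ _] _ _ _] := ps; exact. Qed.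
Let qP x : P x -> P (q x). Proof. by have [[+ _] _ _ _] := qs; exact. Qed.
Let qP' x : P x -> P (q' x). Proof. by have [_ [+ _] _ _] := qs; exact. Qed.
Let pM x y : P x -> P y -> p (x *m y) = p x *m p y.
Proof. by have [[_ +] _ _ _] := ps; exact. Qed.
Let qM x y : P x -> P y -> q (x *m y) = q x *m q y.
Proof. by have [[_ +] _ _ _] := qs; exact. Qed.
Let qM' x y : P x -> P y -> q' (x *m y) = q' x *m q' y.
Proof. by have [_ [_ +] _ _] := qs; exact. Qed.
Let qq x : P x -> x = q x *m q' x. Proof. by have [_ _ + _] := qs; exact. Qed.

Lemma center_split z : Z z -> Z (p z).
Proof.
move=> [Pz zC]; split=> [|x Px]; first exact: pP.
by apply: (direct_split_comm ps) => //; exact: zC.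
Qed.

(** The element p (q x) commutes with the image of q', because q x does and
    p is a projection of a direct decomposition; hence q' (p (q x)) commutes
    with the image of q'. It commutes with the image of q anyway. *)
Lemma complement_center x : P x -> Z (q' (p (q x))).
Proof.
move=> Px; have Ppqx : P (p (q x)) by exact/pP/qP.
split=> [|y Py]; first exact: qP'.
have [_ _ _ comm] := qs.
rewrite (qq Py) mulmxA -(comm _ _ Py Ppqx) -!mulmxA; congr (_ *m _).
apply: (direct_split_comm (direct_splitC qs)) => //; first exact: qP'.
apply: (direct_split_comm ps); [exact: qP|exact: qP'|exact: comm].
Qed.

(** The elements q x and p' y commute because x and p' y do. For x and
    q (p y): the component p (q (p y)) is central by hypothesis and the other
    component, in the image of p', commutes with x = p x. *)
Lemma central_transfer : (forall x, P x -> p (p x) = p x) ->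
  (forall x, P x -> p x = x -> Z (p (q x))) ->
  forall x, P x -> p x = x -> Z (q x).
Proof.
move=> pp pqC x Px px; have [_ _ _ comm] := qs.
have [[_ pM'] [pP' _] psplit pcomm] := ps.
split=> [|y Py]; first exact: qP.
have xq y' : P y' -> x *m q y' = q y' *m x -> q x *m y' = y' *m q x.
  move=> Py' xqy; rewrite (qq Py') mulmxA.
  rewrite (direct_split_comm qs (b := q y'))//; last exact: qP.
  by rewrite -!mulmxA comm.
rewrite (psplit y Py).
have py1 : q x *m p y = p y *m q x.
  apply: xq; first exact: pP.
  have Pqpy : P (q (p y)) by exact/qP/pP.
  have [_ pqpC] := pqC (p y) (pP Py) (pp _ Py).
  rewrite (psplit _ Pqpy) mulmxA -pqpC// -!mulmxA; congr (_ *m _).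
  by rewrite -px; exact: pcomm.
have py2 : q x *m p' y = p' y *m q x.
  apply: (direct_split_comm qs) => //; first exact: pP'.
  by rewrite -px; exact: pcomm.
by rewrite mulmxA py1 -mulmxA py2 mulmxA.
Qed.

(** With q' and q for f, these are the two candidates for the direct
    factors of the image of p. *)
Definition split_part (f : 'M[F]_n -> 'M[F]_n) (S : set 'M[F]_n) :
    set 'M[F]_n :=
  [set x | [/\ P x, p x = x, Z (f x) & S (p (f x))]].

Lemma split_part_group f S : mx_endo P f -> mx_group S ->
  mx_group (split_part f S).
Proof.
move=> fe SG; have [pe _ _ _] := ps.
rewrite (_ : split_part f S = [set x | P x /\ p x = x] `&`
  ([set x | P x /\ Z (f x)] `&` [set x | P x /\ S (p (f x))])).
  apply: mx_groupI; first exact: mx_group_eq.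
  apply: mx_groupI; first exact: mx_group_preim (center_mx_group PG) fe.
  exact: mx_group_preim (mx_endo_comp fe pe).
by apply/seteqP; split=> [x [? ? ? ?]|x [[? ?] [[_ ?] [_ ?]]]].
Qed.

(** For a = p (q x), the element q' a is central by [complement_center];
    its S0-component is p (q' t) for some t in S0, and dividing a by t moves it
    into the first factor. *)
Lemma fitting_half S0 S1 :
  (forall x, P x -> p (p x) = p x) -> mx_group S0 ->
  (forall z, S0 z -> Z z /\ p z = z) -> (forall z, S1 z -> Z z /\ p z = z) ->
  (forall z, Z z -> p z = z ->
     exists s0 s1, [/\ S0 s0, S1 s1 & z = s0 *m s1]) ->
  (forall s, S0 s -> exists2 t, S0 t & p (q' t) = s) ->
  forall x, P x -> exists x1 t, [/\ split_part q' S1 x1, S0 t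
    & p (q x) = x1 *m t].
Proof.
move=> pp S0G S0Z S1Z Sdec S0sur x Px; have [_ _ _ PU] := PG.
have [[_ pM0] [pP' _] psplit pcomm] := ps; have [_ [_ _] _ _] := qs.
have qe' : mx_endo P q' by have [] := qs.
have pe : mx_endo P p by have [] := ps.
set a := p (q x); have Pa : P a by exact/pP/qP.
have pa : p a = a by exact/pp/qP.
have Zqa : Z (q' a) := complement_center Px.
have Zpqa : Z (p (q' a)) := center_split Zqa.
have [|s0 [s1 [S0s0 S1s1 as01]]] := Sdec _ Zpqa; first exact/pp/qP'.
have [t S0t ts0] := S0sur _ S0s0.
have [Zt pt] := S0Z _ S0t; have [Pt tC] := Zt.
have [_ _ S0V _] := S0G.
have S0tV := S0V _ S0t; have [ZtV ptV] := S0Z _ S0tV; have [PtV tVC] := ZtV.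
exists (a *m invmx t), t; split=> //; last by rewrite mulmxKV// PU.
have [_ ZM ZV _] := center_mx_group PG.
have [S0s0Z _] := S0Z _ S0s0; have [Ps0 s0C] := S0s0Z.
have Zqt : Z (q' t).
  have Pqt := qP' Pt; split=> // y Py.
  by apply: (direct_split_comm (direct_splitC qs)) => //; exact: tC.
split.
- exact: PM.
- by rewrite pM// pa ptV.
- rewrite qM' // (mx_endoV PG qe' Pt); exact: (ZM _ _ Zqa (ZV _ Zqt)).
- rewrite (qM' Pa PtV) (pM (qP' Pa) (qP' PtV)) (mx_endoV PG qe' Pt).
  rewrite (mx_endoV PG pe (qP' Pt)) ts0 as01 (s0C s1); last first.
    by have [[]] := S1Z _ S1s1.
  by rewrite mulmxK// PU.
Qed.

End SplittingFactor.

Section FittingSplitting.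
Variables (R : realType) (n : nat).
Local Notation F := R[i].
Variables (P : set 'M[F]_n) (p p' q q' : 'M[F]_n -> 'M[F]_n).
Hypotheses (PG : mx_group P) (ps : direct_split P p p').
Hypotheses (qs : direct_split P q q').
Hypothesis pp : forall x, P x -> p (p x) = p x.
Local Notation Z := [set z | P z /\ forall x, P x -> z *m x = x *m z].
Variables (S0 S1 : set 'M[F]_n).
Hypotheses (S0G : mx_group S0) (S1G : mx_group S1).
Hypotheses (S0Z : forall z, S0 z -> Z z /\ p z = z).
Hypotheses (S1Z : forall z, S1 z -> Z z /\ p z = z).
Hypothesis Sdec : forall z, Z z -> p z = z ->
  exists s0 s1, [/\ S0 s0, S1 s1 & z = s0 *m s1].
Hypothesis Sint : forall z, S0 z -> S1 z -> z = 1%:M.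
Hypotheses (q_S0 : forall s, S0 s -> S0 (p (q s)))
           (q_S1 : forall s, S1 s -> S1 (p (q s))).
Hypotheses (q'_S0 : forall s, S0 s -> S0 (p (q' s)))
           (q'_S1 : forall s, S1 s -> S1 (p (q' s))).
Hypotheses (q_S1_inj : forall s, S1 s -> p (q s) = 1%:M -> s = 1%:M)
           (q_S1_sur : forall s, S1 s -> exists2 t, S1 t & p (q t) = s).
Hypotheses (q'_S0_inj : forall s, S0 s -> p (q' s) = 1%:M -> s = 1%:M)
           (q'_S0_sur : forall s, S0 s -> exists2 t, S0 t & p (q' t) = s).

Let H1 := split_part P p q' S1.
Let H2 := split_part P p q S0.

(** Existence of the decomposition of x = p (q x) p (q' x) is
    [fitting_half] for both factors. An element x of both factors is central;
    writing x = s0 s1, the image p (q' s0) lies in S0 and in S1, hence s0 = 1,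
    and similarly s1 = 1. *)
Lemma fitting_splitting :
  [/\ is_internal_product [set x | P x /\ p x = x] H1 H2,
      H1 = [set 1%:M] -> forall x, P x -> p x = x -> Z (p (q x))
    & H2 = [set 1%:M] -> forall x, P x -> p x = x -> Z (p (q' x))].
Proof.
have [P1 PM PV PU] := PG.
have [qe qe' qq qcomm] := qs; have [[qP qM] [qP' qM']] := (qe, qe').
have [pe [pP' pM'] psplit pcomm] := ps; have [pP pM] := pe.
have ZG : mx_group Z := center_mx_group PG.
have Zq z : Z z -> Z (q z) by exact: (center_split qs).
have Zq' z : Z z -> Z (q' z) by exact: (center_split (direct_splitC qs)).
have [H11 H1M _ _] : mx_group H1 := split_part_group PG ps qe' S1G.
have [H21 H2M _ _] : mx_group H2 := split_part_group PG ps qe S0G.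
have S1H1 s : S1 s -> H1 s.
  by move=> S1s; have [Zs ps'] := S1Z S1s; split;
    [case: Zs| |exact: Zq'|exact: q'_S1].
have S0H2 s : S0 s -> H2 s.
  by move=> S0s; have [Zs ps'] := S0Z S0s; split;
    [case: Zs| |exact: Zq|exact: q_S0].
have H1E x : P x -> exists x1 t, [/\ H1 x1, S0 t & p (q x) = x1 *m t].
  move=> Px; exact: (fitting_half PG ps qs pp S0G S0Z S1Z Sdec q'_S0_sur Px).
have H2E x : P x -> exists x2 t, [/\ H2 x2, S1 t & p (q' x) = x2 *m t].
  move=> Px; apply: (fitting_half PG ps (direct_splitC qs)) => // z Zz pz.
  have [s0 [s1 [S0s S1s ->]]] := Sdec Zz pz; exists s1, s0; split=> //.
  have [[_ s0C] _] := S0Z S0s; have [[Ps1 _] _] := S1Z S1s.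
  exact: s0C.
have H12 x : H1 x -> H2 x -> x = 1%:M.
  move=> [Px px Zq'x S1x] [_ _ Zqx S0x].
  have Zx : Z x by rewrite (qq x Px); have [_ ZM _ _] := ZG; exact: ZM.
  have [s0 [s1 [S0s S1s xE]]] := Sdec Zx px.
  have [[Ps0 _] ps0] := S0Z S0s; have [[Ps1 _] ps1] := S1Z S1s.
  have [_ S0M S0V _] := S0G; have [_ S1M S1V _] := S1G.
  have s01 : s0 = 1%:M.
    apply: q'_S0_inj => //; apply: Sint; first exact: q'_S0.
    have pq's1 := q'_S1 S1s; have [_ _ _ S1U] := S1G.
    rewrite -(mulmxK (S1U _ pq's1) (p (q' s0))).
    rewrite -(pM _ _ (qP' _ Ps0) (qP' _ Ps1)) -(qM' _ _ Ps0 Ps1) -xE.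
    by apply: S1M => //; exact: S1V.
  have s11 : s1 = 1%:M.
    apply: q_S1_inj => //; apply: Sint; last exact: q_S1.
    by move: S0x; rewrite xE s01 mul1mx.
  by rewrite xE s01 s11 mulmx1.
have comm x y : H1 x -> H2 y -> x *m y = y *m x.
  move=> [Px _ [_ q'xC] _] [Py _ [_ qyC] _].
  rewrite {1}(qq x Px) -mulmxA q'xC// {1}(qq y Py) !mulmxA.
  have := qyC (q x) (qP _ Px) => qyx.
  rewrite -qyx -(mulmxA (q y)) qcomm// !mulmxA -qq//.
  by rewrite -mulmxA -qq.
split.
- split.
  + apply/seteqP; split=> [x [H1x H2x]|_ ->]; first exact: H12.
    by split.
  + exact: comm.
  + apply/seteqP; split=> [x [Px px]|_ [x [Px px _ _]] [y [Py py _ _] <-]].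
      have [x1 [t [H1x1 S0t pqx]]] := H1E x Px.
      have [x2 [t' [H2x2 S1t' pq'x]]] := H2E x Px.
      exists (x1 *m t'); first by apply: H1M => //; exact: S1H1.
      exists (t *m x2); first by apply: H2M => //; exact: S0H2.
      rewrite -[RHS]px [in RHS](qq x Px) (pM _ _ (qP _ Px) (qP' _ Px)) pqx pq'x.
      have [[Pt' t'C] _] := S1Z S1t'.
      have [Pt _] : P t /\ True by have [[]] := S0Z S0t.
      have [Px2 _ _ _] := H2x2.
      by rewrite -(mulmxA x1 t') t'C ?mulmxA//; exact: PM.
    by split; [exact: PM|rewrite pM// px py].
- move=> H1t x Px px; have [x1 [t [H1x1 S0t ->]]] := H1E x Px.
  have -> : x1 = 1%:M by move: H1x1; rewrite H1t.
  by rewrite mul1mx; have [] := S0Z S0t.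
- move=> H2t x Px px; have [x2 [t [H2x2 S1t ->]]] := H2E x Px.
  have -> : x2 = 1%:M by move: H2x2; rewrite H2t.
  by rewrite mul1mx; have [] := S1Z S1t.
Qed.
End FittingSplitting.

(** * Factors of the product and linear algebra on its center *)

(** Fitting's lemma: for k large, the kernel and the image of A^(k + 1) are
    complementary and A is invertible on the image. *)
Lemma fitting_mx (F : fieldType) m (A : 'M[F]_m) : exists k,
  let M := A ^+ k.+1 in
  [/\ forall v : 'rV_m, v *m M = 0 -> (v <= M)%MS -> v = 0,
      forall v : 'rV_m, exists v0 v1,
        [/\ v = v0 + v1, v0 *m M = 0 & (v1 <= M)%MS]
    & forall v : 'rV_m, (v <= M)%MS -> exists2 w, (w <= M)%MS & w *m A = v].
Proof.
have [|d /asboolP[k rk] dmin] :=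
    @ex_minnP (fun d => `[< exists k, \rank (A ^+ k) = d >]).
  by exists (\rank (A ^+ 0)); apply/asboolP; exists 0%N.
have rkl l : \rank (A ^+ (k + l)) = d.
  apply/anti_leq; rewrite -{1}rk exprD mxrankM_maxl /=.
  by apply: dmin; apply/asboolP; exists (k + l)%N; rewrite exprD.
exists k; set M := A ^+ k.+1.
have rM : \rank M = d by rewrite /M -addn1 rkl.
have sub l : (M <= A ^+ l *m M)%MS.
  have lM : (A ^+ l *m M <= M)%MS by exact: submxMl.
  rewrite -(mxrank_leqif_sup lM) rM mulmxE /M -exprD.
  by rewrite (_ : (l + k.+1 = k + l.+1)%N) ?rkl// addnC addSnnS.
have MA l : A ^+ l *m M = M *m A ^+ l by rewrite !mulmxE /M -!exprD addnC.
split.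
- move=> v vM0 /submxP[u vE].
  have uMM : (u <= kermx (M *m M))%MS by rewrite sub_kermx mulmxA -vE vM0.
  have kMM : (kermx M <= kermx (M *m M))%MS.
    by rewrite sub_kermx mulmxA mulmx_ker mul0mx.
  have kM : (kermx (M *m M) <= kermx M)%MS.
    rewrite -(mxrank_leqif_sup kMM) !mxrank_ker rM; apply/eqP; congr (_ - _)%N.
    by rewrite mulmxE /M -exprD addSnnS rkl.
  by rewrite vE; apply/eqP; rewrite -sub_kermx; exact: submx_trans kM.
- move=> v; have /submxP[u vu] : (v *m M <= M *m M)%MS.
    exact: submx_trans (submxMl _ _) (sub k.+1).
  exists (v - u *m M), (u *m M); rewrite subrK submxMl; split=> //.
  by rewrite mulmxBl vu mulmxA subrr.
- move=> v vM; have /submxP[u ->] := submx_trans vM (sub 1%N).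
  exists (u *m M); first exact: submxMl.
  by rewrite -mulmxA MA expr1.
Qed.

Section Factors.
Variables (R : realType) (K : divringClosed R[i]) (r : nat) (n : 'I_r -> nat).
Local Notation C := R[i].
Unset Implicit Arguments.
Variable G : forall i, set 'M[C]_(n i).
Set Implicit Arguments.
Hypothesis G_group : forall i, K_group K (G i).

Local Notation P := (alg_product G).
Local Notation D := (\sum_i n i)%N.
Local Notation bl i x := (@submxblock _ r r n n x i i).
Local Notation iota := (@inj_block r n C _).

Lemma blk_split (S : {set 'I_r}) : direct_split P (blk S) (blk (~: S)%SET).
Proof.
split.
- exact/K_morphism_endo/blk_morphism.
- exact/K_morphism_endo/blk_morphism.
- by move=> x; exact: prod_split.
- by move=> x y _ _; apply: blk_comm_disjoint => i; rewrite inE negbK.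
Qed.

Lemma factorE i : alg_factor G i = [set x | P x /\ blk (finset.set1 i) x = x].
Proof. by apply/seteqP; split=> x; move/(factorP G_group). Qed.

Lemma factor_iota i x : alg_factor G i x -> G i (bl i x) /\ iota (bl i x) = x.
Proof.
move=> /(factorP G_group)[Px xi]; split; first exact: prod_block.
by rewrite inj_block_sub.
Qed.

Lemma iota_factor i x : G i x -> alg_factor G i (iota x).
Proof.
move=> Gx; apply/(factorP G_group); split; last exact: blk_inj_block.
by have [+ _ _] := inj_morphism G_group i; exact.
Qed.

(** Indecomposability of G_i, transported to its copy in the product;
    rationality of the two subgroups is assumed in the form of equations on
    G_i. *)
Lemma factor_indecomposable i (H1 H2 : set 'M[C]_D) :
  K_indecomposable K (G i) -> mx_group H1 -> mx_group H2 ->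
  K_cut K (G i) [set x | G i x /\ H1 (iota x)] ->
  K_cut K (G i) [set x | G i x /\ H2 (iota x)] ->
  is_internal_product (alg_factor G i) H1 H2 ->
  H1 = [set 1%:M] \/ H2 = [set 1%:M].
Proof.
move=> indec H1G H2G H1K H2K [H12 H12C FE].
have [H11 H1M H1V H1U] := H1G; have [H21 H2M H2V H2U] := H2G.
have [iP iM ir] := inj_morphism G_group i.
have im : K_morphism K (G i) P (@inj_block r n C i) by [].
have i1 : iota (1%:M : 'M[C]_(n i)) = 1%:M.
  exact: (K_morphism1 (G_group i) (prod_group G_group) im).
have iV x : G i x -> iota (invmx x) = invmx (iota x).
  move=> Gx; have [_ _ GM GV] := G_group i.
  have xU := K_group_unit (G_group i) Gx.
  have ixU := K_group_unit (prod_group G_group) (iP _ Gx).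
  rewrite -[LHS](mulKmx ixU) -iM ?mulmxV// ?i1 ?mulmx1//; exact: GV.
have sub H : mx_group H -> K_cut K (G i) [set x | G i x /\ H (iota x)] ->
    K_group K [set x | G i x /\ H (iota x)].
  move=> [HH1 HM HV HU] HK; have [_ G1 GM GV] := G_group i.
  apply: (K_cut_group (G_group i) HK).
  - by split=> //; rewrite i1.
  - by move=> x y [Gx Hx] [Gy Hy]; split; [exact: GM|rewrite iM//; exact: HM].
  - by move=> x [Gx Hx]; split; [exact: GV|rewrite iV//; exact: HV].
have H1F x : H1 x -> alg_factor G i x.
  by move=> H1x; rewrite FE; exists x => //; exists 1%:M => //; rewrite mulmx1.
have H2F x : H2 x -> alg_factor G i x.
  by move=> H2x; rewrite FE; exists 1%:M => //; exists x => //; rewrite mul1mx.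
have iinj x y : iota x = iota y -> x = y :> 'M[C]_(n i).
  by move=> xy; rewrite -(inj_blockK x) xy inj_blockK.
have back H : (forall x, H x -> alg_factor G i x) -> H 1%:M ->
    [set x | G i x /\ H (iota x)] = [set 1%:M] -> H = [set 1%:M].
  move=> HF H1' HE; apply/seteqP; split=> [x Hx|_ ->//].
  have [Gx ix] := factor_iota (HF _ Hx).
  have : [set x | G i x /\ H (iota x)] (bl i x) by split; rewrite ?ix.
  by rewrite HE /= => b1; rewrite -ix b1 i1.
have [|H1t|H2t] := indec _ _ (sub _ H1G H1K) (sub _ H2G H2K).
- split.
  + apply/seteqP; split=> [x [[Gx H1x] [_ H2x]]|_ ->].
      apply: iinj; rewrite i1.
      by have : (H1 `&` H2) (iota x) by []; rewrite H12.
    by have [_ G1 _ _] := G_group i; split; split; rewrite ?i1.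
  + by move=> x y [Gx H1x] [Gy H2y]; apply: iinj; rewrite !iM// H12C.
  + apply/seteqP; split=> [x Gx|_ [x [Gx H1x] [y [Gy H2y] <-]]].
      have := iota_factor Gx; rewrite FE => -[h1 H1h1 [h2 H2h2 hx]].
      have [G1 i1h] := factor_iota (H1F _ H1h1).
      have [G2 i2h] := factor_iota (H2F _ H2h2).
      exists (bl i h1); first by split; rewrite ?i1h.
      exists (bl i h2); first by split; rewrite ?i2h.
      by apply: iinj; rewrite iM// i1h i2h.
    by have [_ _ GM _] := G_group i; exact: GM.
- by left; exact: back.
- by right; exact: back.
Qed.

End Factors.

Section KappaFacts.
Variables (R : realType) (K : divringClosed R[i]) (n : nat).
Local Notation C := R[i].
Variables (G : set 'M[C]_n) (m : nat) (kappa : 'M[C]_n -> 'rV[C]_m).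
Hypotheses (KG : K_group K G) (kc : center_coordinates K G kappa).
Local Notation Z := (alg_center G).

Lemma kappa_inj x y : Z x -> Z y -> kappa x = kappa y -> x = y.
Proof. by have [_ + _ _ _] := kc; exact. Qed.

Lemma kappa_sur v : exists2 z, Z z & kappa z = v.
Proof. by have [_ _ + _ _] := kc; exact. Qed.

Lemma kappaM x y : Z x -> Z y -> kappa (x *m y) = kappa x + kappa y.
Proof. by have [_ _ _ + _] := kc; exact. Qed.

Lemma kappa1 : kappa 1%:M = 0.
Proof.
have [_ Z1 _ _] := alg_center_group KG.
have := kappaM Z1 Z1; rewrite mulmx1 => /eqP.
by rewrite -subr_eq0 opprD addNKr oppr_eq0 => /eqP.
Qed.

Lemma kappa_eq0 z : Z z -> kappa z = 0 -> z = 1%:M.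
Proof.
move=> Zz z0; have [_ Z1 _ _] := alg_center_group KG.
by apply: kappa_inj => //; rewrite kappa1.
Qed.

Lemma kappaV z : Z z -> kappa (invmx z) = - kappa z.
Proof.
move=> Zz; have [_ _ _ ZV] := alg_center_group KG.
apply/eqP; rewrite -addr_eq0 -kappaM//; last exact: ZV.
by rewrite mulVmx ?kappa1//; exact: (K_group_unit (alg_center_group KG) Zz).
Qed.

Lemma kappa_kernel_group p (B : 'M[C]_(m, p)) :
  mx_group [set z | Z z /\ kappa z *m B = 0].
Proof.
have [_ Z1 ZM ZV] := alg_center_group KG; split.
- by rewrite /= kappa1 mul0mx.
- move=> x y [Zx x0] [Zy y0]; split; first exact: ZM.
  by rewrite kappaM// mulmxDl x0 y0 addr0.
- move=> x [Zx x0]; split; first exact: ZV.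
  by rewrite kappaV// mulNmx x0 oppr0.
- by move=> x [Zx _]; exact: (K_group_unit (alg_center_group KG) Zx).
Qed.

Lemma kappa_kernel_cut p (B : 'M[C]_(m, p)) : rational_mx K B ->
  K_cut K G [set z | Z z /\ kappa z *m B = 0].
Proof.
move=> ratB; have [kr _ _ _ _] := kc.
have G_unit x : G x -> x \in unitmx by move=> Gx; exact: (K_group_unit KG Gx).
rewrite (_ : [set z | _] = Z `&` [set z | G z /\ kappa z *m B = 0]).
  apply: K_cut_setI; first exact: center_cut.
  apply: K_cut_zero; apply: reg_mxM => //.
  by apply: reg_mx_const; apply/(rational_mxP K).
by apply/seteqP; split=> [z [[Gz zC] z0]|z [Zz [_ z0]]].
Qed.

Lemma mulmx_row_eq p q (A B : 'M[C]_(p, q)) :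
  (forall v : 'rV_p, v *m A = v *m B) -> A = B.
Proof. by move=> AB; apply/row_matrixP => i; rewrite !rowE. Qed.

Lemma kappa_linear f : K_morphism K G G f ->
  (forall z, Z z -> Z (f z)) ->
  exists2 F : 'M[C]_m, rational_mx K F
    & forall z, Z z -> kappa (f z) = kappa z *m F.
Proof. by have [_ _ _ _ +] := kc; exact. Qed.

Lemma kappa_unit f (F : 'M[C]_m) :
  (forall z, Z z -> Z (f z)) -> (forall z, Z z -> f z = 1%:M -> z = 1%:M) ->
  (forall z, Z z -> kappa (f z) = kappa z *m F) -> F \in unitmx.
Proof.
move=> fZ finj fF; rewrite -row_free_unit; apply: inj_row_free => v vF.
have [z Zz zv] := kappa_sur v.
rewrite -zv (finj z) ?kappa1//; apply: kappa_eq0; first exact: fZ.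
by rewrite fF// zv.
Qed.

End KappaFacts.

Lemma rational_mxM (C : numClosedFieldType) (K : divringClosed C) m p q
    (A : 'M[C]_(m, p)) (B : 'M[C]_(p, q)) :
  rational_mx K A -> rational_mx K B -> rational_mx K (A *m B).
Proof. by move=> rA rB s sA; rewrite map_mxM rA ?rB. Qed.

Lemma rational_mxX (C : numClosedFieldType) (K : divringClosed C) m
    (A : 'M[C]_m) k : rational_mx K A -> rational_mx K (A ^+ k).
Proof. by move=> rA s sA; rewrite map_mx_exp rA. Qed.

Lemma rational_invmx (C : numClosedFieldType) (K : divringClosed C) m
    (A : 'M[C]_m) : rational_mx K A -> rational_mx K (invmx A).
Proof. by move=> rA s sA; rewrite map_invmx rA. Qed.

Lemma rational_cokermx (C : numClosedFieldType) (K : divringClosed C) m p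
    (A : 'M[C]_(m, p)) : rational_mx K A -> rational_mx K (cokermx A).
Proof. by move=> rA s sA; rewrite map_cokermx rA. Qed.

(** * Images of the factors under an automorphism *)

Section FactorDichotomy.
Variables (R : realType) (K : divringClosed R[i]) (r : nat) (n : 'I_r -> nat).
Local Notation C := R[i].
Unset Implicit Arguments.
Variable G : forall i, set 'M[C]_(n i).
Set Implicit Arguments.
Hypothesis G_group : forall i, K_group K (G i).
Hypothesis G_indec : forall i, K_indecomposable K (G i).
Hypothesis G_center : forall i, torsion_free (alg_center (G i)).

Local Notation P := (alg_product G).
Local Notation Z := (alg_center P).
Local Notation iota := (@inj_block r n C _).

Variable Phi : 'M[C]_(\sum_i n i) -> 'M[C]_(\sum_i n i).
Hypothesis PhiA : K_automorphism K P Phi.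

Lemma factor_dichotomy (i j : 'I_r) :
  (forall x, alg_factor G i x -> Z (blk (finset.set1 j) (Phi x))) \/
  (forall x, alg_factor G i x -> Z (blk (~: finset.set1 j)%SET (Phi x))).
Proof.
have KP := prod_group G_group; have PG := K_group_mx_group KP.
have [Phim Phib] := PhiA; have Phie := K_morphism_endo Phim.
have [Psi [Psie PsiK PhiK]] := automorphism_inverse PG Phie Phib.
have [P1 PM PV PU] := PG; have [PhiP PhiM] := Phie; have [PsiP PsiM] := Psie.
pose p := blk (finset.set1 i) : 'M[C]_(\sum_i n i) -> _.
pose q0 := blk (finset.set1 j) : 'M[C]_(\sum_i n i) -> _.
pose q0' := blk (~: finset.set1 j)%SET : 'M[C]_(\sum_i n i) -> _.
pose q x := Psi (q0 (Phi x)); pose q' x := Psi (q0' (Phi x)).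
have ps : direct_split P p (blk (~: finset.set1 i)%SET) := blk_split G_group _.
have q0s : direct_split P q0 q0' := blk_split G_group _.
have qs : direct_split P q q' := direct_split_conj Phie Psie PsiK q0s.
have pm : K_morphism K P P p := blk_morphism G_group _.
have q0m : K_morphism K P P q0 := blk_morphism G_group _.
have q0m' : K_morphism K P P q0' := blk_morphism G_group _.
have pp x : P x -> p (p x) = p x by rewrite /p blk_blk finset.setIid.
have PhiZ z : Z z -> Z (Phi z).
  move=> [Pz zC]; split; first exact: PhiP.
  exact: (automorphism_center Phie Phib).
have PsiZ z : Z z -> Z (Psi z).
  move=> [Pz zC]; split=> [|x Px]; first exact: PsiP.
  by rewrite -(PsiK x Px) -!PsiM ?zC//; exact: PhiP.
have pZ z : Z z -> Z (p z) by exact: (center_split ps).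
have q0Z z : Z z -> Z (q0 z) by exact: (center_split q0s).
have q0Z' z : Z z -> Z (q0' z) by exact: (center_split (direct_splitC q0s)).
have [m [kappa kc]] :=
  exists_center_coordinates KP (center_prod_torsion_free G_group G_center).
have kM := kappaM kc; have k0 := kappa_eq0 KP kc.
have [U ratU kU] := kappa_linear kc Phim PhiZ.
have [E ratE kE] := kappa_linear kc pm pZ.
have [J ratJ kJ] := kappa_linear kc q0m q0Z.
have [J' ratJ' kJ'] := kappa_linear kc q0m' q0Z'.
have Uunit : U \in unitmx.
  apply: (kappa_unit KP kc PhiZ _ kU) => z [Pz _] Pz1.
  by rewrite -(PsiK z Pz) Pz1; exact: (mx_endo1 PG Psie).
have kPsi z : Z z -> kappa (Psi z) = kappa z *m invmx U.
  move=> Zz; have [Pz _] := Zz; apply: (canRL (mulmxK Uunit)).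
  by rewrite -kU ?PhiK//; exact: PsiZ.
(* The matrix of p o q on the center, in the coordinates kappa. *)
pose A := U *m J *m invmx U *m E.
have kA z : Z z -> kappa (p (q z)) = kappa z *m A.
  move=> Zz; rewrite kE; last by apply/PsiZ/q0Z/PhiZ.
  by rewrite kPsi ?kJ ?kU//; [rewrite !mulmxA|exact: PhiZ|exact/q0Z/PhiZ].
have ratA : rational_mx K A.
  by rewrite /A; apply: rational_mxM => //; apply: rational_mxM;
    [exact: rational_mxM|exact: rational_invmx].
have EE : E *m E = E.
  apply: mulmx_row_eq => v; have [z Zz <-] := kappa_sur kc v.
  by rewrite mulmxA -!kE ?pp//; [case: Zz|exact: pZ].
have AE : A *m E = A by rewrite /A -mulmxA EE.
have [qe qe' qq _] := qs; have [qP qM] := qe; have [qP' qM'] := qe'.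
have [[pP pM] _ _ _] := ps.
have qZ z : Z z -> Z (q z) by move=> Zz; exact/PsiZ/q0Z/PhiZ.
have qZ' z : Z z -> Z (q' z) by move=> Zz; exact/PsiZ/q0Z'/PhiZ.
(* On the center of F_i the matrix of p o q' is 1 - A. *)
have kA' z : Z z -> p z = z -> kappa (p (q' z)) = kappa z - kappa z *m A.
  move=> Zz pz; have [Pz _] := Zz.
  have Zpq := pZ _ (qZ _ Zz); have Zpq' := pZ _ (qZ' _ Zz).
  have zE : p (q z) *m p (q' z) = z.
    by rewrite -(pM _ _ (qP _ Pz) (qP' _ Pz)) -(qq z Pz).
  have kzE : kappa z = kappa (p (q z)) + kappa (p (q' z)) :=
    etrans (congr1 kappa (esym zE)) (kM _ _ Zpq Zpq').
  by rewrite -(kA _ Zz) [X in X - _]kzE addrC addKr.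
have [k [Mker Mdec Msur]] := fitting_mx A.
set M := A ^+ k.+1 in Mker Mdec Msur.
have MA : M *m A = A *m M by rewrite !mulmxE /M -exprSr exprS.
have AlE l : A ^+ l.+1 *m E = A ^+ l.+1 by rewrite exprSr -mulmxE -mulmxA AE.
have ME : M *m E = M := AlE k.
have ratM : rational_mx K M by exact: rational_mxX.
have kinj := kappa_inj kc.
have pE z : Z z -> kappa z *m E = kappa z -> p z = z.
  by move=> Zz zE; apply: kinj; [exact: pZ| |rewrite kE].
(* S1 and S0 are the parts of the center of F_i on which A is invertible
   and nilpotent. *)
pose S1 : set 'M[C]_(\sum_i n i) := [set z | Z z /\ kappa z *m cokermx M = 0].
pose S0 : set 'M[C]_(\sum_i n i) :=
  [set z | Z z /\ kappa z *m M = 0] `&` [set z | P z /\ p z = z].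
have S1P z : S1 z <-> Z z /\ (kappa z <= M)%MS.
  by rewrite submxE; split=> -[Zz /eqP].
have pe : mx_endo P p by have [] := ps.
have S1G : mx_group S1 := kappa_kernel_group KP kc _.
have S0G : mx_group S0.
  by apply: mx_groupI; [exact: (kappa_kernel_group KP kc)|exact: mx_group_eq].
have S0P z : S0 z <-> [/\ Z z, p z = z & kappa z *m M = 0].
  split=> [[[Zz z0] [_ pz]] //|[Zz pz z0]].
  by split=> //; split=> //; case: Zz.
have ME_sub v : (v <= M)%MS -> v *m E = v.
  by move=> /submxP[u ->]; rewrite -mulmxA ME.
have S1Z z : S1 z -> Z z /\ p z = z.
  by move=> /S1P[Zz zM]; split=> //; apply: pE => //; exact: ME_sub.
have S0Z z : S0 z -> Z z /\ p z = z by move=> /S0P[].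
have S1q s : S1 s -> S1 (p (q s)).
  move=> /S1P[Zs sM]; apply/S1P; split; first exact/pZ/qZ.
  by rewrite kA//; have /submxP[u ->] := sM; rewrite -mulmxA MA mulmxA submxMl.
have S0q s : S0 s -> S0 (p (q s)).
  move=> /S0P[Zs ps' sM]; apply/S0P; split; first exact/pZ/qZ.
    by apply: pp; have [] := qZ _ Zs.
  by rewrite kA// -mulmxA -MA mulmxA sM mul0mx.
have S1q' s : S1 s -> S1 (p (q' s)).
  move=> S1s; have [Zs ps'] := S1Z s S1s; have /S1P[_ sM] := S1s.
  apply/S1P; split; first exact/pZ/qZ'.
  rewrite kA'// addmx_sub// eqmx_opp.
  by have /submxP[u ->] := sM; rewrite -mulmxA MA mulmxA submxMl.
have S0q' s : S0 s -> S0 (p (q' s)).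
  move=> /S0P[Zs ps' sM]; apply/S0P; split; first exact/pZ/qZ'.
    by apply: pp; have [] := qZ' _ Zs.
  by rewrite kA'// mulmxBl -mulmxA -MA mulmxA sM mul0mx subr0.
have Sdec z : Z z -> p z = z -> exists s0 s1, [/\ S0 s0, S1 s1 & z = s0 *m s1].
  move=> Zz pz; have [v0 [v1 [zv v0M v1M]]] := Mdec (kappa z).
  have [z0 Zz0 kz0] := kappa_sur kc v0; have [z1 Zz1 kz1] := kappa_sur kc v1.
  exists z0, z1; split.
  - apply/S0P; split; rewrite ?kz0//; apply: pE => //; rewrite kz0.
    have -> : v0 = kappa z - v1 by rewrite zv addrK.
    by rewrite mulmxBl -kE// pz (ME_sub _ _ v1M).
  - by apply/S1P; rewrite kz1.
  - apply: kinj => //; last by rewrite kM// kz0 kz1.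
    by have [_ _ ZM _] := alg_center_group KP; exact: ZM.
have Sint z : S0 z -> S1 z -> z = 1%:M.
  by move=> /S0P[Zz _ zM] /S1P[_ zM']; apply: k0 => //; exact: Mker.
have S1inj s : S1 s -> p (q s) = 1%:M -> s = 1%:M.
  move=> /S1P[Zs sM] s1; apply: k0 => //; apply: Mker => //.
  by rewrite /M exprS -mulmxE mulmxA -kA// s1 (kappa1 KP kc) mul0mx.
have S1sur s : S1 s -> exists2 t, S1 t & p (q t) = s.
  move=> /S1P[Zs /Msur[w wM wA]]; have [t Zt kt] := kappa_sur kc w.
  exists t; first by apply/S1P; rewrite kt.
  by apply: kinj => //; [exact/pZ/qZ|rewrite kA// kt].
have S0inj s : S0 s -> p (q' s) = 1%:M -> s = 1%:M.
  move=> /S0P[Zs ps' sM] s1; apply: k0 => //.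
  have sA : kappa s *m A = kappa s.
    have := kA' s Zs ps'; rewrite s1 (kappa1 KP kc) => /esym/eqP.
    by rewrite subr_eq0 => /eqP.
  rewrite -sM /M; elim: (k.+1) => [|l IH]; first by rewrite expr0 mulmx1.
  by rewrite exprS -mulmxE mulmxA sA.
(* On S0 the matrix 1 - A is inverted by the geometric series T. *)
have S0sur s : S0 s -> exists2 t, S0 t & p (q' t) = s.
  move=> /S0P[Zs ps' sM]; pose T := \sum_(l < k.+1) A ^+ l.
  have TA (B : 'M_m) : A *m B = B *m A -> T *m B = B *m T.
    move=> AB; rewrite mulmx_suml mulmx_sumr; apply: eq_bigr => l _.
    exact: (esym (commrX l (esym AB))).
  have [t Zt kt] := kappa_sur kc (kappa s *m T).
  have tE : kappa t *m E = kappa t.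
    rewrite kt /T mulmx_sumr mulmx_suml; apply: eq_bigr => -[[|l] ?] _ /=.
      by rewrite expr0 mulmx1 -kE// ps'.
    by rewrite -mulmxA AlE.
  have pt : p t = t by exact: pE.
  exists t.
    by apply/S0P; split=> //; rewrite kt -mulmxA (TA M (esym MA)) mulmxA sM
      mul0mx.
  apply: kinj => //; first exact/pZ/qZ'.
  rewrite kA'// kt -mulmxA (TA A erefl).
  have AT : A *m T - T = M - 1 by rewrite (subrX1 A k.+1) mulrBl mul1r.
  by rewrite -mulmxBr -opprB AT mulmxN mulmxBr sM mulmx1 sub0r opprK.
(* Membership in the two factors amounts to linear equations over K on the
   coordinates of f0 (Phi x), from which the abstract inverse Psi has
   disappeared. *)
have cutH f0 (S : set 'M[C]_(\sum_i n i)) c (B : 'M_(m, c)) :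
    K_morphism K P P f0 -> rational_mx K B ->
    (forall z, Z z -> p z = z -> (S z <-> kappa z *m B = 0)) ->
    K_cut K (G i) [set x | G i x /\
      split_part P p (fun y => Psi (f0 (Phi y))) S (iota x)].
  move=> f0m ratB SB.
  have im := inj_morphism G_group i.
  have fm : K_morphism K (G i) P (fun x => f0 (Phi (iota x))).
    apply: (K_morphism_comp (G_group i) KP _ f0m).
    exact: (K_morphism_comp (G_group i) KP im Phim).
  have ratUEB : rational_mx K (invmx U *m E *m B).
    by apply: rational_mxM => //; apply: rational_mxM => //;
      exact: rational_invmx.
  rewrite (_ : [set x | _] = [set x | G i x /\
      [set z | Z z /\ kappa z *m (invmx U *m E *m B) = 0] (f0 (Phi (iota x)))]).
    apply: (K_cut_preimage (G_group i) KP fm); exact: kappa_kernel_cut.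
  have [f0P _ _] := f0m; have [iP _ _] := im.
  have kEq y : Z (f0 (Phi y)) ->
      kappa (p (Psi (f0 (Phi y)))) *m B =
      kappa (f0 (Phi y)) *m (invmx U *m E *m B).
    by move=> Zy; rewrite kE ?kPsi ?mulmxA//; exact: PsiZ.
  apply/seteqP; split=> x [Gx].
    move=> [Px px ZPsi Spx]; split=> //.
    have Zf : Z (f0 (Phi (iota x))).
      by rewrite -[f0 _]PhiK; [exact: PhiZ|exact/f0P/PhiP].
    split=> //; rewrite -kEq//; apply/SB => //; first exact: pZ.
    by apply: pp; case: ZPsi.
  move=> [Zf f0']; have Px := iP x Gx; split=> //; split=> //.
  - exact: blk_inj_block.
  - exact: PsiZ.
  - apply/SB; [exact/pZ/PsiZ| |by rewrite kEq].
    by apply: pp; have [] := PsiZ _ Zf.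
have [Fprod FH1 FH2] := fitting_splitting PG ps qs pp S0G S1G S0Z S1Z Sdec Sint
  S0q S1q S0q' S1q' S1inj S1sur S0inj S0sur.
have Fi x : alg_factor G i x -> P x /\ p x = x by move/(factorP G_group).
have := @factor_indecomposable _ K _ _ _ G_group i
  (split_part P p q' S1) (split_part P p q S0) (@G_indec i).
case.
- exact: (split_part_group PG ps qe' S1G).
- exact: (split_part_group PG ps qe S0G).
- apply: (cutH q0' S1 _ (cokermx M)) => // [|z Zz _];
    first exact: rational_cokermx.
  by split=> [[]|].
- apply: (cutH q0 S0 _ M) => // z Zz pz.
  by split=> [/S0P[]//|z0]; apply/S0P.
- by rewrite (factorE G_group).
- move=> H1t; left=> x /Fi[Px px].
  have Zqx := central_transfer ps qs pp (FH1 H1t) Px px.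
  by rewrite -[blk _ _]PhiK; [exact: PhiZ|exact/(prod_blk G_group)/PhiP].
- move=> H2t; right=> x /Fi[Px px].
  have Zqx := central_transfer ps (direct_splitC qs) pp (FH2 H2t) Px px.
  by rewrite -[blk _ _]PhiK; [exact: PhiZ|exact/(prod_blk G_group)/PhiP].
Qed.

End FactorDichotomy.

(** * Endomorphisms with central values *)

Section CentralEndomorphisms.
Variables (R : realType) (K : divringClosed R[i]) (r : nat) (n : 'I_r -> nat).
Local Notation C := R[i].
Unset Implicit Arguments.
Variable G : forall i, set 'M[C]_(n i).
Hypothesis G_group : forall i, K_group K (G i).
Hypothesis G_indec : forall i, K_indecomposable K (G i).
Hypothesis G_center : forall i, torsion_free (alg_center (G i)).
Hypothesis G_nonabelian : forall i, ~ abelian_set (G i).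
Set Implicit Arguments.

Local Notation P := (alg_product G).
Local Notation Z := (alg_center P).
Local Notation iota := (@inj_block r n C _).

Lemma blk_ind (T : set 'M[C]_(\sum_i n i)) (S : {set 'I_r}) x :
  T 1%:M -> (forall y z, T y -> T z -> T (y *m z)) ->
  (forall i, i \in S -> T (blk (finset.set1 i) x)) -> T (blk S x).
Proof.
move=> T1 TM; have [k] := ubnP #|S|; elim: k S => // k IH S Sk TS.
have [->|[i iS]] := finset.set_0Vmem S; first by rewrite blk_set0.
rewrite -(finset.setD1K iS) -blk_mul_disjoint; last first.
  by move=> l; rewrite !inE => /eqP ->; rewrite eqxx.
apply: TM; first exact: TS.
apply: IH => [|l]; first by rewrite (cardsD1 i S) iS in Sk.
by rewrite !inE => /andP[_ /TS].
Qed.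

Lemma blk_full x : P x -> blk [set: 'I_r]%SET x = x.
Proof. by move=> /prodP[_ xE]; rewrite {1}xE blk_setT -xE. Qed.

Lemma factor_nonabelian i : ~ (alg_factor G i `<=` Z).
Proof.
move=> FZ; apply: (G_nonabelian i) => x y Gx Gy.
have [_ xC] := FZ _ (iota_factor G_group Gx).
have [iP _ _] := inj_morphism G_group i.
by rewrite -(inj_blockK (x *m y)) inj_blockM (xC _ (iP _ Gy)) -inj_blockM
  inj_blockK.
Qed.

(** In the coordinates of the center let V be the matrix of Psi on Z(F_i).
    Its pseudo-inverse yields Y, whose row space lies in Z(F_i) and is mapped
    isomorphically by Psi onto the image of V. Then F_i is the product of the
    elements that Psi sends into a complement of this image and of the elements
    of the center with coordinates in the row space of Y. *)
Lemma central_endomorphism_kills_center Psi :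
  K_morphism K P P Psi -> (forall x, P x -> Z (Psi x)) ->
  forall z, Z z -> Psi z = 1%:M.
Proof.
move=> Psim PsiZ z0 Zz0.
have KP := prod_group G_group; have PG := K_group_mx_group KP.
have [P1 PM PV PU] := PG; have Psie := K_morphism_endo Psim.
have [PsiP PsiM] := Psie.
(* The center is generated by the centers of the factors. *)
suff killF i z : Z z -> blk (finset.set1 i) z = z -> Psi z = 1%:M.
  have [Pz0 _] := Zz0; rewrite -(blk_full Pz0).
  have [] // : [set x | P x /\ Psi x = 1%:M] (blk [set: 'I_r]%SET z0).
  apply: blk_ind => [|x y [Px x1] [Py y1]|i _].
  - by split=> //; exact: mx_endo1 PG Psie.
  - by split; [exact: PM|rewrite PsiM// x1 y1 mulmx1].
  - split; first exact: (prod_blk G_group).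
    apply: (killF i); last by rewrite blk_blk finset.setIid.
    by apply: (center_split (blk_split G_group _)).
move=> {z0 Zz0} Zz zF.
pose p := blk (finset.set1 i) : 'M[C]_(\sum_i n i) -> _.
have ps : direct_split P p (blk (~: finset.set1 i)%SET) := blk_split G_group _.
have pm : K_morphism K P P p := blk_morphism G_group _.
have pe := K_morphism_endo pm; have [pP pM] := pe.
have pp x : P x -> p (p x) = p x by rewrite /p blk_blk finset.setIid.
have pZ y : Z y -> Z (p y) by exact: (center_split ps).
have [m [kappa kc]] :=
  exists_center_coordinates KP (center_prod_torsion_free G_group G_center).
have kM := kappaM kc; have k0 := kappa_eq0 KP kc; have kinj := kappa_inj kc.
have PsiZZ y : Z y -> Z (Psi y) by move=> [Py _]; exact: PsiZ.
have [U ratU kU] := kappa_linear kc Psim PsiZZ.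
have [E ratE kE] := kappa_linear kc pm pZ.
pose V := E *m U; pose Y := V *m pinvmx V *m E.
have ratV : rational_mx K V by exact: rational_mxM.
have ratY : rational_mx K Y.
  apply: rational_mxM => //; apply: rational_mxM => // s sA.
  by rewrite map_pinvmx ratV.
have EE : E *m E = E.
  apply: mulmx_row_eq => v; have [y Zy <-] := kappa_sur kc v.
  by rewrite mulmxA -!kE ?pp//; [case: Zy|exact: pZ].
have YE : Y *m E = Y by rewrite /Y -mulmxA EE.
have YU : Y *m U = V by rewrite /Y -mulmxA mulmxKpV.
have pE y : Z y -> kappa y *m E = kappa y -> p y = y.
  by move=> Zy yE; apply: kinj; [exact: pZ| |rewrite kE].
have kFU y : Z y -> p y = y -> kappa (Psi y) = kappa y *m V.
  by move=> Zy py; rewrite kU// /V mulmxA -kE// py.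
suff V0 : V = 0 by apply: k0; [exact: PsiZZ|rewrite kFU// V0 mulmx0].
pose S' := [set y | Z y /\ kappa y *m cokermx (V^C)%MS = 0].
have S'G : mx_group S' := kappa_kernel_group KP kc _.
pose H1 := [set x | P x /\ p x = x] `&` [set x | P x /\ S' (Psi x)].
pose H2 := [set y | Z y /\ kappa y *m cokermx Y = 0].
have H1G : mx_group H1.
  by apply: mx_groupI; [exact: mx_group_eq|exact: mx_group_preim].
have H2G : mx_group H2 := kappa_kernel_group KP kc _.
have H2P y : H2 y -> Z y /\ exists u : 'rV_m, kappa y = u *m Y.
  by move=> [Zy /eqP]; rewrite -submxE => /submxP.
have H2p y : H2 y -> p y = y.
  by move=> /H2P[Zy [u yu]]; apply: pE => //; rewrite yu -mulmxA YE.
have im := inj_morphism G_group i; have [iP _ _] := im.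
have cut1 : K_cut K (G i) [set x | G i x /\ H1 (iota x)].
  rewrite (_ : [set x | _] = [set x | G i x /\ S' (Psi (iota x))]).
    apply: (K_cut_preimage (G_group i) KP
      (K_morphism_comp (G_group i) KP im Psim)).
    by apply: kappa_kernel_cut => //; apply: rational_cokermx => s sA;
      rewrite map_complmx ratV.
  apply/seteqP; split=> x [Gx]; first by move=> [_ [_ Sx]].
  by move=> Sx; have Px := iP _ Gx; split=> //; split; split=> //;
    exact: blk_inj_block.
have cut2 : K_cut K (G i) [set x | G i x /\ H2 (iota x)].
  apply: (K_cut_preimage (G_group i) KP im).
  by apply: kappa_kernel_cut => //; exact: rational_cokermx.
have prod12 : is_internal_product (alg_factor G i) H1 H2.
  rewrite (factorE G_group); split.
  - apply/seteqP; split=> [x [[_ [Px [_ Sx]]] H2x]|_ ->]; last first.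
      by split; [case: H1G|case: H2G].
    have [Zx [u xu]] := H2P _ H2x.
    apply: k0 => //.
    have PsiV : kappa (Psi x) = u *m V by rewrite kU// xu -mulmxA YU.
    have uV0 : u *m V = 0.
      apply/eqP; rewrite -submx0 -(capmx_compl V) sub_capmx submxMl /=.
      by rewrite submxE -PsiV Sx.
    have uY : u *m Y = u *m V *m (pinvmx V *m E) by rewrite /Y !mulmxA.
    by rewrite xu uY uV0 mul0mx.
  - move=> x y [[Px _] _] /H2P[[_ yC] _].
    by rewrite yC.
  - apply/seteqP; split=> [x [Px px]|_ [x [[Px px] _] [y H2y <-]]]; last first.
      have [[Py _] _] := H2P _ H2y.
      by split; [exact: PM|rewrite -/(p _) pM// px H2p].
    have /sub_addsmxP[[u w] /= xuw] : (kappa (Psi x) <= V + V^C)%MS.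
      by apply: submx_full; exact: addsmx_compl_full.
    have [y Zy yu] := kappa_sur kc (u *m Y).
    have H2y : H2 y by split=> //; apply/eqP; rewrite -submxE yu submxMl.
    have [Py yC] := Zy; have yU := PU _ Py.
    have [_ Z1 ZM ZV] := alg_center_group KP.
    have py := H2p _ H2y.
    exists (x *m invmx y); last by exists y; rewrite ?mulmxKV.
    have PyV := PV _ Py.
    split; split; try exact: PM.
    + apply: etrans (pM _ _ Px PyV) (congr2 mulmx px _).
      exact: etrans (mx_endoV PG pe Py) (congr1 _ py).
    + rewrite (PsiM _ _ Px PyV) (mx_endoV PG Psie Py).
      have ZPy := PsiZ _ Py; have ZPx := PsiZ _ Px.
      split; first by apply: ZM => //; exact: ZV.
      apply/eqP; rewrite -submxE (kM _ _ ZPx (ZV _ ZPy)) (kappaV KP kc ZPy).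
      by rewrite xuw (kU _ Zy) yu -mulmxA YU addrAC subrr add0r submxMl.
have [H1t|H2t] := factor_indecomposable G_group (@G_indec i) H1G H2G cut1 cut2
  prod12.
  (* If H1 were trivial, F_i = H2 would be central. *)
  case: (@factor_nonabelian i) => x; have [_ _ ->] := prod12.
  by move=> [x1 + [y /H2P[Zy _] <-]]; rewrite H1t => ->; rewrite mul1mx.
rewrite -YU; suff -> : Y = 0 by rewrite mul0mx.
apply/row_matrixP => l; rewrite row0.
have [y Zy yl] := kappa_sur kc (row l Y).
have : H2 y by split=> //; apply/eqP; rewrite -submxE yl row_sub.
by rewrite H2t => y1; rewrite -yl y1 (kappa1 KP kc).
Qed.

End CentralEndomorphisms.

Section CentralTwists.
Variables (R : realType) (K : divringClosed R[i]) (r : nat) (n : 'I_r -> nat).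
Local Notation C := R[i].
Unset Implicit Arguments.
Variable G : forall i, set 'M[C]_(n i).
Hypothesis G_group : forall i, K_group K (G i).
Hypothesis G_nonabelian : forall i, ~ abelian_set (G i).
Hypothesis G_indec : forall i, K_indecomposable K (G i).
Hypothesis G_center : forall i, torsion_free (alg_center (G i)).
Set Implicit Arguments.

Local Notation P := (alg_product G).
Local Notation Z := (alg_center P).

(** On Z the map f . h agrees with f, because h is trivial there. An
    element z of the kernel has f z = (h z)^-1 in Z, so z is in Z and f z = 1.
    For surjectivity, the preimage of y under f is corrected by the central
    element that f sends to the inverse of its image under h. *)
Lemma central_twist f h :
  K_automorphism K P f -> K_endomorphism K P h -> (forall x, P x -> Z (h x)) ->
  K_automorphism K P (fun x => f x *m h x).
Proof.
move=> [fm fb] hm hZ.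
have KP := prod_group G_group; have PG := K_group_mx_group KP.
have [P1 PM PV PU] := PG.
have fe := K_morphism_endo fm; have he := K_morphism_endo hm.
have [fP fM] := fe; have [hP hM] := he.
have [_ _ fr] := fm; have [_ _ hr] := hm.
have hK := central_endomorphism_kills_center G_group G_indec G_center
  G_nonabelian hm hZ.
have [Psi [[PsiP PsiM] PsiK fK]] := automorphism_inverse PG fe fb.
have [_ Z1 ZM ZV] := alg_center_group KP.
have PsiZ z : Z z -> Z (Psi z).
  move=> [Pz zC]; split=> [|x Px]; first exact: PsiP.
  by rewrite -(PsiK x Px) -!PsiM ?zC//; exact: fP.
have ge : mx_endo P (fun x => f x *m h x).
  split=> [x Px|x y Px Py]; first exact: PM (fP _ Px) (hP _ Px).
  rewrite (fM _ _ Px Py) (hM _ _ Px Py) -!mulmxA; congr (_ *m _).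
  have [_ hxC] := hZ x Px.
  by rewrite !mulmxA (hxC _ (fP _ Py)).
have gm : K_morphism K P P (fun x => f x *m h x).
  have P_unit x : P x -> x \in unitmx by exact: PU.
  by have [gP gM] := ge; split=> //; exact: (reg_mxM P_unit fr hr).
split=> //; split.
- by have [] := gm.
- move=> x y /set_mem Px /set_mem Py; apply: (mx_endo_inj PG ge) => // z Pz fh1.
  have Phz := hP z Pz.
  have fz : f z = invmx (h z) by rewrite -[LHS](mulmxK (PU _ Phz)) fh1 mul1mx.
  have Zz : Z z by rewrite -(PsiK z Pz) fz; apply/PsiZ/ZV/hZ.
  move: fh1; rewrite (hK z Zz) mulmx1 => f1.
  by rewrite -(PsiK z Pz) f1 -[X in Psi X](mx_endo1 PG fe) PsiK.
- move=> y Py; pose x := Psi y; have Px : P x := PsiP _ Py.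
  have Zhx := hZ x Px; pose z := Psi (invmx (h x)).
  have ZhV := ZV _ Zhx; have [PhV _] := ZhV.
  have Zz : Z z by exact: PsiZ.
  have [Pz _] := Zz; exists (x *m z); first exact: PM.
  rewrite fM// hM// (hK z Zz) mulmx1 /x fK// -/x /z fK//.
  by rewrite mulmxKV// PU//; exact: hP.
Qed.

Lemma K_endomorphism_inv h : K_endomorphism K P h ->
  (forall x, P x -> Z (h x)) -> K_endomorphism K P (fun x => invmx (h x)).
Proof.
move=> hm hZ; have KP := prod_group G_group.
have [P1 PM PV PU] := K_group_mx_group KP; have [hP hM _] := hm.
split.
- by move=> x Px; apply: PV; exact: hP.
- move=> x y Px Py; have [_ hyC] := hZ y Py.
  rewrite hM// -(hyC (h x) (hP x Px)).
  have xU := PU _ (hP x Px); have yU := PU _ (hP y Py).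
  have xyU : h y *m h x \in unitmx by rewrite unitmx_mul yU.
  apply: (canRL (mulmxK yU)); apply: (canLR (mulKmx xyU)).
  by rewrite mulmxK.
- have P_unit x : P x -> x \in unitmx by exact: PU.
  exact: (reg_mx_comp KP KP hm (reg_invmx K P_unit)).
Qed.

End CentralTwists.

(** * Central mixing *)

Section CentralMixing.
Variables (R : realType) (K : divringClosed R[i]) (r : nat) (n : 'I_r -> nat).
Local Notation C := R[i].
Unset Implicit Arguments.
Variable G : forall i, set 'M[C]_(n i).
Hypothesis G_group : forall i, K_group K (G i).
Hypothesis G_nonabelian : forall i, ~ abelian_set (G i).
Hypothesis G_indec : forall i, K_indecomposable K (G i).
Hypothesis G_center : forall i, torsion_free (alg_center (G i)).
Set Implicit Arguments.

Local Notation P := (alg_product G).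
Local Notation Z := (alg_center P).
Local Notation bl i x := (@submxblock _ r r n n x i i).
Local Notation iota := (@inj_block r n C _).

Lemma blk_center S z : Z z -> Z (blk S z).
Proof. by move=> Zz; exact: (center_split (blk_split G_group S)). Qed.

Lemma blk_blkC1 i j (x : 'M[C]_(\sum_i n i)) : i != j ->
  blk (finset.set1 i) (blk (~: finset.set1 j)%SET x) = blk (finset.set1 i) x.
Proof.
move=> ij; rewrite blk_blk; congr (blk _ x); apply/finset.setP => k.
by rewrite !inE; case: eqP => [->|].
Qed.

Lemma prod_ind (T : set 'M[C]_(\sum_i n i)) :
  T 1%:M -> (forall x y, P x -> P y -> T x -> T y -> T (x *m y)) ->
  (forall i x, alg_factor G i x -> T x) -> forall x, P x -> T x.
Proof.
move=> T1 TM TF x Px; rewrite -(blk_full Px).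
have [] // : [set y | P y /\ T y] (blk [set: 'I_r]%SET x).
apply: blk_ind => [|y z [Py Ty] [Pz Tz]|i _].
- by split=> //; exact: prod1.
- by split; [exact: (prodM G_group)|exact: TM].
- have PF : P (blk (finset.set1 i) x) by exact: prod_blk.
  split=> //; apply: (TF i); apply/(factorP G_group).
  by rewrite blk_blk finset.setIid.
Qed.

(** By [factor_dichotomy], unless Phi(F_i) is central, some j has all
    components of Phi(F_i) outside F_j central. If j were not attained, the
    j-component of Phi would be central on every factor, hence everywhere, and
    F_j would be central as Phi is surjective. *)
Lemma factor_permutation Phi : K_automorphism K P Phi ->
  exists sigma : 'S_r, forall i x, alg_factor G i x ->
    Z (blk (~: finset.set1 (sigma i))%SET (Phi x)).
Proof.
move=> PhiA; have [Phim Phib] := PhiA.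
have KP := prod_group G_group; have PG := K_group_mx_group KP.
have Phie := K_morphism_endo Phim; have [PhiP PhiM] := Phie.
have [Psi [[PsiP PsiM] PsiK PhiK]] := automorphism_inverse PG Phie Phib.
have [_ Z1 ZM _] := alg_center_group KP.
have FP i x : alg_factor G i x -> P x by move/(factorP G_group) => [].
have /choice[s sP] : forall i, exists j, forall x, alg_factor G i x ->
    Z (blk (~: finset.set1 j)%SET (Phi x)).
  move=> i; apply: contrapT => no.
  apply: (@factor_nonabelian _ K _ _ G G_group G_nonabelian i) => x Fx.
  have Px := FP _ _ Fx.
  have [PPhi PhiC] : Z (Phi x).
    rewrite -(blk_full (PhiP _ Px)); apply: blk_ind => // j _.
    have [jC|jI] := factor_dichotomy G_group G_indec G_center PhiA i j.
      exact: jC.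
    by case: no; exists j.
  split=> // y Py; rewrite -(PsiK x Px) -(PsiK y Py) -!PsiM ?PhiC//;
    exact: PhiP.
have /choice[t tP] : forall j, exists i, s i = j.
  move=> j; apply: contrapT => no.
  apply: (@factor_nonabelian _ K _ _ G G_group G_nonabelian j).
  move=> y /(factorP G_group)[Py yF].
  have jZ : forall x, P x -> Z (blk (finset.set1 j) (Phi x)).
    apply: prod_ind => [|x x' Px Px' Zx Zx'|i x Fx].
    - by rewrite (mx_endo1 PG Phie) blk_1.
    - rewrite PhiM// (prod_blkM G_group); [exact: ZM|exact: PhiP|exact: PhiP].
    - rewrite -(@blk_blkC1 _ (s i)); first by apply: blk_center; exact: sP.
      by apply/eqP => ji; apply: no; exists i.
  by rewrite -yF -(PhiK y Py); apply: jZ; exact: PsiP.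
have t_inj : injective t by move=> a b ab; rewrite -(tP a) -(tP b) ab.
exists (perm t_inj)^-1%g => i x Fx.
have <- : s i = (perm t_inj)^-1%g i; last exact: sP.
by rewrite -{1}(permKV (perm t_inj) i) permE tP.
Qed.

(** A common element of two distinct factors is trivial, and no factor is
    trivial since none is abelian. *)
Lemma factor_inj a b : alg_factor G a = alg_factor G b -> a = b.
Proof.
move=> FE; apply: contrapT => /eqP ab.
apply: (@factor_nonabelian _ K _ _ G G_group G_nonabelian a) => x Fx.
have [_ xa] : P x /\ blk (finset.set1 a) x = x by exact/(factorP G_group).
have [_ xb] : P x /\ blk (finset.set1 b) x = x.
  by apply/(factorP G_group); rewrite -FE.
suff -> : x = 1%:M by have [] := alg_center_group (prod_group G_group).
rewrite -xa -xb blk_blk (_ : (_ :&: _)%SET = finset.set0) ?blk_set0//.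
apply/finset.setP => k; rewrite !inE; apply/negbTE/negP => /andP[/eqP ->
  /eqP ba].
by rewrite ba eqxx in ab.
Qed.

(** With T j the preimage of j this gives Theta, with its complement
    Psi. *)
Lemma gather_morphism Phi (T : 'I_r -> {set 'I_r}) : K_morphism K P P Phi ->
  K_morphism K P P (fun x => mxdiag (fun j => bl j (Phi (blk (T j) x)))).
Proof.
move=> Phim; have KP := prod_group G_group.
apply: (diag_morphism (f := fun j x => bl j (Phi (blk (T j) x)))) => j.
apply: (K_morphism_comp KP KP _ (@proj_morphism _ K _ _ G j)).
exact: (K_morphism_comp KP KP (blk_morphism G_group (T j)) Phim).
Qed.

(** Compatibility with the projections gives the equality, and not only an
    inclusion, between the image of F_i and F_sigma(i). *)
Lemma equivariant_mixing_part Theta (sigma : 'S_r) : K_automorphism K P Theta ->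
  (forall i x, P x ->
    blk (finset.set1 (sigma i)) (Theta x) = Theta (blk (finset.set1 i) x)) ->
  mixing_part K G Theta sigma.
Proof.
move=> ThetaA Tblk; have [Thetam [_ Tinj Tsur]] := ThetaA.
have [ThetaP _ _] := Thetam; have KP := prod_group G_group.
have FP i x : alg_factor G i x -> P x by move/(factorP G_group) => [].
have TF i : set_bij (alg_factor G i) (alg_factor G (sigma i)) Theta.
  split.
  - move=> x /(factorP G_group)[Px xi]; apply/(factorP G_group).
    by split; [exact: ThetaP|rewrite Tblk// xi].
  - move=> x y /set_mem/FP Px /set_mem/FP Py; apply: Tinj; exact/mem_set.
  - move=> y /(factorP G_group)[/Tsur[x Px <-] yi].
    exists (blk (finset.set1 i) x); last by rewrite -Tblk.
    apply/(factorP G_group); rewrite blk_blk finset.setIid.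
    by split=> //; exact: prod_blk.
split=> //; split.
  move=> i; have [Tfun TFinj TFsur] := TF i; split.
    apply/seteqP; split=> [_ [x Fx <-]|]; [exact: Tfun|exact: TFsur].
  exists (fun x => bl (sigma i) (Theta (iota x))).
  have im := inj_morphism G_group i.
  split.
    apply: (K_morphism_comp (G_group i) KP _
      (@proj_morphism _ K _ _ G (sigma i))).
    exact: (K_morphism_comp (G_group i) KP im Thetam).
  split.
  + move=> x /(iota_factor G_group)/Tfun/(factor_iota G_group).
    by case.
  + move=> x y /set_mem Gx /set_mem Gy xy.
    have Fx := iota_factor G_group Gx; have Fy := iota_factor G_group Gy.
    rewrite -(inj_blockK x) -(inj_blockK y); congr (bl i _).
    apply: TFinj; [exact/mem_set|exact/mem_set|].
    have [_ xE] := factor_iota G_group (Tfun _ Fx).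
    have [_ yE] := factor_iota G_group (Tfun _ Fy).
    by rewrite -xE -yE xy.
  + move=> y Gy; have [x Fx xy] := TFsur _ (iota_factor G_group Gy).
    have [Gx xE] := factor_iota G_group Fx.
    by exists (bl i x) => //; rewrite xE xy inj_blockK.
move=> sigma' s'P; apply/permP => i; apply: factor_inj.
have [<- _] := s'P i; have [Tfun _ TFsur] := TF i.
by apply/seteqP; split=> [|_ [x Fx <-]]; [exact: TFsur|exact: Tfun].
Qed.

(** The component of Theta x in F_sigma(i) is that of the image of the i-th
    component of x, and Psi x collects all contributions of the other
    components, which are central. Bijectivity of Theta comes from Theta = Phi
    . Psi^-1 on P, by [central_twist]. *)
Lemma central_mixing Phi : K_automorphism K P Phi ->
  exists Theta Psi (sigma : 'S_r),
    [/\ mixing_part K G Theta sigma, central_part K G Psi sigma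
      & forall x, P x -> Phi x = Theta x *m Psi x].
Proof.
move=> PhiA; have [sigma sP] := factor_permutation PhiA.
have [Phim Phib] := PhiA; have Phie := K_morphism_endo Phim.
have KP := prod_group G_group; have PG := K_group_mx_group KP.
have [P1 PM PV PU] := PG; have [PhiP PhiM] := Phie.
have [_ Z1 ZM _] := alg_center_group KP.
have Phi1 : Phi 1%:M = 1%:M := mx_endo1 PG Phie.
have FP i x : alg_factor G i x -> P x by move/(factorP G_group) => [].
have bl_blk j y : bl j (blk (finset.set1 j) y) = bl j y.
  by rewrite submxblock_diag inE eqxx.
pose t j := (sigma^-1)%g j.
have ts i : t (sigma i) = i by exact: permK.
have st j : sigma (t j) = j by exact: permKV.
pose Theta x := mxdiag (fun j => bl j (Phi (blk (finset.set1 (t j)) x))).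
pose Psi x := mxdiag (fun j => bl j (Phi (blk (~: finset.set1 (t j))%SET x))).
have Thetam : K_morphism K P P Theta.
  exact: (gather_morphism (fun j => finset.set1 (t j)) Phim).
have Psim : K_morphism K P P Psi.
  exact: (gather_morphism (fun j => (~: finset.set1 (t j))%SET) Phim).
have [ThetaP ThetaM _] := Thetam; have [PsiP PsiM _] := Psim.
have PhiE x : P x -> Phi x = Theta x *m Psi x.
  move=> Px; rewrite mxdiagM.
  have /prodP[_ ->] := PhiP _ Px; apply/eq_mxdiagP => j.
  have Pb S : P (blk S x) by exact: prod_blk.
  rewrite -(block_mul _ _ (PhiP _ (Pb _))) -(PhiM _ _ (Pb _) (Pb _)).
  by rewrite -(prod_split (G := G)).
have PsiZ x : P x -> Z (Psi x).
  move=> Px; apply/(center_prodP G_group); split=> [|j]; first exact: PsiP.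
  rewrite submxblock_diag -bl_blk.
  set y := blk (~: finset.set1 (t j))%SET x.
  have [_ Zy] : P y /\ Z (blk (finset.set1 j) (Phi y)).
    rewrite /y; have [] // : [set y | P y /\ Z (blk (finset.set1 j) (Phi y))]
      (blk (~: finset.set1 (t j))%SET x).
    apply: blk_ind => [|a b [Pa Za] [Pb Zb]|i].
    - by rewrite /= Phi1 blk_1.
    - split; first exact: PM.
      rewrite PhiM// (prod_blkM G_group); [exact: ZM|exact: PhiP|exact: PhiP].
    - rewrite !inE => it.
      have Fi : alg_factor G i (blk (finset.set1 i) x).
        apply/(factorP G_group); rewrite blk_blk finset.setIid.
        by split=> //; exact: prod_blk.
      split; first exact: FP Fi.
      rewrite -(@blk_blkC1 j (sigma i)); first by apply: blk_center; exact: sP.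
      by apply: contra it => /eqP ->; rewrite ts.
  by move/(center_prodP G_group): Zy => -[_].
have PsivZ x : P x -> Z (invmx (Psi x)).
  by move=> Px; have [_ _ _] := alg_center_group KP; apply; exact: PsiZ.
have ThetaE x : P x -> Theta x = Phi x *m invmx (Psi x).
  by move=> Px; rewrite PhiE// mulmxK//; apply: PU; exact: PsiP.
have Thetab : set_bij P P Theta.
  have Psivm := K_endomorphism_inv G_group Psim PsiZ.
  have [_ [_ inj surj]] :=
    central_twist G_group G_nonabelian G_indec G_center PhiA Psivm PsivZ.
  split.
  - exact: ThetaP.
  - move=> x y Px Py; rewrite (ThetaE _ (set_mem Px)) (ThetaE _ (set_mem Py)).
    exact: (inj x y Px Py).
  - move=> y /surj[x Px xy]; exists x; first exact: Px.
    by rewrite (ThetaE _ Px).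
have Tblk i x : P x ->
    blk (finset.set1 (sigma i)) (Theta x) = Theta (blk (finset.set1 i) x).
  move=> Px; rewrite blkE; apply/eq_mxdiagP => j; rewrite inE blk_blk.
  have [->|ne] := eqVneq j (sigma i); first by rewrite ts finset.setIid.
  rewrite (_ : (_ :&: _)%SET = finset.set0) ?blk_set0 ?Phi1 -?mxdiag1
    ?submxblock_diag//.
  apply/finset.setP => k; rewrite !inE; apply/negbTE/negP => /andP[/eqP ->
    /eqP ti].
  by rewrite -ti st eqxx in ne.
exists Theta, Psi, sigma; split=> //.
- exact: equivariant_mixing_part.
- split=> // [_ [x Px <-]|i]; first exact: PsiZ.
  have F1 : alg_factor G i 1%:M by apply/(factorP G_group); rewrite blk_1.
  have PsiF x : alg_factor G i x -> bl (sigma i) (Psi x) = 1%:M.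
    move=> /(factorP G_group)[Px xi]; rewrite submxblock_diag ts -xi blk_blk.
    rewrite (_ : (_ :&: _)%SET = finset.set0); last first.
      by apply/finset.setP => k; rewrite !inE andNb.
    by rewrite blk_set0 Phi1 -mxdiag1 submxblock_diag.
  apply/seteqP; split=> [_ [_ [x Fx <-] <-]|_ ->]; first exact: PsiF.
  by exists (Psi 1%:M); [exists 1%:M|exact: PsiF].
Qed.

End CentralMixing.

Theorem theoremB (R : realType) (K : divringClosed R[i]) (r : nat)
    (n : 'I_r -> nat) (G : forall i : 'I_r, set 'M[R[i]]_(n i))
    (G_group : forall i, K_group K (G i))
    (G_connected : forall i, zariski_connected (G i))
    (G_nonabelian : forall i, ~ abelian_set (G i))
    (G_indecomposable : forall i, K_indecomposable K (G i))
    (G_center : forall i, torsion_free (alg_center (G i))) :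
  (forall Phi : 'M[R[i]]_(\sum_i n i) -> 'M[R[i]]_(\sum_i n i),
      K_automorphism K (alg_product G) Phi ->
      exists (Theta Psi : 'M[R[i]]_(\sum_i n i) -> 'M[R[i]]_(\sum_i n i))
             (sigma : 'S_r),
        [/\ mixing_part K G Theta sigma,
            central_part K G Psi sigma
          & forall x, alg_product G x -> Phi x = Theta x *m Psi x]) /\
  (forall (Theta Psi : 'M[R[i]]_(\sum_i n i) -> 'M[R[i]]_(\sum_i n i))
          (sigma : 'S_r),
      mixing_part K G Theta sigma ->
      central_part K G Psi sigma ->
      K_automorphism K (alg_product G) (fun x => Theta x *m Psi x)).
Proof.
split=> [Phi PhiA|Theta Psi sigma [ThetaA _] [Psim PsiZ _]].
  exact: central_mixing.
apply: central_twist => // x Px; apply: PsiZ.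
by exists x.
Qed.
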